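(* Let $m\geq 1$ be an integer, let $\mathscr{F}=\mathscr{F}^{(m)}_{2m}(x)$, let $$P=\{(a,b)\in\mathbb{Z}^{2}\mid a,b\geq 0,\ a+b=2m,\ a-b\equiv 0 \bmod 4\},$$ and let $\beta(a)=\frac{a}{2m}\binom{2m}{a}$. For $n\ge 1$ let $\log_{\geq n}(u)=\sum_{k\geq n}u^{k}/k$, the power series of $\log(1/(1-u))$ with the terms of degree $<n$ omitted. Then the genus $1$ series of the hypergraph matrix model is $$\mathscr{G}^{(m)}_{1}(x)=\frac{\mathscr{F}}{2m}+\frac{\langle (z\bar z)^{2m}\rangle_{m}\,\mathscr{F}^{2}}{4m}+\frac{1}{2m}\,\frac{(\beta(m)\mathscr{F})^{3}}{1-\beta(m)\mathscr{F}}+\sum_{\substack{(a,b)\in P\\ a\neq b}}\frac{1}{2(a-b)}\Bigl(\log_{\geq 3}\bigl(\beta(a)\mathscr{F}\bigr)-\log_{\geq 3}\bigl(\beta(b)\mathscr{F}\bigr)\Bigr),$$ where the moment $\langle (z\bar z)^{2m}\rangle_{m}$ is computed using the nonloop normalization.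
   Context: **Generalized Wick numbers.** For integers $j\geq 1$, $k\geq 0$ with $j\mid k$ let $W_{j}(k)=\dfrac{k!}{(j!)^{k/j}(k/j)!}$, the number of set partitions of $\{1,\dots,k\}$ into blocks of size $j$ (so $W_j(0)=1$). **Moments.** Fix $m\ge 1$. *Loop normalization:* $\langle x^{k}\rangle_{m}=W_{2m}(k)$ if $2m\mid k$ and $0$ otherwise. *Nonloop normalization:* for real variables $x,y$, $\langle x^{k}\rangle_{m}=\langle y^{k}\rangle_{m}=W_{2m}(k)/2^{k/(2m)}$ if $2m\mid k$ and $0$ otherwise, $\langle x^{k}y^{l}\rangle_{m}=\langle x^{k}\rangle_{m}\langle y^{l}\rangle_{m}$, extended linearly to polynomials in $z=x+\sqrt{-1}\,y$ and $\bar z=x-\sqrt{-1}\,y$. **Hypergraph matrix model.** Let $X=(X_{ij})$ be an $N\times N$ Hermitian matrix of variables, $X_{ii}=x_{ii}$, and $X_{ij}=x_{ij}+\sqrt{-1}\,y_{ij}$, $X_{ji}=x_{ij}-\sqrt{-1}\,y_{ij}$ for $i<j$, in $N^{2}$ independent real coordinates. Let $\langle\,\cdot\,\rangle_{m}$ be the $\mathbb{C}$-linear functional on polynomials in these coordinates that is multiplicative over distinct coordinates (product measure), with the powers of each diagonal coordinate $x_{ii}$ evaluated in the loop normalization and the powers of each $x_{ij},y_{ij}$ ($i<j$) evaluated in the nonloop normalization. For $r\geq 1$ put $P^{(m)}_{2mr}(N)=\langle \mathrm{Tr}\,X^{2mr}\rangle_{m}$; it is known that this is an integral polynomial in $N$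 of degree $r+1$. **The series $\mathscr{G}^{(m)}_{g}$.** Let $(N)_{k}=N(N-1)\cdots(N-k+1)$. For $r\geq 1$ write $$\frac{1}{2mr}P^{(m)}_{2mr}(N)=\sum_{l=0}^{r+1}\alpha^{(m)}_{l,r}\,(N)_{r+1-l}.$$ For $g\ge 1$ put $\mathscr{G}^{(m)}_{g}(x)=\sum_{v\geq 1}\alpha^{(m)}_{g,g-1+v}x^{v}\in\mathbb{Q}[[x]]$. **The tree functions $\mathscr{F}^{(m)}_{s}$.** Let $X$ be a plane tree (rooted, with children ordered) on $mv+1$ vertices, and for $i\ge 1$ let $X_{i}$ be the set of vertices at distance $i$ from the root. Let $L$ be a set of $v$ labels. An admissible $m$-labeling of $X$ consists of a decomposition of each $X_{i}$, $i\geq 1$, into disjoint subsets of order $m$, together with an assignment of distinct labels from $L$ to all these subsets, such that whenever two vertices have the same label, the labels of their parents agree (the root is unlabeled, so this is no condition on children of the root). Labelings that differ by a permutation of $L$ are considered the same. For $s\geq 1$, let $C^{(m)}_{v,s}$ be the number of pairs $(X,\xi)$ where $X$ is an admissibly $m$-labeled plane tree with $mv+1$ vertices, and $\xi$ is a composition of $d$ into $s$ parts (an $s$-tuple of nonnegative integers with sum $d$), $d$ being the number of children of the root of $X$. Put $\mathscr{F}^{(m)}_{s}(x)=\sum_{v\geq 0}C^{(m)}_{v,s}x^{v+1}$. *)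

(* Defs.v *)
From HB Require Import structures.
From mathcomp Require Import all_boot all_order all_algebra.
From mathcomp Require Import perm boolp mpoly.

Set Implicit Arguments.
Unset Strict Implicit.
Unset Printing Implicit Defensive.

Import Order.TTheory GRing.Theory Num.Theory.
Local Open Scope ring_scope.

Record fps (R : Type) := Fps { fcoef :> nat -> R }.

Lemma fpsP (R : Type) (f g : fps R) : f =1 g -> f = g.
Proof. by case: f g => [f] [g] /= /funext ->. Qed.

HB.instance Definition _ (R : Type) := gen_eqMixin (fps R).
HB.instance Definition _ (R : Type) := gen_choiceMixin (fps R).

Section FpsZmod.
Variable R : zmodType.
Implicit Types f g : fps R.

Definition fps_zero : fps R := Fps (fun=> 0).
Definition fps_opp f := Fps (fun n => - f n).
Definition fps_add f g := Fps (fun n => f n + g n).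

Fact fps_addA : associative fps_add.
Proof. by move=> f g h; apply: fpsP => n /=; rewrite addrA. Qed.
Fact fps_addC : commutative fps_add.
Proof. by move=> f g; apply: fpsP => n /=; rewrite addrC. Qed.
Fact fps_add0 : left_id fps_zero fps_add.
Proof. by move=> f; apply: fpsP => n /=; rewrite add0r. Qed.
Fact fps_addN : left_inverse fps_zero fps_opp fps_add.
Proof. by move=> f; apply: fpsP => n /=; rewrite addNr. Qed.

HB.instance Definition _ := GRing.isZmodule.Build (fps R)
  fps_addA fps_addC fps_add0 fps_addN.
End FpsZmod.

Section FpsRing.
Variable R : comNzRingType.
Implicit Types f g : fps R.

Definition fps_one : fps R := Fps (fun n => (n == 0%N)%:R).
Definition fps_mul f g := Fps (fun n => \sum_(j < n.+1) f j * g (n - j)%N).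
Definition fps_scale (c : R) f := Fps (fun n => c * f n).

Let trunc N f : {poly R} := \poly_(i < N) f i.

Let truncE N f i : (i < N)%N -> (trunc N f)`_i = f i.
Proof. by move=> iN; rewrite coef_poly iN. Qed.

Let fps_mulE N f g n : (n < N)%N -> fps_mul f g n = (trunc N f * trunc N g)`_n.
Proof.
move=> nN; rewrite coefM /=; apply: eq_bigr => j _.
by rewrite !truncE ?(leq_ltn_trans (leq_subr _ _) nN) ?(leq_ltn_trans _ nN) // -ltnS.
Qed.

Fact fps_mulC : commutative fps_mul.
Proof. by move=> f g; apply: fpsP => n; rewrite !(@fps_mulE n.+1) // mulrC. Qed.

Fact fps_mulA : associative fps_mul.
Proof.
move=> f g h; apply: fpsP => n.
transitivity ((trunc n.+1 f * (trunc n.+1 g * trunc n.+1 h))`_n).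
  rewrite coefM; apply: eq_bigr => j _; rewrite truncE //.
  by rewrite (@fps_mulE n.+1) // ltnS leq_subr.
rewrite mulrA coefM; apply: eq_bigr => j _.
by rewrite (@fps_mulE n.+1) // truncE // ltnS leq_subr.
Qed.

Fact fps_mul1 : left_id fps_one fps_mul.
Proof.
move=> f; apply: fpsP => n /=; rewrite big_ord_recl /= mul1r subn0.
by rewrite big1 ?addr0 // => j _; rewrite mul0r.
Qed.

Fact fps_mulDl : left_distributive fps_mul (@fps_add R).
Proof.
move=> f g h; apply: fpsP => n /=; rewrite -big_split.
by apply: eq_bigr => j _; rewrite /= mulrDl.
Qed.

Fact fps_one_neq0 : fps_one != 0.
Proof.
by apply/eqP => /(congr1 (fun f : fps R => f 0%N)) /eqP /=; rewrite oner_eq0.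
Qed.

HB.instance Definition _ := GRing.Zmodule_isComNzRing.Build (fps R)
  fps_mulA fps_mulC fps_mul1 fps_mulDl fps_one_neq0.

Fact fps_scaleA a b f : fps_scale a (fps_scale b f) = fps_scale (a * b) f.
Proof. by apply: fpsP => n /=; rewrite mulrA. Qed.
Fact fps_scale1 : left_id 1 fps_scale.
Proof. by move=> f; apply: fpsP => n /=; rewrite mul1r. Qed.
Fact fps_scaleDr : right_distributive fps_scale +%R.
Proof. by move=> a f g; apply: fpsP => n /=; rewrite mulrDr. Qed.
Fact fps_scaleDl f : {morph fps_scale^~ f : a b / a + b}.
Proof. by move=> a b; apply: fpsP => n /=; rewrite mulrDl. Qed.

HB.instance Definition _ := GRing.Zmodule_isLmodule.Build R (fps R)
  fps_scaleA fps_scale1 fps_scaleDr fps_scaleDl.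

Definition fps_unit : pred (fps R) := fun f => `[< exists g, g * f = 1 >].
Definition fps_inv f : fps R :=
  if pselect (exists g, g * f = 1) is left fU then sval (cid fU) else f.

Fact fps_mulV : {in fps_unit, left_inverse 1 fps_inv *%R}.
Proof.
move=> f; rewrite unfold_in => /asboolP fU; rewrite /fps_inv.
by case: pselect => // ?; case: cid.
Qed.
Fact fps_unitP f g : g * f = 1 -> fps_unit f.
Proof. by move=> gf1; apply/asboolP; exists g. Qed.
Fact fps_inv_out : {in [predC fps_unit], fps_inv =1 id}.
Proof.
move=> f; rewrite inE unfold_in => /asboolP fU; rewrite /fps_inv.
by case: pselect => // /fU.
Qed.

HB.instance Definition _ := GRing.ComNzRing_hasMulInverse.Build (fps R)
  fps_mulV fps_unitP fps_inv_out.

(* Substitution [sum_k c_k u^k]; meaningful only if u has zero constant term,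
   in which case u^k has no term of degree n for k > n. *)
Definition fps_comp (c : nat -> R) (u : fps R) : fps R :=
  Fps (fun n => \sum_(k < n.+1) c k * (u ^+ k) n).

Lemma fps_exp_small (u : fps R) k n : u 0%N = 0 -> (n < k)%N -> (u ^+ k) n = 0.
Proof.
move=> u0; elim: k n => // k IHk n nk; rewrite exprS.
rewrite [LHS]/= big_ord_recl /= u0 mul0r add0r big1 // => j _.
rewrite IHk ?mulr0 // -ltnS (leq_trans _ nk) // !ltnS ltn_subrL /=.
exact: leq_ltn_trans (ltn_ord j).
Qed.

Lemma fps_sumE (I : Type) (s : seq I) (F : I -> fps R) n :
  (\sum_(i <- s) F i) n = \sum_(i <- s) F i n.
Proof. by elim: s => [|i s IHs]; rewrite ?big_nil ?big_cons //= IHs. Qed.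

Lemma fps_geom (u : fps R) : u 0%N = 0 -> (1 - u) * fps_comp (fun=> 1) u = 1.
Proof.
move=> u0; apply: fpsP => n.
have E j : (j < n.+1)%N ->
    fps_comp (fun=> 1) u j = (\sum_(0 <= k < n.+1) u ^+ k) j.
  move=> jn; rewrite fps_sumE (@big_cat_nat _ _ _ j.+1) //=.
  rewrite [X in _ + X]big_nat_cond [X in _ + X]big1 ?addr0; last first.
    by move=> k /andP[/andP[jk _] _]; rewrite fps_exp_small.
  by rewrite big_mkord; apply: eq_bigr => k _; rewrite mul1r.
transitivity (((1 - u) * \sum_(0 <= k < n.+1) u ^+ k) n).
  by apply: eq_bigr => j _; rewrite E // ltnS leq_subr.
rewrite big_mkord -(opprB u 1) mulNr -subrX1 opprB.
change ((1 : fps R) n - (u ^+ n.+1) n = (1 : fps R) n).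
by rewrite fps_exp_small // subr0.
Qed.
End FpsRing.

Arguments fps_comp {R} c u.

Definition fps_map (R S : Type) (phi : R -> S) (f : fps R) : fps S :=
  Fps (fun n => phi (f n)).

(* [log_{>= n}(u)], for u with zero constant term *)
Definition fps_log_ge (K : fieldType) (n : nat) (u : fps K) : fps K :=
  fps_comp (fun k => if (n <= k)%N then k%:R^-1 else 0) u.

Definition wick (K : fieldType) (j k : nat) : K :=
  k`!%:R / (j`!%:R ^+ (k %/ j) * (k %/ j)`!%:R).

Definition loop_moment (K : fieldType) (m k : nat) : K :=
  if (2 * m %| k)%N then wick K (2 * m) k else 0.

Definition nonloop_moment (K : fieldType) (m k : nat) : K :=
  if (2 * m %| k)%N then wick K (2 * m) k / 2%:R ^+ (k %/ (2 * m)) else 0.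

(* The linear functional on polynomials in n variables that is multiplicative
   over distinct variables and sends the k-th power of 'X_t to [mu t k]. *)
Definition product_functional (K : fieldType) (n : nat)
    (mu : 'I_n -> nat -> K) (p : {mpoly K[n]}) : K :=
  \sum_(e <- msupp p) p@_e * \prod_(t < n) mu t (e t).

Section MatrixModel.
Variable C : numClosedFieldType.
Variable m : nat.

(* <(z zbar)^k>_m, where x and y are the variables number 0 and 1 *)
Definition zzbar_moment (k : nat) : C :=
  let x : {mpoly C[2]} := 'X_ord0 in
  let y : {mpoly C[2]} := 'X_ord_max in
  product_functional (fun=> nonloop_moment C m)
    (((x + 'i *: y) * (x - 'i *: y)) ^+ k).

(* The N^2 real coordinates are the variables of {mpoly C[N * N]}: the entry
   (i, j) of [coord N] is x_ij if i <= j and it is y_ji if j < i. *)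
Definition coord (N : nat) (i j : 'I_N) : {mpoly C[N * N]} :=
  'X_(mxvec_index i j).

Definition hermitian_mx (N : nat) : 'M[{mpoly C[N * N]}]_N :=
  \matrix_(i, j)
    if i == j then coord i i
    else if (i < j)%N then coord i j + 'i *: coord j i
    else coord j i - 'i *: coord i j.

Definition coord_moment (N : nat) : 'I_(N * N) -> nat -> C :=
  mxvec (\matrix_(i < N, j < N)
    if i == j then loop_moment C m else nonloop_moment C m) 0.

(* P^{(m)}_k at the natural number N *)
Definition trace_moment (k N : nat) : C :=
  product_functional (@coord_moment N) (\tr (hermitian_mx N ^+ k)).

(* [a l], for 0 <= l <= r+1, is the coefficient of (N)_{r+1-l} in the expansion
   of P^{(m)}_{2mr}(N) / 2mr; these coefficients are unique since the identity
   holds for infinitely many N. *)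
Definition falling_expansion (r : nat) (a : nat -> rat) : Prop :=
  forall N : nat, (0 < N)%N ->
    (2 * m * r)%:R^-1 * trace_moment (2 * m * r) N =
      \sum_(l < r.+2) ratr (a l) * (N ^_ (r.+1 - l))%:R.

(* The default value 0 is not used: for r >= 1 the expansion exists because
   P^{(m)}_{2mr} is an integral polynomial of degree r+1. *)
Definition alpha (l r : nat) : rat :=
  if pselect (exists a, falling_expansion r a) is left aP then sval (cid aP) l
  else 0.

Definition genus_series (g : nat) : fps rat :=
  Fps (fun v => if v == 0%N then 0 else alpha g (g.-1 + v)).

End MatrixModel.

Inductive ptree := PNode of seq ptree.

Definition children (X : ptree) : seq ptree := let: PNode ts := X in ts.

Lemma ptree_ind' (Q : ptree -> Prop) :
  (forall ts, foldr (fun t => and (Q t)) True ts -> Q (PNode ts)) ->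
  forall X, Q X.
Proof.
move=> QN; fix IH 1 => -[ts]; apply: QN.
by elim: ts => [|t ts IHts] //=; split.
Qed.

Fixpoint ptree_enc (X : ptree) : GenTree.tree unit :=
  let: PNode ts := X in GenTree.Node 0 (map ptree_enc ts).
Fixpoint ptree_dec (T : GenTree.tree unit) : ptree :=
  if T is GenTree.Node _ ts then PNode (map ptree_dec ts) else PNode [::].
Fact ptree_encK : cancel ptree_enc ptree_dec.
Proof.
elim/ptree_ind' => ts IH /=; congr PNode.
by elim: ts IH => //= t ts IHts [-> /IHts ->].
Qed.
HB.instance Definition _ := Countable.copy ptree (can_type ptree_encK).

(* A vertex is the sequence of child indices along the path from the vertex up
   to the root, so that the root is [::], [behead] is the parent map, and
   [size] is the distance to the root. *)
Fixpoint vertices (X : ptree) : seq (seq nat) :=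
  let: PNode ts := X in
  [::] :: flatten [seq [seq rcons w iV.1 | w <- iV.2]
                     | iV <- zip (iota 0 (size ts)) (map vertices ts)].

Lemma size_vertices ts :
  size (vertices (PNode ts)) = (sumn [seq size (vertices t) | t <- ts]).+1.
Proof.
rewrite /=; congr _.+1; move: 0%N.
by elim: ts => //= t ts IH i; rewrite size_cat size_map IH.
Qed.

Lemma vertices_uniq X : uniq (vertices X).
Proof.
elim/ptree_ind': X => ts IH /=.
set V := fun i => flatten [seq [seq rcons w iV.1 | w <- iV.2]
                     | iV <- zip (iota i (size ts)) (map vertices ts)].
rewrite -/(V 0%N).
have VP i w : w \in V i -> exists j u, (i <= j)%N /\ w = rcons u j.
  rewrite /V; elim: (ts) i => //= t us IHus i; rewrite mem_cat => /orP[].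
    by case/mapP => u _ ->; exists i, u.
  by case/IHus => j [u [ij ->]]; exists j, u; split=> //; apply: ltnW.
apply/andP; split.
  by apply/negP => /VP[j [u [_ /(congr1 size)]]]; rewrite size_rcons.
rewrite {VP}/V; move: 0%N; elim: ts IH => //= t us IHus [tU usU] i.
rewrite cat_uniq map_inj_uniq ?tU; last by move=> u w /rcons_inj[].
rewrite IHus // andbT /=; apply/hasPn => w wV.
apply/negP => /mapP[u _ wE]; move: wV; rewrite {}wE.
suff: forall k, (i < k)%N -> rcons u i \notin
   flatten [seq [seq rcons w iV.1 | w <- iV.2]
                     | iV <- zip (iota k (size us)) (map vertices us)].
  by move=> /(_ i.+1 (ltnSn i)) /negbTE ->.
elim: {IHus usU} us => //= t' us IH k ik.
rewrite mem_cat negb_or IH ?(ltnW ik) // ?andbT; last exact: ltnW.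
by apply/negP => /mapP[u' _ /rcons_inj[_ ki]]; rewrite ki ltnn in ik.
Qed.

Record plane_tree (n : nat) :=
  PlaneTree { ptree_of :> ptree; _ : size (vertices ptree_of) == n }.
HB.instance Definition _ n := [isSub for @ptree_of n].
HB.instance Definition _ n := [Countable of plane_tree n by <:].

(* All plane forests on n vertices, provided n <= fuel *)
Fixpoint forests (fuel n : nat) : seq (seq ptree) :=
  if n == 0%N then [:: [::]]
  else if fuel is fuel'.+1 then
    flatten [seq [seq PNode ts :: us | ts <- forests fuel' i,
                                       us <- forests fuel' (n.-1 - i)]
               | i <- iota 0 n]
  else [::].

Lemma mem_forests fuel ts :
  (sumn [seq size (vertices t) | t <- ts] <= fuel)%N ->
  ts \in forests fuel (sumn [seq size (vertices t) | t <- ts]).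
Proof.
elim: fuel ts => [|fuel IH] [|[ts] us] //.
set a := sumn [seq size (vertices t) | t <- ts].
set b := sumn [seq size (vertices t) | t <- us].
have -> : sumn [seq size (vertices t) | t <- PNode ts :: us] = (a + b).+1.
  by rewrite -addSn -size_vertices.
rewrite ltnS => ab.
apply/flattenP; exists [seq PNode ts' :: us' | ts' <- forests fuel a,
                                     us' <- forests fuel b].
  apply/mapP; exists a; last by rewrite addKn.
  by rewrite mem_iota ltnS leq_addr.
apply: (allpairs_f (fun x y => PNode x :: y)).
  by apply: IH; apply: leq_trans ab; apply: leq_addr.
by apply: IH; apply: leq_trans ab; apply: leq_addl.
Qed.

Definition plane_tree_enum (n : nat) : seq (plane_tree n) :=
  undup (pmap insub [seq PNode ts | ts <- forests n n.-1]).

Fact plane_tree_enumP n : Finite.axiom (plane_tree_enum n).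
Proof.
apply: Finite.uniq_enumP => [|X]; first exact: undup_uniq.
rewrite mem_undup mem_pmap_sub [RHS]inE; apply/mapP.
case: X => -[ts] Xn; exists ts => //; move: Xn.
rewrite size_vertices => /eqP <-; exact: mem_forests.
Qed.
HB.instance Definition _ n := isFinite.Build (plane_tree n) (@plane_tree_enumP n).

Definition nonroot (X : ptree) := seq_sub [seq w <- vertices X | w != [::]].

Section Labelings.
Variables (m v : nat) (X : ptree).
Implicit Types f : {ffun nonroot X -> 'I_v}.

(* [None] for the root, which is unlabeled *)
Definition label f (w : seq nat) : option 'I_v := omap f (insub w).

(* The subsets of order m into which the levels are decomposed are the fibers
   of f; distinct subsets have distinct labels, hence equal labels imply equal
   levels. *)
Definition admissible f : bool :=
  [&& [forall c, (f @^-1: [set c] == set0) || (#|f @^-1: [set c]| == m)],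
      [forall u, forall w, (f u == f w) ==> (size (val u) == size (val w))]
    & [forall u, forall w, (f u == f w) ==>
         (label f (behead (val u)) == label f (behead (val w)))]].

Definition same_labeling : rel {ffun nonroot X -> 'I_v} :=
  fun f g => [exists s : {perm 'I_v}, g == [ffun w => s (f w)]].

Definition labelings : {set {set {ffun nonroot X -> 'I_v}}} :=
  equivalence_partition same_labeling [set f | admissible f].

End Labelings.

Definition compositions (d s : nat) : {set {ffun 'I_s -> 'I_d.+1}} :=
  [set xi : {ffun 'I_s -> 'I_d.+1} | (\sum_i xi i)%N == d].

Definition tree_count (m v s : nat) : nat :=
  \sum_(X : plane_tree (m * v).+1)
     #|labelings m v X| * #|compositions (size (children X)) s|.

Definition tree_series (K : fieldType) (m s : nat) : fps K :=
  Fps (fun n => if n is v.+1 then (tree_count m v s)%:R else 0).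

Definition index_pair (m a b : nat) : bool :=
  (a + b == 2 * m)%N && (4 %| a%:Z - b%:Z)%Z.

Definition beta (K : fieldType) (m a : nat) : K :=
  a%:R / (2 * m)%:R * 'C(2 * m, a)%:R.

(* Main.v *)
(** The trace of X^n is a sum over closed walks of length n on the indices, and the
    moment of a walk depends only on its step counts; it vanishes unless every
    unordered pair is crossed a multiple of 2m times.  For n = 2mr, the coefficient
    of (N)_r collects the walks with r vertices.  Counting crossings in units of 2m,
    such a walk traces a connected multigraph with r vertices and r edges, that is,
    the edges x -- f x of a function f with a single cycle, and f is determined up to
    the direction of the cycle if the cycle has length at least 3.  The edges off the
    cycle are crossed m times in each direction, those of the cycle a times along f
    and b = 2m - a times against it.  The BEST theorem counts the closed walks with
    these step counts.  The count is a product over vertices, so that the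
    exponential formula turns the sum over all f with a k-cycle into a constant times
    the k-th power of the series of trees hanging from one vertex of the cycle.  The
    BEST theorem, applied now to depth-first tours, shows that this series counts
    labelled plane trees.  Summing over k gives the geometric series (from a = b) and
    the logarithms (from a <> b, by a^k - b^k = (a - b) sum_j a^(k-1-j) b^j). *)

Require Import Defs.
From mathcomp Require Import all_boot all_order all_algebra.
From mathcomp Require Import perm boolp mpoly zify ring.

Set Implicit Arguments.
Unset Strict Implicit.
Unset Printing Implicit Defensive.

Import Order.TTheory GRing.Theory Num.Theory.

(** * The BEST theorem *)

(** Connectivity is never proved as such: the existence of one closed walk makes the left side of
    the BEST identity positive, so some arborescence has nonzero weight, and this spanning tree
    bounds the number of vertices and yields f. Cycles of length 1 and 2 are the obstacle. There
    both directions of the cycle fall on the same entries, only a + b = 2m is visible, and the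
    moments differ: 1 for a loop, <(z zbar)^(2m)> for a double edge. These cycles are treated with a
    = 2m, b = 0 and give the terms in F and F^2; hence the logarithms start in degree 3. On longer
    cycles an edge has moment 1 or 0 according to a - b mod 4. The parameter s = 2m of F arises
    because BEST gives a cycle vertex with d preimages off the cycle the factor (2m - 1 + md)!,
    while the root of a depth-first tour gets (md)!; the quotient, divided by (2m - 1)!, counts the
    compositions of md children into 2m parts. What is left at each cycle vertex is (2m - 1)!/(a!
    b!) = binom(2m, a)/2m. Together with the factors a and b of the arborescences of the cycle it
    becomes beta(a) and beta(b). *)

Section Arborescences.
Variable V : finType.
Implicit Types (t : {ffun V -> V}) (k : V -> V -> nat) (u v w z : V).

Definition upd t w y : {ffun V -> V} := [ffun u => if u == w then y else t u].

(** The spanning trees directed towards [z], as parent maps; the root is its own parent. *)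
Definition arbs z : {set {ffun V -> V}} :=
  [set t : {ffun V -> V} | (t z == z) && [forall u, fconnect t u z]].

Lemma arbsP z t :
  reflect (t z = z /\ forall u, fconnect t u z) (t \in arbs z).
Proof.
by rewrite inE; apply: (iffP andP) => -[/eqP ? /forallP ?].
Qed.

Definition arb_sum z k := \sum_(t in arbs z) \prod_(u | u != z) k u (t u).

(** For [w != z], [arb_sum] is linear in the row [w] of [k], and this is the coefficient of
    [k w j]. *)
Definition arb_sum_via z k w j :=
  \sum_(t in arbs z | t w == j) \prod_(u | (u != z) && (u != w)) k u (t u).

Lemma eq_arb_sum z k k' :
  (forall u v, u != z -> k u v = k' u v) -> arb_sum z k = arb_sum z k'.
Proof.
by move=> E; apply: eq_bigr => t _; apply: eq_bigr => u uz; rewrite E.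
Qed.

Lemma eq_arb_sum_via z k k' w j :
    (forall u v, u != z -> u != w -> k u v = k' u v) ->
  arb_sum_via z k w j = arb_sum_via z k' w j.
Proof.
by move=> E; apply: eq_bigr => t _; apply: eq_bigr => u /andP[uz uw]; rewrite E.
Qed.

Lemma arb_sum_row z k w : w != z ->
  arb_sum z k = \sum_j k w j * arb_sum_via z k w j.
Proof.
move=> wz; rewrite /arb_sum (partition_big (fun t : {ffun V -> V} => t w) predT) //=.
apply: eq_bigr => j _; rewrite big_distrr /=; apply: eq_bigr => t /andP[_ /eqP tw].
by rewrite (bigD1 w) //= tw.
Qed.

Lemma iter_avoid t t' w u n : (forall x, x != w -> t x != w) ->
  (forall x, x != w -> t' x = t x) -> u != w ->
  iter n t' u = iter n t u /\ iter n t u != w.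
Proof.
move=> tw E uw; elim: n => //= n [-> nw]; split; first exact: E.
exact: tw.
Qed.

Lemma arbs_upd z t w y : w != z -> y != w -> (forall x, x != w -> t x != w) ->
  t \in arbs z -> upd t w y \in arbs z.
Proof.
move=> wz yw tw /arbsP[tz tc]; apply/arbsP.
have E x : x != w -> upd t w y x = t x by rewrite ffunE => /negbTE ->.
have H u : u != w -> fconnect (upd t w y) u z.
  move=> uw; have /iter_findex <- := tc u.
  have [<- _] := iter_avoid (findex t u z) tw E uw.
  exact: fconnect_iter.
split; first by rewrite E // eq_sym.
move=> u; have [->|] := eqVneq u w; last exact: H.
by apply: connect_trans (fconnect1 _ _) _; rewrite ffunE eqxx; apply: H.
Qed.

(** No tree of nonzero weight has an edge into [w], so [w] is a leaf and its exit can be redirected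
    at will. *)
Lemma arb_sum_via_swap z k w j y : w != z -> j != w -> y != w ->
  (forall u, u != z -> u != w -> k u w = 0) ->
  arb_sum_via z k w j = arb_sum_via z k w y.
Proof.
move=> wz jw yw k0; rewrite /arb_sum_via.
have R i : i != w -> arb_sum_via z k w i =
   \sum_(t in arbs z | (t w == i) && [forall x, (x != w) ==> (t x != w)])
      \prod_(u | (u != z) && (u != w)) k u (t u).
  move=> iw; rewrite /arb_sum_via big_mkcond [RHS]big_mkcond /=.
  apply: eq_bigr => t _; rewrite andbA; case: ifP => //= /andP[tz /eqP ti].
  case: ifPn => // /forallPn[x].
  rewrite negb_imply negbK => /andP[xw /eqP tx].
  have xz : x != z.
    apply: contraNneq wz => xz; move: tz => /arbsP[tz _].
    by rewrite -tx xz tz.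
  by rewrite (bigD1 x) ?xz //= tx k0 ?mul0n.
rewrite -!/(arb_sum_via _ _ _ _) !R //.
rewrite (reindex_onto (upd^~ w ^~ j) (upd^~ w ^~ y)) /=; last first.
  move=> t /andP[_ /andP[/eqP tw _]]; apply/ffunP => u; rewrite !ffunE.
  by case: eqVneq => // ->.
apply: eq_big => [t|t _]; last first.
  by apply: eq_bigr => u /andP[_ /negbTE uw]; rewrite ffunE uw.
rewrite ffunE eqxx /=.
have A s i : [forall x, (x != w) ==> (upd s w i x != w)] = [forall x, (x != w) ==> (s x != w)].
  by apply: eq_forallb => x; rewrite ffunE; case: eqP.
have B : (upd (upd t w j) w y == t) = (t w == y).
  apply/eqP/eqP => [<-|tw]; first by rewrite ffunE eqxx.
  by apply/ffunP => u; rewrite !ffunE; case: eqVneq => // ->.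
rewrite A B; case: (t w =P y) => //= tw; rewrite ?andbF // !andbT.
have [/forallP H|_] := boolP [forall x, (x != w) ==> (t x != w)]; rewrite ?andbF // !andbT.
have {}H x : x != w -> t x != w by move/implyP: (H x).
rewrite eqxx andbT; apply/idP/idP => [Ht|]; last exact: arbs_upd.
have <- : upd (upd t w j) w y = t by apply/eqP; rewrite B tw.
apply: arbs_upd => // x xw; rewrite ffunE (negbTE xw); exact: H.
Qed.

End Arborescences.

Section Best.
Variable V : finType.
Implicit Types (c : V -> V -> nat) (u v w z : V).

Definition steps w (s : seq V) := pairmap pair w s.

Definition outdeg c u := \sum_v c u v.
Definition indeg c v := \sum_u c u v.

Definition walks n c w : {set n.-tuple V} :=
  [set s : n.-tuple V |
     [forall u, forall v, count_mem (u, v) (steps w s) == c u v]].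

Definition dec_step c w j u v := c u v - ((u == w) && (v == j)).

(** The degree condition satisfied by the step counts of a walk from [w] to [z]. *)
Definition balanced c w z :=
  forall u, outdeg c u + (u == z) = indeg c u + (u == w).

(* The convention at vertices without outgoing steps attaches them to [z], so that
   [best] also holds for walks that miss vertices. *)
Definition exit_weight c z u v : nat :=
  if outdeg c u == 0 then (v == z : nat) else c u v.

Lemma walksP n c w (s : n.-tuple V) :
  reflect (forall u v, count_mem (u, v) (steps w s) = c u v) (s \in walks n c w).
Proof.
rewrite inE; apply: (iffP forallP) => [H u v|H u].
  by move/forallP: (H u) => /(_ v)/eqP.
by apply/forallP => v; rewrite H.
Qed.

Lemma card_walksS n c w :
  #|walks n.+1 c w| = \sum_(j | 0 < c w j) #|walks n (dec_step c w j) j|.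
Proof.
rewrite -sum1_card (partition_big (fun s : n.+1.-tuple V => thead s) predT) //=.
rewrite [RHS]big_mkcond; apply: eq_bigr => j _.
have E (s : n.-tuple V) : ([tuple of j :: s] \in walks n.+1 c w) =
    (0 < c w j) && (s \in walks n (dec_step c w j) j).
  apply/walksP/andP => [H|[c0 /walksP H] u v].
    have c0 : 0 < c w j by rewrite -H /= eqxx.
    by split=> //; apply/walksP => u v; rewrite /dec_step -H /= xpair_eqE
      (eq_sym w) (eq_sym j) addKn.
  rewrite /= -/(steps j s) H /dec_step xpair_eqE (eq_sym w) (eq_sym j).
  by case: andP => [[/eqP-> /eqP->]|]; lia.
case: ifPn => c0; last first.
  apply: big1 => s /andP[sw /eqP sj]; move: sw.
  by rewrite [s]tuple_eta sj E (negbTE c0).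
rewrite -sum1_card (reindex_onto (fun s : n.-tuple V => [tuple of j :: s])
  (fun s => [tuple of behead s])); last first.
  by move=> s /andP[_ /eqP <-]; rewrite -tuple_eta.
apply: eq_bigl => s; rewrite E c0 /= theadE eqxx.
by rewrite andbT; case: (s \in _) => //=; apply/eqP/val_inj.
Qed.

Lemma dec_stepD c w j u v : 0 < c w j ->
  c u v = dec_step c w j u v + ((u == w) && (v == j)).
Proof. by rewrite /dec_step; case: andP => [[/eqP-> /eqP->]|]; lia. Qed.

Lemma sum_pred1 (P : pred V) j : \sum_(v | P v) (v == j : nat) = P j.
Proof.
have [Pj|Pj] := boolP (P j); last first.
  by rewrite big1 // => v; case: eqP => // ->; rewrite (negbTE Pj).
by rewrite (bigD1 j) //= eqxx big1 // => v /andP[_ /negbTE ->].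
Qed.

Lemma outdeg_dec c w j u : 0 < c w j ->
  outdeg c u = outdeg (dec_step c w j) u + (u == w).
Proof.
move=> c0; rewrite /outdeg (eq_bigr _ (fun v _ => dec_stepD u v c0)) big_split /=.
congr (_ + _); case: eqP => _ /=; last by rewrite big1.
by rewrite (sum_pred1 predT).
Qed.

Lemma indeg_dec c w j v : 0 < c w j ->
  indeg c v = indeg (dec_step c w j) v + (v == j).
Proof.
move=> c0; rewrite /indeg (eq_bigr _ (fun u _ => dec_stepD u v c0)) big_split /=.
congr (_ + _); case: eqP => _ /=.
  by under eq_bigr do rewrite andbT; rewrite (sum_pred1 predT).
by rewrite big1 // => u _; rewrite andbF.
Qed.

Lemma balanced_dec c w z j : 0 < c w j -> balanced c w z ->
  balanced (dec_step c w j) j z.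
Proof.
move=> c0 b u; have := b u.
rewrite (outdeg_dec u c0) (indeg_dec u c0); lia.
Qed.

Lemma size_dec c w j : 0 < c w j ->
  \sum_u outdeg c u = (\sum_u outdeg (dec_step c w j) u).+1.
Proof.
move=> c0; rewrite (eq_bigr _ (fun u _ => outdeg_dec u c0)) big_split /=.
by rewrite (sum_pred1 predT) addn1.
Qed.

(** The number of ways to tell parallel steps apart: multiplied by it, the number of walks becomes
    the number of Eulerian trails with labelled edges. *)
Definition entry_fact c := \prod_u \prod_v (c u v)`!.

Lemma entry_fact_dec c w j : 0 < c w j ->
  entry_fact c = c w j * entry_fact (dec_step c w j).
Proof.
move=> c0; rewrite /entry_fact (bigD1 w) //= [in RHS](bigD1 w) //= mulnA.
congr (_ * _); last first.
  apply: eq_bigr => u uw; apply: eq_bigr => v _.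
  by rewrite /dec_step (negbTE uw) subn0.
rewrite (bigD1 j) //= [in RHS](bigD1 j) //= mulnA.
congr (_ * _); last first.
  by apply: eq_bigr => v vj; rewrite /dec_step (negbTE vj) andbF subn0.
by rewrite /dec_step !eqxx /= subn1; case: (c w j) c0.
Qed.

Lemma leq_outdeg c u v : c u v <= outdeg c u.
Proof. by rewrite /outdeg (bigD1 v) //= leq_addr. Qed.
Lemma leq_indeg c u v : c u v <= indeg c v.
Proof. by rewrite /indeg (bigD1 u) //= leq_addr. Qed.

(** The last exit from a vertex other than [z] belongs to the tree, which leaves [(outdeg c u).-1]
    exits to order; at [z] all exits are free. *)
Definition degree_fact c z := (outdeg c z)`! * \prod_(u | u != z) (outdeg c u).-1`!.

(* By balance no step enters [z], so that no tree can lead to [z]. *)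
Lemma arb_sum_isolated c z x : balanced c z z -> outdeg c z = 0 ->
  outdeg c x != 0 -> arb_sum z (exit_weight c z) = 0.
Proof.
move=> b dz dx; have iz : indeg c z = 0 by have := b z; rewrite dz; lia.
apply: big1 => t /arbsP[tz tc]; apply/eqP; rewrite -leqn0 leqNgt; apply/negP => H.
have {}H u : u != z -> outdeg c u != 0 -> 0 < c u (t u).
  move=> uz du; move: H; rewrite (bigD1 u) //= muln_gt0 => /andP[].
  by rewrite /exit_weight (negbTE du).
have act n : outdeg c (iter n t x) != 0.
  elim: n => //= n IH; have nz : iter n t x != z by apply: contraNneq IH => ->; rewrite dz.
  rewrite (addIn (b (t (iter n t x)))) -lt0n.
  exact: leq_trans (H _ nz IH) (leq_indeg c _ _).
by have := act (findex t x z); rewrite iter_findex // dz.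
Qed.

(* The theorem of de Bruijn, van Aardenne-Ehrenfest, Smith and Tutte, by removing
   the first step of the walk. *)
Lemma best n c w z : \sum_u outdeg c u = n -> balanced c w z ->
  #|walks n c w| * entry_fact c =
    arb_sum z (exit_weight c z) * degree_fact c z.
Proof.
elim: n c w => [|n IH] c w.
  move/eqP; rewrite sum_nat_eq0 => /forallP d0 b.
  have {}d0 u : outdeg c u = 0 by apply/eqP; apply: d0.
  have c0 u v : c u v = 0 by have := leq_outdeg c u v; rewrite d0; lia.
  have -> : walks 0 c w = [set [tuple]].
    by apply/setP => s; rewrite tuple0 set11; apply/walksP => u v; rewrite c0.
  rewrite cards1 /entry_fact big1 => [|u _]; last by rewrite big1 // => v _; rewrite c0.
  rewrite /degree_fact d0 big1 => [|u _]; last by rewrite d0.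
  rewrite !muln1 /arb_sum (bigD1 [ffun=> z]) /=; last first.
    apply/arbsP; split=> [|u]; first by rewrite ffunE.
    by apply: connect1; rewrite /= ffunE.
  rewrite big1 => [|u _]; last by rewrite /exit_weight d0 ffunE !eqxx.
  rewrite big1 // => t /andP[/arbsP[tz _] tN].
  have [u uz] : exists u, t u != z.
    apply/existsP; apply: contraR tN; rewrite negb_exists => /forallP H.
    by apply/eqP/ffunP => u; rewrite ffunE; move: (H u); rewrite negbK => /eqP.
  rewrite (bigD1 u) /=; first by rewrite /exit_weight d0 eqxx (negbTE uz).
  by apply: contraNneq uz => ->; rewrite tz.
move=> dn b; rewrite card_walksS big_distrl /=.
have E j : 0 < c w j -> #|walks n (dec_step c w j) j| * entry_fact c =
    c w j * (arb_sum z (exit_weight (dec_step c w j) z) * degree_fact (dec_step c w j) z).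
  move=> c0; rewrite (entry_fact_dec c0) mulnCA (IH _ j) //.
    by apply: succn_inj; rewrite -(size_dec c0).
  exact: balanced_dec.
rewrite (eq_bigr _ E) {E IH}.
rewrite [LHS](_ : _ = \sum_j c w j * (arb_sum z (exit_weight (dec_step c w j) z)
   * degree_fact (dec_step c w j) z)); last first.
  by rewrite big_mkcond; apply: eq_bigr => j _; case: (c w j).
(* If [w = z], the removed step lies in the row of the root, which no tree weight involves; the
   weights [c z j] then add up to [outdeg c z]. *)
have [wz|wz] := eqVneq w z.
  rewrite {}wz in b *.
  have [dz|dz] := eqVneq (outdeg c z) 0.
    rewrite big1 => [|j _]; last by have := leq_outdeg c z j; rewrite dz; case: (c z j).
    have /existsP[x dx] : [exists x, outdeg c x != 0].
      apply: contraPT (dn); rewrite negb_exists => /forallP H.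
      by rewrite big1 // => u _; apply/eqP; rewrite -[_ == _]negbK.
    by rewrite (arb_sum_isolated b dz dx).
  under eq_bigr => j _.
    rewrite [_ * (_ * _)](_ : _ = c z j * (arb_sum z (exit_weight c z) *
      ((outdeg c z).-1`! * \prod_(u | u != z) (outdeg c u).-1`!))); first over.
    have [->//|] := posnP (c z j) => c0; congr (_ * (_ * _)).
      apply: eq_arb_sum => u v uz; rewrite /exit_weight (outdeg_dec u c0).
      by rewrite (negbTE uz) addn0 /dec_step (negbTE uz) subn0.
    rewrite /degree_fact (outdeg_dec z c0) eqxx addn1; congr (_ * _).
    by apply: eq_bigr => u uz; rewrite (outdeg_dec u c0) (negbTE uz) addn0.
  rewrite -big_distrl /= -/(outdeg c z) /degree_fact.
  by case: (outdeg c z) dz => // d _; rewrite factS /=; nia.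
have dw : outdeg c w != 0 by have := b w; rewrite (negbTE wz) eqxx; lia.
(* The walk leaves [w] for good: [w] has no incoming step, hence is a leaf of every contributing
   tree, and its exit can be moved from [j] to the conventional [z]. *)
have [d1|d1] := eqVneq (outdeg c w) 1.
  have iw : indeg c w = 0 by have := b w; rewrite (negbTE wz) eqxx; lia.
  have cw0 u : c u w = 0 by have := leq_indeg c u w; lia.
  have [j c1 cN] : exists2 j, c w j = 1 & forall v, v != j -> c w v = 0.
    have /existsP[j cj] : [exists j, c w j != 0].
      apply: contraNT dw; rewrite negb_exists => /forallP H.
      by rewrite /outdeg big1 // => v _; apply/eqP; rewrite -[_ == _]negbK.
    move: d1; rewrite /outdeg (bigD1 j) //= => d1; exists j; first lia.
    move=> v vj; move: d1; rewrite (bigD1 v) //=; lia.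
  have c0 : 0 < c w j by rewrite c1.
  rewrite (bigD1 j) //= big1 ?addn0 => [|v vj]; last by rewrite cN.
  rewrite c1 mul1n; congr (_ * _); last first.
    rewrite /degree_fact (outdeg_dec z c0) (eq_sym z) (negbTE wz) addn0.
    congr (_ * _); apply: eq_bigr => u _; rewrite (outdeg_dec u c0).
    case: (eqVneq u w) => [->|]; last by rewrite addn0.
    by move: d1; rewrite (outdeg_dec w c0) eqxx; case: (outdeg _ w) => // ; lia.
  have jw : j != w by apply: contraTneq c0 => ->; rewrite cw0.
  have dw' : outdeg (dec_step c w j) w = 0.
    by move: d1; rewrite (outdeg_dec w c0) eqxx; lia.
  have E1 v : exit_weight (dec_step c w j) z w v = (v == z) by rewrite /exit_weight dw'.
  have E2 v : exit_weight c z w v = c w v by rewrite /exit_weight (negbTE dw).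
  rewrite !(@arb_sum_row _ _ _ w) // (bigD1 z) //= big1 => [|v vz].
    rewrite [in RHS](bigD1 j) //= [in RHS]big1 => [|v vj].
      rewrite E1 E2 c1 eqxx.
      rewrite !mul1n !addn0.
      rewrite (@eq_arb_sum_via _ _ _ (exit_weight c z)).
        apply: arb_sum_via_swap => //; first by rewrite eq_sym.
        move=> u uz uw; rewrite /exit_weight cw0.
        by rewrite (negbTE wz); case: eqP.
      move=> u v uz uw; rewrite /exit_weight (outdeg_dec u c0) (negbTE uw) addn0.
      by rewrite /dec_step (negbTE uw) subn0.
    by rewrite E2 cN.
  by rewrite E1 (negbTE vz).
have d2 : 1 < outdeg c w by lia.
pose D := (outdeg c z)`! * ((outdeg c w).-2`! *
   \prod_(u | (u != z) && (u != w)) (outdeg c u).-1`!).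
pose A := arb_sum z (exit_weight c z).
(* Lowering [c w j] by one removes from the tree sum [A] the coefficient of [c w j]. Summed with the
   weights [c w j], this gives [outdeg c w * A - A]; the second conjunct keeps the truncated
   subtraction exact. *)
have key j : c w j * (arb_sum z (exit_weight (dec_step c w j) z) *
      degree_fact (dec_step c w j) z) =
    c w j * (A - arb_sum_via z (exit_weight c z) w j) * D /\
    c w j * arb_sum_via z (exit_weight c z) w j <= c w j * A.
  have [->//|c0] := posnP (c w j).
  have dw' := outdeg_dec w c0; rewrite eqxx in dw'.
  have EA : A = arb_sum z (exit_weight (dec_step c w j) z) +
       arb_sum_via z (exit_weight c z) w j.
    rewrite /A !(@arb_sum_row _ _ _ w) //.
    under [in RHS]eq_bigr => v _.
      rewrite (@eq_arb_sum_via _ _ _ (exit_weight c z)); first over.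
      move=> u x uz uw; rewrite /exit_weight (outdeg_dec u c0) (negbTE uw) addn0.
      by rewrite /dec_step (negbTE uw) subn0.
    rewrite (bigD1 j) //= [in RHS](bigD1 j) //= addnAC; congr (_ + _).
      rewrite /exit_weight (negbTE dw) /dec_step !eqxx /=.
      case: eqP => [|_]; first by rewrite -/(dec_step c w j); lia.
      by rewrite addnC -mulSn; congr (_ * _); lia.
    apply: eq_bigr => v vj; rewrite /exit_weight (negbTE dw) /dec_step.
    case: eqP => [|_]; first by rewrite -/(dec_step c w j); lia.
    by rewrite (negbTE vj) andbF subn0.
  split; last by rewrite EA mulnDr leq_addl.
  rewrite EA addnK -mulnA; congr (_ * (_ * _)).
  rewrite /degree_fact /D (outdeg_dec z c0) (eq_sym z) (negbTE wz) addn0.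
  congr (_ * _); rewrite (bigD1 w) //=; congr (_ * _); first by congr (_`!); lia.
  by apply: eq_bigr => u /andP[_ uw]; rewrite (outdeg_dec u c0) (negbTE uw) addn0.
under eq_bigr => j _ do rewrite (proj1 (key j)).
rewrite -big_distrl /=.
have -> : degree_fact c z = (outdeg c w).-1 * D.
  rewrite /degree_fact /D (bigD1 w) //=.
  by case: (outdeg c w) d2 => [|[|d]] // _; rewrite /= factS; nia.
rewrite mulnA; congr (_ * _).
under eq_bigr => j _ do rewrite mulnBr.
rewrite sumnB => [|j _]; last exact: (proj2 (key j)).
rewrite -big_distrl /= -/(outdeg c w).
rewrite [X in _ - X](_ : _ = A); last first.
  by rewrite /A (@arb_sum_row _ _ _ w) //; apply: eq_bigr => j _;
     rewrite {2}/exit_weight (negbTE dw).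
by rewrite mulnC -{2}[A]muln1 -mulnBr subn1.
Qed.

Lemma steps_zip w s : steps w s = zip (belast w s) s.
Proof. by elim: s w => //= x s IH w; rewrite -IH. Qed.

(** The walk is read cyclically: the step into its first entry comes from its last. *)
Definition cyc_steps (s : seq V) := zip (rotr 1 s) s.

Lemma cyc_steps_cons x s : cyc_steps (x :: s) = steps (last x s) (x :: s).
Proof. by rewrite steps_zip /cyc_steps {1}lastI rotr1_rcons. Qed.

Lemma cyc_steps_rot k s : cyc_steps (rot k s) = rot k (cyc_steps s).
Proof.
rewrite /cyc_steps -rot_rotr; have : size (rotr 1 s) = size s by rewrite size_rotr.
move: (rotr 1 s) => t st; have [sk|ks] := leqP (size s) k.
  by rewrite !rot_oversize // ?size_zip ?st ?minnn.
have sz : size (take k t) = size (take k s) by rewrite !size_take st.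
rewrite -[in RHS](cat_take_drop k t) -[in RHS](cat_take_drop k s) zip_cat //.
have := rot_size_cat (zip (take k t) (take k s)) (zip (drop k t) (drop k s)).
rewrite size_zip sz minnn size_takel ?(ltnW ks) // => ->.
by rewrite /rot zip_cat // !size_drop st.
Qed.

Lemma sum_count_snd (e : seq (V * V)) v :
  \sum_u count_mem (u, v) e = count_mem v (unzip2 e).
Proof.
elim: e => [|[x y] e IH] /=; first by rewrite big1.
rewrite big_split /= IH; congr (_ + _).
under eq_bigr do rewrite xpair_eqE (eq_sym x).
case: (y == v) => /=; last by rewrite big1 // => u _; rewrite andbF.
by under eq_bigr do rewrite andbT; rewrite (sum_pred1 predT).
Qed.

Lemma sum_count_fst (e : seq (V * V)) u :
  \sum_v count_mem (u, v) e = count_mem u (unzip1 e).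
Proof.
elim: e => [|[x y] e IH] /=; first by rewrite big1.
rewrite big_split /= IH; congr (_ + _).
under eq_bigr do rewrite xpair_eqE (eq_sym y).
case: (x == u) => /=; last by rewrite big1.
by rewrite (sum_pred1 predT).
Qed.

Lemma count_belast w s u :
  count_mem u (belast w s) + (u == last w s) = count_mem u s + (u == w).
Proof.
elim: s w => [|x s IH] w //=; by rewrite -addnA IH (eq_sym w) (eq_sym x) addnC [(u == x) + _]addnC.
Qed.

Lemma walks_balanced n c w (s : n.-tuple V) : s \in walks n c w ->
  balanced c w (last w s).
Proof.
move=> /walksP H u.
have -> : outdeg c u = count_mem u (belast w s).
  rewrite -[belast w s](@unzip1_zip _ _ _ s) ?size_belast // -steps_zip.
  by rewrite -sum_count_fst; apply: eq_bigr.
have -> : indeg c u = count_mem u s.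
  rewrite -[X in count_mem _ X](@unzip2_zip _ _ (belast w s)) ?size_belast // -steps_zip.
  by rewrite -sum_count_snd; apply: eq_bigr.
exact: count_belast.
Qed.

Definition cyc_count (s : seq V) u v := count_mem (u, v) (cyc_steps s).

Lemma indeg_cyc_count s u : indeg (cyc_count s) u = count_mem u s.
Proof. by rewrite /indeg sum_count_snd unzip2_zip // size_rotr. Qed.

Lemma outdeg_cyc_count s u : outdeg (cyc_count s) u = count_mem u s.
Proof.
rewrite /outdeg sum_count_fst unzip1_zip ?size_rotr //.
by apply/seq.permP; rewrite perm_rotr.
Qed.

Lemma sum_count_mem (s : seq V) : \sum_u count_mem u s = size s.
Proof.
elim: s => [|x s IH] /=; first by rewrite big1.
rewrite big_split /= IH -add1n; congr (_ + _).
by under eq_bigr do rewrite eq_sym; rewrite (sum_pred1 predT).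
Qed.

Definition closed_walks n c : {set n.-tuple V} :=
  [set s : n.-tuple V | [forall u, forall v, cyc_count s u v == c u v]].

Lemma closed_walksP n c (s : n.-tuple V) :
  reflect (forall u v, cyc_count s u v = c u v) (s \in closed_walks n c).
Proof.
rewrite inE; apply: (iffP forallP) => [H u v|H u].
  by move/forallP: (H u) => /(_ v)/eqP.
by apply/forallP => v; rewrite H.
Qed.

Lemma walks_closed n c z (s : n.+1.-tuple V) : (forall u, outdeg c u = indeg c u) ->
  (s \in walks n.+1 c z) = (last z s == z) && (s \in closed_walks n.+1 c).
Proof.
move=> b; have E : last z s = z ->
    forall u v, cyc_count s u v = count_mem (u, v) (steps z s).
  by case: s => -[|x s] //= _ <- u v; rewrite /cyc_count cyc_steps_cons.
apply/idP/andP => [H|[/eqP lz /closed_walksP H]]; last first.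
  by apply/walksP => u v; rewrite -H E.
have lz : last z s = z.
  have := walks_balanced H z; rewrite b eqxx => /addnI/eqP.
  by rewrite eqb1 eq_sym => /eqP.
split; first exact/eqP.
by apply/closed_walksP => u v; rewrite E //; move/walksP: H => ->.
Qed.

(** Rotation by [i.+1] brings the entry number [i] to the end, where a closed walk with [z] at that
    place becomes a walk from [z] to [z]. *)
Lemma card_closed_through n c z (i : 'I_n.+1) : (forall u, outdeg c u = indeg c u) ->
  #|[set s in closed_walks n.+1 c | tnth s i == z]| = #|walks n.+1 c z|.
Proof.
move=> b; rewrite -(card_imset _ (f := fun s : n.+1.-tuple V => [tuple of rot i.+1 s])); last first.
  by move=> s t /(congr1 val) /= /rot_inj /val_inj.
apply: eq_card => s; rewrite walks_closed //.
have last_rot (t : n.+1.-tuple V) : last z (rot i.+1 t) = tnth t i.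
  by rewrite /rot (take_nth z) ?size_tuple // last_cat last_rcons (tnth_nth z).
have cl (t : n.+1.-tuple V) :
    ([tuple of rot i.+1 t] \in closed_walks n.+1 c) = (t \in closed_walks n.+1 c).
  apply/closed_walksP/closed_walksP => H u v; rewrite -H /cyc_count cyc_steps_rot;
  by apply/seq.permP; rewrite ?perm_rot // perm_sym perm_rot.
apply/imsetP/andP => [[t] |[lz sc]].
  by rewrite inE => /andP[tc /eqP ti] ->; rewrite cl tc /= last_rot ti eqxx.
have sE : s = [tuple of rot i.+1 [tuple of rotr i.+1 s]].
  by apply/val_inj; rewrite /= rotrK.
exists [tuple of rotr i.+1 s] => //.
by rewrite inE -cl -sE sc -last_rot /= rotrK lz.
Qed.

(** Pairs of a closed walk and a position at [z] are counted in two ways. *)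
Lemma card_closed_walks n c z : (forall u, outdeg c u = indeg c u) ->
  #|closed_walks n.+1 c| * outdeg c z = n.+1 * #|walks n.+1 c z|.
Proof.
move=> b; rewrite -sum1_card big_distrl /=.
under eq_bigr => s sc.
  rewrite mul1n [outdeg c z](_ : _ = \sum_(i < n.+1) (tnth s i == z)); first over.
  have -> : outdeg c z = count_mem z s.
    by rewrite -outdeg_cyc_count; apply: eq_bigr => v _; move/closed_walksP: sc => ->.
  by rewrite -sum1_count big_tuple big_mkcond.
rewrite exchange_big /=.
transitivity (\sum_(i < n.+1) #|walks n.+1 c z|); last by rewrite sum_nat_const card_ord.
apply: eq_bigr => i _; rewrite -(card_closed_through z i b) -sum1_card.
rewrite [RHS](eq_bigl (fun s => (s \in closed_walks n.+1 c) && (tnth s i == z))).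
  by rewrite [RHS]big_mkcondr.
by move=> s; rewrite inE.
Qed.

(* Rotating a closed walk makes it start at any prescribed passage through z, so
   the number of closed walks of length n is (n / outdeg z) times the number of
   those that start at z. *)
Lemma closed_best n c z : \sum_u outdeg c u = n ->
    (forall u, outdeg c u = indeg c u) -> 0 < outdeg c z ->
  #|closed_walks n c| * entry_fact c =
    n * (arb_sum z (exit_weight c z) * \prod_u (outdeg c u).-1`!).
Proof.
case: n => [|n] dn b dz.
  by move: dn; rewrite (bigD1 z) //=; lia.
have bz : balanced c z z by move=> u; rewrite b.
apply/eqP; rewrite -(eqn_pmul2r dz); apply/eqP.
rewrite mulnAC (card_closed_walks _ z b) -!mulnA (best dn bz).
congr (_ * (_ * _)).
rewrite /degree_fact [in RHS](bigD1 z) //=.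
by case: (outdeg c z) dz => // d _; rewrite factS /=; lia.
Qed.

End Best.

(** * Functions with a single cycle *)

Section Core.
Variable V : finType.
Implicit Types (f t : {ffun V -> V}) (u v w z x y : V) (a b m : nat).

(* [core f] is the cycle of [f] if [f] has a single cycle, and it is empty
   otherwise. *)
Definition core f : {set V} := [set z | [forall x, fconnect f x z]].

Lemma coreP f z : reflect (forall x, fconnect f x z) (z \in core f).
Proof. by rewrite inE; apply: forallP. Qed.

Lemma iter_core f z n : z \in core f -> iter n f z \in core f.
Proof.
move=> /coreP zc; apply/coreP => x.
exact: connect_trans (zc x) (fconnect_iter _ _ _).
Qed.

Lemma f_core f z : z \in core f -> f z \in core f.
Proof. exact: (@iter_core f z 1). Qed.

Lemma core_fconnect f z x : z \in core f -> (x \in core f) = fconnect f z x.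
Proof.
move=> zc; apply/coreP/idP => [//|zx y].
by apply: connect_trans zx; move/coreP: zc.
Qed.

Lemma order_core f z : z \in core f -> order f z = #|core f|.
Proof. by move=> zc; apply: eq_card => x; rewrite (core_fconnect _ zc). Qed.

Lemma iter_card_core f z : z \in core f -> iter #|core f| f z = z.
Proof.
move=> zc; rewrite -(order_core zc); apply/(orbitPcycle 4 2).
by move/coreP: zc => /(_ (f z)).
Qed.

Lemma card_core_gt0 f z : z \in core f -> 0 < #|core f|.
Proof. by move=> zc; rewrite -(order_core zc) order_gt0. Qed.

Lemma findex_core f z x : z \in core f -> x \in core f ->
  findex f z x < #|core f| /\ iter (findex f z x) f z = x.
Proof.
move=> zc; rewrite (core_fconnect x zc) => zx.
by rewrite -(order_core zc) findex_max // iter_findex.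
Qed.

(** If [f^i u = z], then going [i] times round the period of [u] passes through [z] and ends at
    [u]. *)
Lemma periodic_core f z u n : z \in core f -> iter n.+1 f u = u -> u \in core f.
Proof.
move=> zc fu; rewrite (core_fconnect _ zc).
have /iter_findex : fconnect f u z by move/coreP: zc.
move: (findex _ _ _) => i uz.
suff <- : iter (n * i) f z = u by exact: fconnect_iter.
rewrite -uz -iterD addnC -mulSn mulnC; elim: i {uz} => // i IH.
by rewrite mulSn addnC iterD fu.
Qed.

Definition core_pred f u := iter #|core f|.-1 f u.

Lemma core_predK f u : u \in core f -> f (core_pred f u) = u.
Proof.
move=> uc; rewrite /core_pred -iterS prednK ?iter_card_core //.
exact: card_core_gt0 uc.
Qed.

Lemma core_pred_f f u : u \in core f -> core_pred f (f u) = u.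
Proof.
move=> uc; rewrite /core_pred -iterSr prednK ?iter_card_core //.
exact: card_core_gt0 uc.
Qed.

Lemma core_pred_core f u : u \in core f -> core_pred f u \in core f.
Proof. exact: iter_core. Qed.

Lemma core_iter_neq f z i j : z \in core f -> i < j -> j < i + #|core f| ->
  iter i f z != iter j f z.
Proof.
move=> zc ij jk; apply/negP => /eqP E.
have := findex_iter (f := f) (x := iter i f z) (i := j - i).
rewrite order_core ?iter_core // ltn_subLR ?(ltnW ij) // => /(_ jk).
by rewrite -iterD subnK ?(ltnW ij) // -E findex0; lia.
Qed.

Lemma iter_card_in_core f z x : z \in core f -> iter #|V| f x \in core f.
Proof.
move=> zc; have xz : fconnect f x z by move/coreP: zc.
have := findex_max xz; have : order f x <= #|V| by apply: max_card.
move=> le lt; have {lt}le := leq_trans (ltnW lt) le.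
rewrite -(subnK le) iterD iter_findex //; exact: iter_core.
Qed.

Definition off_core f u := #|[set x | (x \notin core f) && (f x == u)]|.

(* The edges of [f] off the cycle are crossed [m] times in each direction, those of
   the cycle [a] times along [f] and [b] times against it. *)
Definition edge_mx f a b m u v : nat :=
  (v == f u) * (if u \in core f then a else m) +
  (u == f v) * (if v \in core f then b else m).

Lemma edge_mxC f a b m u v : edge_mx f a b m u v = edge_mx f b a m v u.
Proof. by rewrite /edge_mx addnC. Qed.

Lemma sum_eq_mul u (F : V -> nat) : \sum_v (v == u) * F v = F u.
Proof. by rewrite (bigD1 u) //= eqxx mul1n big1 ?addn0 // => v /negbTE ->. Qed.

Lemma outdeg_edge_mx f a b m u : outdeg (edge_mx f a b m) u =
  if u \in core f then a + b + m * off_core f u else m + m * off_core f u.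
Proof.
rewrite /outdeg big_split /= sum_eq_mul.
rewrite (bigID (fun v => v \in core f)) /=.
rewrite [X in _ + (_ + X)](_ : _ = m * off_core f u); last first.
  rewrite /off_core mulnC -sum_nat_const big_mkcond [RHS]big_mkcond.
  apply: eq_bigr => v _; rewrite inE (eq_sym (f v)); case: ifP => //= /negbTE ->.
  by case: eqP; rewrite ?mul1n.
rewrite addnA; case: ifP => uc; congr (_ + _); last first.
  rewrite big1 ?addn0 // => v vc; case: eqP => // uE.
  by rewrite uE f_core in uc.
congr (_ + _); rewrite (bigD1 (core_pred f u)) ?core_pred_core //= core_predK //.
rewrite eqxx mul1n big1 ?addn0 // => v /andP[vc vu].
by case: eqP => // E; move: vu; rewrite E core_pred_f // eqxx.
Qed.

(** Transposition exchanges [a] and [b], and the outdegree depends only on [a + b]. *)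
Lemma indeg_edge_mx f a b m u :
  indeg (edge_mx f a b m) u = outdeg (edge_mx f a b m) u.
Proof.
rewrite outdeg_edge_mx (addnC a) -(outdeg_edge_mx f b a).
by apply: eq_bigr => v _; rewrite edge_mxC.
Qed.

(* The arborescence to z obtained by reversing the j edges that f gives to the
   vertices f z, ..., f^j z of its cycle. *)
Definition turn f z (j : nat) : {ffun V -> V} :=
  [ffun u => if u == z then z
             else if (u \in core f) && (findex f z u <= j)
                  then iter (findex f z u).-1 f z else f u].

Lemma turn_arb f z j : z \in core f -> j < #|core f| -> turn f z j \in arbs z.
Proof.
move=> zc jk; apply/arbsP; split; first by rewrite ffunE eqxx.
have back i : i <= j -> fconnect (turn f z j) (iter i f z) z.
  elim: i => [|i IH] ij; first exact: connect0.
  have -> : fconnect (turn f z j) (iter i.+1 f z) z; last by [].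
  have lt : i.+1 < #|core f| by apply: leq_ltn_trans jk.
  apply: connect_trans (fconnect1 _ _) _; rewrite ffunE.
  case: eqP => [_|_]; first exact: connect0.
  rewrite iter_core // findex_iter ?order_core // ij.
  by apply: IH; apply: ltnW.
move=> u; have /iter_findex : fconnect f u z by move/coreP: zc.
move: (findex f u z) => n; elim: n u => [|n IH] u; first by move=> /= ->; apply: connect0.
rewrite iterSr => /IH H.
have [/andP[uc uj]|uN] := boolP ((u \in core f) && (findex f z u <= j)).
  by have [_ <-] := findex_core zc uc; apply: back.
apply: connect_trans (fconnect1 _ _) _; rewrite ffunE (negbTE uN).
by case: eqP => // _; apply: connect0.
Qed.

(* Following the edges reversed by t leads to z along the cycle of f. *)
Lemma arb_turn f z t : z \in core f -> t \in arbs z ->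
    (forall u, u != z -> t u = f u \/ f (t u) = u) ->
  exists2 j, j < #|core f| & t = turn f z j.
Proof.
move=> zc /arbsP[tz tc] H.
(* [E] marks the vertices whose tree edge runs against [f]; from such a vertex [t] keeps running
   against [f] until it reaches [z]. *)
pose E u := (u != z) && (t u != f u).
have step u : E u -> f (t u) = u /\ (t u != z -> E (t u)).
  move=> /andP[uz tu]; have ftu : f (t u) = u.
    by case: (H u uz) => // E'; rewrite E' eqxx in tu.
  split=> // tuz; rewrite /E tuz ftu; apply: contraNneq uz => ttu.
  (* If [t] exchanged [u] and [t u], the path from [u] would never reach [z]. *)
  have : iter (findex t u z) t u \in [:: u; t u].
    elim: (findex t u z) => [|n] /=; first by rewrite mem_head.
    by rewrite !inE => /orP[] /eqP ->; rewrite ?eqxx ?orbT // ttu eqxx.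
  by rewrite iter_findex // !inE (eq_sym z u) (eq_sym z (t u)) (negbTE tuz) orbF.
have chain n u : iter n t u = z -> E u ->
    exists i, [/\ 0 < i, u = iter i f z,
      t u = iter i.-1 f z & forall l, 0 < l -> l <= i -> E (iter l f z) /\
         t (iter l f z) = iter l.-1 f z].
  elim: n u => [|n IH] u; first by move=> /= ->; rewrite /E eqxx.
  rewrite iterSr => tn Eu; have [ftu st] := step u Eu.
  have [tuz|tuz] := eqVneq (t u) z.
    exists 1; rewrite /= -tuz ftu; split=> // l l0 l1.
    have -> : l = 1 by lia.
    by rewrite /= ftu.
  have [i [i0 tuE _ il]] := IH _ tn (st tuz).
  exists i.+1; rewrite /= -tuE ftu; split=> // l l0.
  rewrite leq_eqVlt => /orP[/eqP ->|li]; last exact: il.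
  by rewrite /= -tuE ftu.
have {}chain u : E u -> exists i, [/\ 0 < i, u = iter i f z &
     forall l, 0 < l -> l <= i -> E (iter l f z) /\ t (iter l f z) = iter l.-1 f z].
  by move=> Eu; have [i [? ? _ ?]] := chain _ _ (iter_findex (tc u)) Eu; exists i.
have ltk u i : 0 < i -> (forall l, 0 < l -> l <= i -> E (iter l f z) /\
     t (iter l f z) = iter l.-1 f z) -> u = iter i f z -> i < #|core f|.
  move=> i0 il uE; rewrite ltnNge; apply/negP => ki.
  have [] := il _ (card_core_gt0 zc) ki.
  by rewrite iter_card_core // /E eqxx.
(* The witness is the largest [j] for which [f z, ..., f^j z] are all reversed; maximality shows
   that no other vertex is. *)
pose P j := (j < #|core f|) && [forall l : 'I_#|core f|, (0 < l <= j) ==> E (iter l f z)].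
have P0 : exists j, P j.
  exists 0; rewrite /P (card_core_gt0 zc); apply/forallP => l.
  by rewrite ltnNge; case: leqP.
have Pb j : P j -> j <= #|core f| by case/andP => /ltnW.
case: (ex_maxnP P0 Pb) => j /andP[jk Pj] jmax.
have {}Pj l : 0 < l -> l <= j -> E (iter l f z).
  move=> l0 lj; have lk : l < #|core f| by apply: leq_ltn_trans jk.
  by have /forallP/(_ (Ordinal lk)) := Pj; rewrite /= l0 lj.
exists j => //; apply/ffunP => u; rewrite ffunE.
have [->//|uz] := eqVneq u z.
case: ifPn => [/andP[uc uj]|uN].
  have [_ uE] := findex_core zc uc; set i := findex _ _ _ in uE uj *.
  have i0 : 0 < i by rewrite lt0n /i findex_eq0 eq_sym.
  have Eu : E u by rewrite -uE; apply: Pj.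
  have [i' [i'0 uE' il]] := chain u Eu.
  have i'k := ltk u i' i'0 il uE'.
  have ii : i = i' by rewrite /i uE' findex_iter // order_core.
  by rewrite -{1}uE; have [] := il i i0; rewrite ?ii.
have [//|tu] := eqVneq (t u) (f u).
have Eu : E u by rewrite /E uz tu.
have [i [i0 uE il]] := chain u Eu; have ik := ltk u i i0 il uE.
move: uN; rewrite uE iter_core //= findex_iter ?order_core // => /negP[].
apply: jmax; rewrite /P ik; apply/forallP => l; apply/implyP => /andP[l0 li].
by case: (il l l0 li).
Qed.

Lemma prod_core f z (G : V -> nat) : z \in core f ->
  \prod_(u | (u != z) && (u \in core f)) G u =
    \prod_(i < #|core f|.-1) G (iter i.+1 f z).
Proof.
move=> zc; transitivity (\prod_(u <- orbit f z | u != z) G u).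
  rewrite [RHS]big_mkcond [RHS]big_uniq ?orbit_uniq //= [RHS]big_mkcond /=.
  rewrite [LHS]big_mkcond /=; apply: eq_bigr => u _.
  by rewrite -fconnect_orbit -core_fconnect // andbC; case: (u \in _).
have [k kE] : exists k, #|core f| = k.+1.
  by exists #|core f|.-1; rewrite prednK // (card_core_gt0 zc).
have := orbit_uniq f z; rewrite /orbit (order_core zc) kE /= big_cons eqxx /=.
case/andP => zN _; transitivity (\prod_(u <- traject f (f z) k) G u).
  rewrite big_mkcond; apply: eq_big_seq => u ut.
  by case: eqP ut => [->|] //; rewrite (negbTE zN).
elim: k z {zc kE zN} => [|k IH] z; first by rewrite big_nil big_ord0.
rewrite trajectS big_cons big_ord_recl IH; congr (_ * _).
by apply: eq_bigr => i _; rewrite -iterSr.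
Qed.

Lemma off_core_neq f z u : z \in core f -> u \notin core f -> u != f (f u).
Proof.
by move=> zc; apply: contraNneq => E; apply: (@periodic_core f z u 1).
Qed.

Lemma prod_turn f z j a b m : z \in core f -> j < #|core f| ->
  \prod_(u | u != z) edge_mx f a b m u (turn f z j u) =
  m ^ (#|V| - #|core f|) * \prod_(i < #|core f|.-1)
     edge_mx f a b m (iter i.+1 f z)
        (if i < j then iter i f z else iter i.+2 f z).
Proof.
move=> zc jk; rewrite (bigID (fun u => u \in core f)) /= mulnC; congr (_ * _).
  rewrite -cardsT -cardsDS ?subsetT // setTD -prod_nat_const.
  apply: eq_big => [u|u /andP[uz uc]].
    by rewrite in_setC; case: eqVneq => [->|]; rewrite ?zc //=.
  by rewrite ffunE (negbTE uz) /edge_mx (negbTE uc) eqxx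
     (negbTE (off_core_neq zc uc)) mul1n addn0.
rewrite prod_core //; apply: eq_bigr => i _; congr edge_mx.
have ik : i.+1 < #|core f| by have := ltn_ord i; lia.
rewrite ffunE iter_core // findex_iter ?order_core //=.
by case: eqP => // E; have := core_iter_neq zc (ltn0Sn i) ik; rewrite /= E eqxx.
Qed.

(** Any other arborescence uses a pair that [f] does not join, where [edge_mx] vanishes. The sum
    runs over a set of trees and not over [j], because in a 2-cycle both values of [j] give the same
    tree. *)
Lemma arb_sum_edge_turn f z a b m : z \in core f ->
  arb_sum z (edge_mx f a b m) =
  \sum_(t in [set turn f z j | j : 'I_#|core f|])
     \prod_(u | u != z) edge_mx f a b m u (t u).
Proof.
move=> zc; rewrite /arb_sum big_mkcond [RHS]big_mkcond; apply: eq_bigr => t _.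
case: ifPn => [tz|tN]; last first.
  by case: imsetP => // -[j _ tE]; move: tN; rewrite tE turn_arb.
case: ifPn => // tN.
have /existsP[u /andP[uz cu]] :
    [exists u, (u != z) && (edge_mx f a b m u (t u) == 0)].
  apply: contraR tN; rewrite negb_exists => /forallP H.
  have [|j jk ->] := arb_turn zc tz; last by apply/imsetP; exists (Ordinal jk).
  move=> u uz; have := H u; rewrite uz /= /edge_mx.
  case: (t u =P f u) => [->|_]; first by left.
  by case: (u =P f (t u)) => [<-|//]; right.
by rewrite (bigD1 u) //= (eqP cu).
Qed.

(** In a 2-cycle the only tree edge on the cycle leads from [f z] to [z], where the two kinds of
    crossings add up to [a + b]. *)
Lemma arb_sum_edge_small f z a b m : z \in core f -> #|core f| <= 2 ->
  arb_sum z (edge_mx f a b m) =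
    m ^ (#|V| - #|core f|) * (a + b) ^ #|core f|.-1.
Proof.
move=> zc k2; have k0 := card_core_gt0 zc.
rewrite arb_sum_edge_turn // (_ : [set _ | _ in _] = [set turn f z 0]).
  rewrite big_set1 prod_turn //; congr (_ * _); rewrite -[in RHS](card_ord #|core f|.-1).
  rewrite -prod_nat_const; apply: eq_bigr => i _ /=.
  have k2' : #|core f| = 2 by have := ltn_ord i; lia.
  have i0 : i = 0 :> nat by have := ltn_ord i; lia.
  have ffz : f (f z) = z by move: (iter_card_core zc); rewrite k2'.
  by rewrite i0 /= /edge_mx ffz f_core // zc !eqxx !mul1n.
apply/setP => t; rewrite inE; apply/imsetP/eqP => [[j _ ->]|->]; last first.
  by exists (Ordinal k0).
apply/ffunP => u; rewrite !ffunE; case: eqVneq => // uz.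
case: ifPn => [/andP[uc uj]|_]; last first.
  by rewrite leqn0 findex_eq0 (eq_sym z) (negbTE uz) andbF.
rewrite leqn0 findex_eq0 (eq_sym z) (negbTE uz) andbF.
have [fk uE] := findex_core zc uc; have i0 : findex f z u != 0.
  by rewrite findex_eq0 eq_sym.
have k2' : #|core f| = 2 by lia.
have i1 : findex f z u = 1 by lia.
by move: uE; rewrite i1 /= => <-; move: (iter_card_core zc); rewrite k2'.
Qed.

(** The tree [turn f z j] sends [j] cycle vertices against [f], with weight [b], and the other
    [#|core f|.-1 - j] along [f], with weight [a]. In a 2-cycle these trees would coincide. *)
Lemma arb_sum_edge f z a b m : z \in core f -> 2 < #|core f| ->
  arb_sum z (edge_mx f a b m) = m ^ (#|V| - #|core f|) *
    \sum_(j < #|core f|) b ^ j * a ^ (#|core f|.-1 - j).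
Proof.
move=> zc k3; rewrite arb_sum_edge_turn // big_imset /=; last first.
  move=> j j' _ _ E; apply: val_inj; case: (ltngtP j j') => // jj; move/ffunP: E.
  - move=> /(_ (iter j' f z)); rewrite !ffunE iter_core // findex_iter ?order_core //.
    have j0 : 0 < j' by apply: leq_ltn_trans jj.
    rewrite eq_sym (negbTE (@core_iter_neq f z 0 j' zc j0 (ltn_ord j'))) leqnn leqNgt jj /=.
    move=> E; have := @core_iter_neq f z j'.-1 j'.+1 zc.
    by rewrite /= E eqxx; have := ltn_ord j'; lia.
  - move=> /(_ (iter j f z)); rewrite !ffunE iter_core // findex_iter ?order_core //.
    have j0 : 0 < j by apply: leq_ltn_trans jj.
    rewrite eq_sym (negbTE (@core_iter_neq f z 0 j zc j0 (ltn_ord j))) leqnn leqNgt jj /=.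
    move=> E; have := @core_iter_neq f z j.-1 j.+1 zc.
    by rewrite /= -E eqxx; have := ltn_ord j; lia.
rewrite big_distrr /=; apply: eq_bigr => j _; rewrite prod_turn //; congr (_ * _).
have jk := ltn_ord j.
transitivity (\prod_(i < #|core f|.-1) if i < j then b else a).
  apply: eq_bigr => i _; have ik := ltn_ord i.
  rewrite /edge_mx iter_core //; case: ifP => ij.
    rewrite iter_core // eqxx mul1n (negbTE (@core_iter_neq f z i i.+2 zc _ _)) //.
    by lia.
  rewrite eqxx mul1n (negbTE (@core_iter_neq f z i.+1 i.+3 zc _ _)) ?addn0 //.
  by lia.
have [k kE] : exists k, #|core f|.-1 = j + k by exists (#|core f|.-1 - j); lia.
rewrite kE big_split_ord /= addKn; congr (_ * _).
  rewrite (eq_bigr (fun=> b)) => [|i _]; first by rewrite prod_nat_const card_ord.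
  by rewrite /= ltn_ord.
rewrite (eq_bigr (fun=> a)) => [|i _]; first by rewrite prod_nat_const card_ord.
by rewrite /= ltnNge leq_addr.
Qed.

End Core.

(** * Orientations of connected multigraphs with a single cycle *)

Section Orientations.
Variable V : finType.
Implicit Types (f t : {ffun V -> V}) (u v w z x y p q : V) (a b m : nat).
Implicit Types c : V -> V -> nat.

(** A fixed point has value 2 with itself, in agreement with [c u u] entering [c u v + c v u] twice;
    a 2-cycle has value 2 as a double edge. *)
Definition joins f u v : nat := (v == f u) + (u == f v).

Definition orients m c f :=
  [forall u, forall v, c u v + c v u == 2 * m * joins f u v].

Lemma orientsP m c f :
  reflect (forall u v, c u v + c v u = 2 * m * joins f u v) (orients m c f).
Proof.
apply: (iffP forallP) => [H u v|H u].
  by move/forallP: (H u) => /(_ v)/eqP.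
by apply/forallP => v; rewrite H.
Qed.

Definition tree_edge z t u v : nat := (u != z) && (v == t u).

Lemma arb_neq z t u : t \in arbs z -> u != z -> t u != u.
Proof.
move=> /arbsP[tz tc] uz; apply: contraNneq uz => tu.
by have /iter_findex := tc u; elim: (findex t u z) => [/= -> //|n IH]; rewrite iterSr tu.
Qed.

Lemma tree_edge_asym z t u v : t \in arbs z ->
  tree_edge z t u v + tree_edge z t v u <= 1.
Proof.
move=> /arbsP[tz tc]; rewrite /tree_edge.
case: (u =P z) => //= uz; first by case: (_ && _).
case: (v =P t u) => //= [vE|_]; last by case: (_ && _).
case: (v =P z) => //= vz; case: (u =P t v) => //= uE.
have : iter (findex t u z) t u \in [:: u; v].
  elim: (findex t u z) => [|n] /=; first by rewrite mem_head.
  by rewrite !inE => /orP[] /eqP ->; rewrite -?vE -?uE eqxx ?orbT.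
by rewrite iter_findex // !inE => /orP[] /eqP E; [case: uz | case: vz].
Qed.

Lemma sum_tree_edge z t : \sum_u \sum_v tree_edge z t u v = #|V|.-1.
Proof.
rewrite (bigD1 z) //= [X in X + _]big1 ?add0n => [|v _]; last first.
  by rewrite /tree_edge eqxx.
under eq_bigr => u uz.
  rewrite (_ : \sum_v _ = 1); last first.
    by rewrite /tree_edge uz (bigD1 (t u)) //= eqxx big1 // => v /negbTE ->.
  over.
rewrite sum1_card; have := cardC (pred1 z); rewrite card1 add1n.
by move=> <-; apply: eq_card.
Qed.

Lemma sum_symm c : \sum_u \sum_v (c u v + c v u) = 2 * \sum_u outdeg c u.
Proof.
under eq_bigr do rewrite big_split.
rewrite big_split /= mul2n -addnn; congr (_ + _).
by rewrite exchange_big.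
Qed.

(** A nonzero tree sum stands for connectedness: it provides a spanning tree all of whose edges are
    crossed. *)
Lemma arb_sum_support c z : (forall u, 0 < outdeg c u) ->
    arb_sum z (exit_weight c z) != 0 ->
  exists2 t, t \in arbs z & forall u, u != z -> 0 < c u (t u).
Proof.
move=> d0; rewrite sum_nat_eq0 negb_forall => /existsP[t].
rewrite negb_imply => /andP[tz tN]; exists t => // u uz.
rewrite lt0n; apply: contraNneq tN => c0.
rewrite (bigD1 u) //=; have -> : exit_weight c z u (t u) = 0.
  by rewrite /exit_weight c0 (gtn_eqF (d0 u)).
by [].
Qed.

Section Classification.
Variables (m : nat) (c : V -> V -> nat).
Hypothesis m0 : 0 < m.
Hypothesis cV : forall u v, u != v -> 2 * m %| c u v + c v u.
Hypothesis cL : forall u, 2 * m %| c u u.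

(** Crossings in units of [2 * m]. A loop enters twice, so that [cL] makes the diagonal even and the
    total is [2 * r]. *)
Let mu u v := (c u v + c v u) %/ (2 * m).

Let muE u v : c u v + c v u = 2 * m * mu u v.
Proof.
rewrite mulnC divnK //; have [->|uv] := eqVneq u v; last exact: cV.
by rewrite dvdn_addr.
Qed.

Let mu_sum r : \sum_u outdeg c u = 2 * m * r -> \sum_u \sum_v mu u v = 2 * r.
Proof.
move=> cr; have := sum_symm c; rewrite cr.
under eq_bigr do under eq_bigr do rewrite muE.
under eq_bigr do rewrite -big_distrr.
rewrite -big_distrr /=; nia.
Qed.

(** A tree edge is crossed at least once, hence by divisibility at least [2 * m] times. *)
Let tree_le_mu z t : t \in arbs z -> (forall u, u != z -> 0 < c u (t u)) ->
  forall u v, tree_edge z t u v + tree_edge z t v u <= mu u v.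
Proof.
move=> tz tc u v; have le1 := tree_edge_asym u v tz.
have pos x y : tree_edge z t x y <= c x y.
  rewrite /tree_edge; case: eqP => //= /eqP xz; case: eqP => //= ->.
  exact: tc.
by have := muE u v; have := pos u v; have := pos v u; case: (mu u v) => [|k]; lia.
Qed.

Let sum_tree_symm z t :
  \sum_u \sum_v (tree_edge z t u v + tree_edge z t v u) = 2 * #|V|.-1.
Proof. by rewrite sum_symm sum_tree_edge. Qed.

(** A spanning tree takes up [#|V|.-1] of the [r] available units. *)
Lemma card_vertices_le z r : \sum_u outdeg c u = 2 * m * r ->
    (forall u, 0 < outdeg c u) -> arb_sum z (exit_weight c z) != 0 ->
  #|V| <= r.+1.
Proof.
move=> cr d0 /(arb_sum_support d0)[t tz tc].
suff : 2 * #|V|.-1 <= 2 * r by lia.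
rewrite -(mu_sum cr) -(sum_tree_symm z t).
by apply: leq_sum => u _; apply: leq_sum => v _; apply: tree_le_mu.
Qed.

(** What remains is a single edge, possibly a loop; the even diagonal rules out two half loops at
    different vertices. *)
Let residual (nu : V -> V -> nat) : (forall u v, nu u v = nu v u) ->
    (forall u, ~~ odd (nu u u)) -> \sum_u \sum_v nu u v = 2 ->
  exists p q, forall u v, nu u v = ((u == p) && (v == q)) + ((u == q) && (v == p)).
Proof.
move=> nuC nuE; rewrite pair_bigA /= => nu2.
have /existsP[[p q] /= pq] : [exists x : V * V, nu x.1 x.2 != 0].
  apply: contraPT nu2; rewrite negb_exists => /forallP H.
  by rewrite big1 // => x _; apply/eqP; rewrite -[_ == _]negbK.
exists p, q => u v; move: nu2; rewrite (bigD1 (p, q)) //=.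
have [pqE|pqN] := eqVneq p q.
  rewrite -{}pqE in pq *; move=> S.
  have npp : nu p p = 2 by move: (nuE p) pq S; case: (nu p p) => [|[|[|n]]].
  move: S; rewrite npp => /eqP; rewrite -[2]addn0 eqn_add2l sum_nat_eq0 => /forallP H.
  have := H (u, v); rewrite xpair_eqE /=.
  by case: (u =P p) => [->|_]; case: (v =P p) => [->|_] //= /eqP.
rewrite (bigD1 (q, p)) /=; last by rewrite xpair_eqE negb_and eq_sym pqN.
rewrite (nuC q p) => S; have npq : nu p q = 1 by lia.
move: S; rewrite npq addnA => /eqP.
rewrite -[X in _ == X]addn0 eqn_add2l sum_nat_eq0 => /forallP H.
have := H (u, v); rewrite !xpair_eqE /=.
case: (u =P p) => [->|_].
  rewrite (negbTE pqN) /= addn0; case: (v =P q) => [-> _|_ /= /eqP]; first by rewrite npq.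
  by [].
case: (u =P q) => [->|_] /=; last by move/eqP.
by case: (v =P p) => [-> _|_ /= /eqP]; rewrite // nuC npq.
Qed.

(** The root moves along the path from [z] to [x], reversing one edge at a time. *)
Let reroot z t x : t \in arbs z -> exists2 t', t' \in arbs x &
  forall u v, tree_edge z t u v + tree_edge z t v u =
              tree_edge x t' u v + tree_edge x t' v u.
Proof.
move=> tz; have /arbsP[_ /(_ x) /iter_findex] := tz.
move: (findex _ _ _) => n; elim: n x => [|n IH] x; first by move=> /= ->; exists t.
rewrite iterSr; have [->|xz] := eqVneq x z; first by exists t.
move=> /IH[t' ty E]; set y := t x in ty E *.
have xy : x != y by rewrite eq_sym; apply: arb_neq tz xz.
have t'x : t' x = y.
  have := E x y; rewrite /tree_edge xz !eqxx /= xy /= => /eqP.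
  by case: (y =P t' x) => // _; rewrite addn0 add1n.
exists (upd (upd t' y x) x x).
  apply/arbsP; split; first by rewrite ffunE eqxx.
  move=> u; have /arbsP[_ /(_ u) /iter_findex] := ty.
  move: (findex _ _ _) => k; elim: k u => [|k IHk] u /=.
    move=> ->; apply: connect_trans (fconnect1 _ _) _.
    by rewrite !ffunE eqxx (eq_sym y) (negbTE xy).
  rewrite -iterS iterSr => /IHk H.
  have [->//|ux] := eqVneq u x; apply: connect_trans (fconnect1 _ _) _.
  by rewrite !ffunE (negbTE ux); case: eqP.
move=> u v; rewrite E /tree_edge !ffunE.
have [->|ux] := eqVneq u x; have [->|vx] := eqVneq v x;
  rewrite ?eqxx ?xy ?t'x /= ?addn0 ?add0n.
- by rewrite (negbTE xy).
- by case: (eqVneq v y) => //= _; rewrite ?eqxx.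
- by case: (eqVneq u y) => //= _; rewrite ?eqxx ?addn0.
by case: (eqVneq u y); case: (eqVneq v y) => //= _ _;
  rewrite ?(negbTE ux) ?(negbTE vx) ?addn0.
Qed.

(* A support tree leaves exactly one unit of multiplicity unused; rerooting the
   tree at an end of the edge carrying it produces the orientation. *)
Lemma orientation_exists z : \sum_u outdeg c u = 2 * m * #|V| ->
    (forall u, 0 < outdeg c u) -> arb_sum z (exit_weight c z) != 0 ->
  exists2 f, core f != set0 & orients m c f.
Proof.
move=> cr d0 /(arb_sum_support d0)[t tz tc].
pose nu u v := mu u v - (tree_edge z t u v + tree_edge z t v u).
have le := tree_le_mu tz tc.
have muC u v : mu u v = mu v u by rewrite /mu addnC.
have nuC u v : nu u v = nu v u by rewrite /nu muC (addnC (tree_edge _ _ _ _)).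
have V0 : 0 < #|V| by apply/card_gt0P; exists z.
have nu0 u : ~~ odd (nu u u).
  rewrite /nu addnn oddB ?odd_double; last by rewrite -addnn.
  have /dvdnP[k cE] := cL u; rewrite /mu addnn cE -muln2 -mulnA (mulnC (2 * m)).
  by rewrite mulnA mulnK ?muln2 ?odd_double //; lia.
have nu2 : \sum_u \sum_v nu u v = 2.
  under eq_bigr do rewrite sumnB //.
  rewrite sumnB => [|u _]; last by apply: leq_sum.
  by rewrite (mu_sum cr) sum_tree_symm; lia.
have [p [q nuE]] := residual nuC nu0 nu2.
have [t' tp E] := reroot p tz.
exists (upd t' p q).
  apply/set0Pn; exists p; apply/coreP => x.
  have /arbsP[_ /(_ x) /iter_findex] := tp.
  move: (findex _ _ _) => n; elim: n x => [|n IH] x; first by move=> /= ->; apply: connect0.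
  rewrite iterSr => /IH H; have [->|xp] := eqVneq x p; first exact: connect0.
  by apply: connect_trans (fconnect1 _ _) _; rewrite ffunE (negbTE xp).
apply/orientsP => u v; rewrite muE; congr (_ * _).
rewrite -(subnK (le u v)) -/(nu u v) nuE E /tree_edge /joins !ffunE.
case: (u =P p) => [->|_]; case: (v =P p) => [->|_] //=;
  rewrite ?add0n ?addn0 ?andbT ?andbF //=; lia.
Qed.

End Classification.

Definition reverse f : {ffun V -> V} :=
  [ffun u => if u \in core f then core_pred f u else f u].

Lemma core_pred_eq f u v : u \in core f ->
  (v == core_pred f u) = (v \in core f) && (u == f v).
Proof.
move=> uc; apply/eqP/andP => [->|[vc /eqP ->]]; last by rewrite core_pred_f.
by rewrite core_pred_core ?core_predK.
Qed.

(** With [a = b = m = 1] this says that [f] and [reverse f] join the same pairs. *)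
Lemma edge_mx_rev_cases f a b m u v :
  (v == reverse f u) * (if u \in core f then b else m) +
  (u == reverse f v) * (if v \in core f then a else m) = edge_mx f a b m u v.
Proof.
have cf w : (w \in core f) -> (f w \in core f) by exact: f_core.
rewrite /edge_mx !ffunE; case: ifPn => uc; case: ifPn => vc.
- by rewrite !core_pred_eq // uc vc addnC.
- rewrite core_pred_eq // (negbTE vc) /= mul0n add0n.
  by case: (v =P f u) => [E|]; rewrite ?add0n //; rewrite E cf in vc.
- rewrite core_pred_eq // (negbTE uc) /= mul0n addn0.
  by case: (u =P f v) => [E|]; rewrite ?addn0 //; rewrite E cf in uc.
by [].
Qed.

Lemma joins_rev f u v : joins (reverse f) u v = joins f u v.
Proof.
have := edge_mx_rev_cases f 1 1 1 u v.
by rewrite /edge_mx /joins !if_same !muln1.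
Qed.

Lemma rev_iter_core f z n : z \in core f -> iter n (reverse f) z \in core f.
Proof. by move=> zc; elim: n => //= n IH; rewrite ffunE IH core_pred_core. Qed.

Lemma core_rev f : core f != set0 -> core (reverse f) = core f.
Proof.
move=> /set0Pn[z0 z0c]; have sub z : z \in core f -> z \in core (reverse f).
  move=> zc; have back x : x \in core f -> fconnect (reverse f) x z.
    move=> xc; have [_ <-] := findex_core zc xc; move: (findex _ _ _) => n.
    elim: n => [|n IH]; first exact: connect0.
    apply: connect_trans (fconnect1 _ _) _.
    by rewrite ffunE iter_core // iterS core_pred_f ?iter_core.
  apply/coreP => x; have /coreP/(_ x)/iter_findex := zc.
  move: (findex _ _ _) => n; elim: n x => [|n IH] x; first by move=> /= ->; apply: back.
  rewrite iterSr => /IH H; have [|xN] := boolP (x \in core f); first exact: back.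
  by apply: connect_trans (fconnect1 _ _) _; rewrite ffunE (negbTE xN).
apply/setP => z; apply/idP/idP; last exact: sub.
move=> /coreP/(_ z0)/iter_findex <-; exact: rev_iter_core.
Qed.

Lemma rev_neq f : (reverse f == f) = (#|core f| <= 2).
Proof.
apply/eqP/idP => [E|k2].
  rewrite leqNgt; apply/negP => k3.
  have /set0Pn[z zc] : core f != set0 by rewrite -card_gt0; lia.
  have := @core_iter_neq _ f z 0 2 zc isT k3; move/ffunP: E => /(_ (f z)).
  by rewrite ffunE f_core // core_pred_f //= => <-; rewrite eqxx.
apply/ffunP => u; rewrite ffunE; case: ifP => // uc.
have := card_core_gt0 uc; have := iter_card_core uc; rewrite /core_pred.
by case: #|core f| k2 => [|[|[|k]]].
Qed.

(** Where [g] differs from [f] it must undo [f], and the set [D] of these vertices is closed under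
    [f]. Hence [g^n f^n] fixes [D] pointwise; as [f^n] ends up on the cycle, every vertex of [D] is
    periodic. So [D] is empty or the whole cycle. *)
Lemma orientation_unique f g : core f != set0 ->
  (forall u v, joins f u v = joins g u v) -> g = f \/ g = reverse f.
Proof.
move=> /set0Pn[z zc] E; pose D u := g u != f u.
have Dg u : D u -> g (f u) = u.
  rewrite /D => /negbTE gu; have := E u (f u); rewrite /joins eqxx (eq_sym (f u)) gu.
  by case: (u =P g (f u)).
have Df u : D u -> D (f u).
  move=> Du; rewrite /D (Dg _ Du); apply/negP => /eqP ffu.
  have := E u (f u); rewrite /joins (Dg _ Du) -ffu !eqxx.
  by move: Du; rewrite /D (eq_sym (f u)) => /negbTE ->.
have Dgn n u : D u -> iter n g (iter n f u) = u.
  elim: n u => //= n IH u Du; rewrite -[iter n f _]/(iter n f u) -iterS iterSr.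
  by rewrite -/(iter n.+1 f u) iterS Dg ?IH //; elim: n {IH} => //= n; apply: Df.
have Dc u : D u -> u \in core f.
  move=> Du; have yc := iter_card_in_core u zc.
  have : iter #|core f| f (iter #|V| f u) = iter #|V| f u by apply: iter_card_core.
  rewrite -iterD addnC iterD => /(congr1 (iter #|V| g)); rewrite !Dgn //.
    by rewrite -(prednK (card_core_gt0 zc)) => /(periodic_core zc).
  by elim: #|core f| => //= n; apply: Df.
have [/existsP[u Du]|DN] := boolP [exists u, D u]; last first.
  left; apply/ffunP => u; apply/eqP; move: DN; rewrite negb_exists.
  by move=> /forallP/(_ u); rewrite negbK.
right; have Dcore v : v \in core f -> D v.
  move=> vc; have [_ <-] := findex_core (Dc _ Du) vc.
  by elim: (findex _ _ _) => //= n; apply: Df.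
apply/ffunP => v; rewrite ffunE; case: ifPn => vc; last first.
  by apply/eqP; apply: contraNT vc => Dv; apply: Dc.
by rewrite -{1}(core_predK vc) Dg // Dcore // core_pred_core.
Qed.

Lemma orientationsE m c f : 0 < m -> core f != set0 -> orients m c f ->
  [set g : {ffun V -> V} | (core g != set0) && orients m c g] = [set f; reverse f].
Proof.
move=> m0 f0 /orientsP cf; apply/setP => g; rewrite !inE.
apply/andP/orP => [[g0 /orientsP cg]|].
  have [|->|->] := @orientation_unique f g f0; rewrite ?eqxx; [|by left|by right].
  move=> u v; have := cf u v; rewrite cg => /eqP; rewrite eqn_pmul2l; last lia.
  by move=> /eqP.
case=> /eqP ->; first by split=> //; apply/orientsP.
by split; [rewrite core_rev | apply/orientsP => u v; rewrite joins_rev].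
Qed.

Lemma card_orientations m c f : 0 < m -> core f != set0 -> orients m c f ->
  #|[set g : {ffun V -> V} | (core g != set0) && orients m c g]| =
    if #|core f| <= 2 then 1 else 2.
Proof.
move=> m0 f0 cf; rewrite (orientationsE m0 f0 cf) cards2 eq_sym rev_neq.
by case: leqP.
Qed.

(** On a cycle of length at most 2 the steps along [f] and against it fall on the same entries. *)
Lemma edge_mx_small f a b a' b' m u v : #|core f| <= 2 -> a + b = a' + b' ->
  edge_mx f a b m u v = edge_mx f a' b' m u v.
Proof.
move=> k2 ab; have ff w : w \in core f -> f (f w) = w.
  move=> wc; have := card_core_gt0 wc; have := iter_card_core wc.
  by case: #|core f| k2 => [|[|[|k]]] //= _ E; rewrite ?E.
rewrite /edge_mx; have [->|vu] := eqVneq v (f u); last first.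
  rewrite !mul0n !add0n; case: ifP => // vc.
  by case: (u =P f v) vu => [->|//]; rewrite ff ?eqxx.
have [uc|uc] := boolP (u \in core f); first by rewrite f_core // ff // !eqxx !mul1n.
by case: ifP => fc //; case: eqP => // E; rewrite E f_core in uc.
Qed.

Lemma sum_nat_eq1 (F G : V -> nat) x : \sum_v F v = \sum_v G v ->
  (forall v, v != x -> F v = G v) -> F x = G x.
Proof.
move=> E H; move: E; rewrite (bigD1 x) // [RHS](bigD1 x) //=.
by rewrite (eq_bigr G) => [/addIn|v /H].
Qed.

Lemma sum_nat_eq2 (F G : V -> nat) x y : x != y -> \sum_v F v = \sum_v G v ->
  (forall v, v != x -> v != y -> F v = G v) -> F x + F y = G x + G y.
Proof.
move=> xy E H; move: E; rewrite (bigD1 x) // (bigD1 y) 1?eq_sym //=.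
rewrite [RHS](bigD1 x) // [in RHS](bigD1 y) 1?eq_sym //= !addnA.
by rewrite (eq_bigr G) => [/addIn|v /andP[vx vy]]; last exact: H.
Qed.

Lemma orients_edge_mx f a b m : a + b = 2 * m -> orients m (edge_mx f a b m) f.
Proof.
move=> ab; apply/orientsP => u v; rewrite /edge_mx /joins.
case: ifP => _; case: ifP => _; case: (v == f u); case: (u == f v) => /=; lia.
Qed.

(* A circulation is balanced on the edges off the cycle, since nothing else
   leaves the subtree hanging from such an edge, and constant along the cycle. *)
Lemma circulationE m c f : core f != set0 -> orients m c f ->
    (forall u, outdeg c u = indeg c u) ->
  exists2 a, a <= 2 * m & forall u v, c u v = edge_mx f a (2 * m - a) m u v.
Proof.
move=> /set0Pn[z zc] /orientsP cf b.
have c0 u v : v != f u -> u != f v -> c u v = 0.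
  by move=> /negbTE vu /negbTE uv; have := cf u v; rewrite /joins vu uv; lia.
(* Descent: an unbalanced edge at a vertex off the cycle forces, by balance at this vertex, another
   one hanging from it; after [#|V|] repetitions [u] would lie on the cycle. *)
have off u : u \notin core f -> c u (f u) = c (f u) u.
  move=> uc; apply/eqP; apply: contraT => cN.
  suff : u \in core f by rewrite (negbTE uc).
  suff [x <-] : exists x, iter #|V| f x = u by apply: iter_card_in_core zc.
  suff [x [xu _ _]] : exists x, [/\ iter #|V| f x = u, x \notin core f & c x (f x) != c (f x) x].
    by exists x.
  elim: #|V| => [|n [x [xu xc cx]]]; first by exists u.
  have /existsP[v /andP[vx cv]] : [exists v, (v != f x) && (c x v != c v x)].
    apply: contraR cx; rewrite negb_exists => /forallP H; apply/eqP.
    apply: (@sum_nat_eq1 (c x) (c^~ x)); first exact: b.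
    by move=> v vx; apply/eqP; have := H v; rewrite vx negbK.
  have xv : x = f v.
    by apply/eqP; apply: contraNT cv => xv; rewrite !c0.
  exists v; rewrite iterSr -xv; split=> //; last by rewrite eq_sym.
  by apply: contraNN xc; rewrite xv; apply: f_core.
have on u v : u \in core f -> v != f u -> v != core_pred f u -> c u v = c v u.
  move=> uc vu vp; have [E|uv] := eqVneq u (f v); last by rewrite !c0.
  rewrite {2}E off -?E //; apply: contraNN vp => vc.
  by rewrite E core_pred_f.
suff [a am main] : exists2 a, a <= 2 * m &
    forall u, c u (f u) = edge_mx f a (2 * m - a) m u (f u).
  exists a => // u v; have [->//|vu] := eqVneq v (f u).
  have [E|uv] := eqVneq u (f v); last first.
    by rewrite c0 // /edge_mx (negbTE vu) (negbTE uv).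
  have /orientsP/(_ u v) := @orients_edge_mx f a (2 * m - a) m (subnKC am).
  by rewrite -cf {2 4}E -main; lia.
have main_off a u : u \notin core f -> c u (f u) = edge_mx f a (2 * m - a) m u (f u).
  move=> uc; have := cf u (f u); rewrite -(off u uc) /edge_mx /joins eqxx (negbTE uc).
  by rewrite (negbTE (off_core_neq zc uc)); lia.
have [k2|k3] := leqP #|core f| 2.
  (* Balance makes the cycle edges be crossed equally often both ways, hence [a = m]. *)
  exists m => [|u]; first lia.
  have [uc|] := boolP (u \in core f); last exact: main_off.
  have fp : core_pred f u = f u.
    by move: k2; rewrite -rev_neq => /eqP/ffunP/(_ u); rewrite ffunE uc.
  have E : c u (f u) = c (f u) u.
    apply: (@sum_nat_eq1 (c u) (c^~ u)); first exact: b.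
    by move=> v vu; apply: on; rewrite ?fp.
  have := cf u (f u); rewrite -E /edge_mx /joins eqxx uc f_core //.
  by case: eqP => _; lia.
have neq u : u \in core f -> u != f (f u).
  by move=> uc; apply: (@core_iter_neq _ f u 0 2).
have cfu u : u \in core f -> c u (f u) + c (f u) u = 2 * m.
  by move=> uc; rewrite cf /joins eqxx (negbTE (neq u uc)); lia.
have step u : u \in core f -> c (f u) (f (f u)) = c u (f u).
  move=> uc; have := @sum_nat_eq2 (c (f u)) (c^~ (f u)) (f (f u)) u.
  have := cfu _ uc; have := cfu _ (f_core uc).
  rewrite eq_sym neq // => E1 E2 /(_ isT (b (f u))).
  have H v : v != f (f u) -> v != u -> c (f u) v = c v (f u).
    by move=> v1 v2; apply: on; rewrite ?f_core ?core_pred_f.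
  by move=> /(_ H); lia.
exists (c z (f z)) => [|u]; first by have := cfu z zc; lia.
have [uc|] := boolP (u \in core f); last exact: main_off.
rewrite /edge_mx eqxx (negbTE (neq u uc)) uc mul1n addn0.
have [_ <-] := findex_core zc uc; elim: (findex _ _ _) => //= n <-.
by rewrite step ?iter_core.
Qed.

End Orientations.

(** * Weighted forests *)

Lemma iter_eq_in (T : finType) (A : {pred T}) (p q : T -> T) x n :
    (forall y, y \in A -> p y \in A /\ p y = q y) -> x \in A ->
  iter n p x = iter n q x /\ iter n p x \in A.
Proof.
by move=> H xA; elim: n => //= n [<- nA]; have [pA <-] := H _ nA.
Qed.

Lemma fconnect_eq_in (T : finType) (A : {pred T}) (p q : T -> T) x y :
    (forall y, y \in A -> p y \in A /\ p y = q y) -> x \in A ->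
  fconnect p x y = fconnect q x y.
Proof.
move=> H xA; apply/idP/idP => /iter_findex <-; set n := findex _ _ _;
  have [E _] := iter_eq_in n H xA.
  by rewrite E fconnect_iter.
by rewrite -E fconnect_iter.
Qed.

Section Forests.
Variable T : finType.
Implicit Types (p q : {ffun T -> T}) (S R U : {set T}) (x y u b : T).

(** For disjoint [S] and [R], the parent maps of the forests on [S :|: R] with root set [S]; being
    the identity outside [R] makes the map unique to its forest. *)
Definition forest S R : {set {ffun T -> T}} :=
  [set p : {ffun T -> T} | [forall x, (x \notin R) ==> (p x == x)] &&
     [forall x in R, [exists y in S, fconnect p x y]]].

Lemma forestP S R p : reflect ((forall x, x \notin R -> p x = x) /\
    (forall x, x \in R -> exists2 y, y \in S & fconnect p x y)) (p \in forest S R).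
Proof.
rewrite inE; apply: (iffP andP) => -[H1 H2]; split.
- by move=> x xR; apply/eqP; apply: (implyP (forallP H1 x)).
- by move=> x xR; apply/exists_inP; apply: (implyP (forallP H2 x)).
- by apply/forallP => x; apply/implyP => xR; rewrite H1.
by apply/forall_inP => x xR; apply/exists_inP; apply: H2.
Qed.

Lemma fconnect_fixed p x y : p x = x -> fconnect p x y = (x == y).
Proof.
move=> px; apply/idP/eqP => [/iter_findex <-|->]; last exact: connect0.
by elim: (findex p x y) => //= n {1}<-.
Qed.

Lemma forest_step S R p x : [disjoint S & R] -> p \in forest S R -> x \in R ->
  p x \in R :|: S.
Proof.
move=> dSR /forestP[p1 p2] xR; rewrite inE; case: (boolP (p x \in R)) => //= pxR.
have [y yS] := p2 x xR; rewrite fconnect_eqVf => /orP[/eqP xy|].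
  by move/pred0P: dSR => /(_ x); rewrite /= {1}xy yS xR.
by rewrite (fconnect_fixed _ (p1 _ pxR)) => /eqP ->.
Qed.

Definition restr U p : {ffun T -> T} := [ffun x => if x \in U then p x else x].

Definition preim_count R p u := #|[set x in R | p x == u]|.

Section Weights.
Variables (K : comNzRingType) (hs hm : nat -> K).

Definition forest_weight S R p : K :=
  (\prod_(u in S) hs (preim_count R p u) *
   \prod_(u in R) hm (preim_count R p u))%R.

Definition forest_sum S R : K := (\sum_(p in forest S R) forest_weight S R p)%R.

Lemma forest_sum0 R : forest_sum set0 R = ((R == set0)%:R)%R.
Proof.
rewrite /forest_sum; have [->|[x xR]] := set_0Vmem R.
  rewrite eqxx (big_pred1 (finfun id)) => [|p].
    by rewrite /forest_weight !big_set0 mulr1.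
  apply/forestP/eqP => [[p1 _]|->].
    by apply/ffunP => x; rewrite ffunE p1 // inE.
  by split=> x; rewrite ?ffunE ?inE.
rewrite big_pred0 => [|p]; first by case: eqP xR => // ->; rewrite inE.
apply/negP => /forestP[_ /(_ x xR)[y]]; by rewrite inE.
Qed.

Section Split.
Variables (b : T) (S R : {set T}).
Hypotheses (bS : b \notin S) (bR : b \notin R) (dSR : [disjoint S & R]).

Let SR x : x \in S -> x \notin R.
Proof. by move=> xS; have := disjointFr dSR xS => ->. Qed.

Definition glue U (pq : {ffun T -> T} * {ffun T -> T}) : {ffun T -> T} :=
  [ffun x => if x \in U then pq.1 x else pq.2 x].

Definition hanging p := [set x in R | fconnect p x b].

Section Fixed.
Variable U : {set T}.
Hypothesis UR : U \subset R.

Let bU : b \notin U.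
Proof. by apply: contraNN bR; apply: subsetP UR _. Qed.

Let dbU : [disjoint [set b] & U].
Proof. by rewrite disjoints1. Qed.

Let dSU : [disjoint S & R :\: U].
Proof. exact: disjointWr (subsetDl _ _) dSR. Qed.

Section Glue.
Variables p q : {ffun T -> T}.
Hypotheses (pU : p \in forest [set b] U) (qU : q \in forest S (R :\: U)).

Let A1 y : y \in U :|: [set b] ->
  p y \in U :|: [set b] /\ p y = glue U (p, q) y.
Proof.
have /forestP[q1 _] := qU; have /forestP[p1 _] := pU.
rewrite inE => /orP[yU|]; first by rewrite ffunE yU (forest_step dbU).
rewrite inE => /eqP ->; rewrite ffunE (negbTE bU) p1 // q1 ?inE ?(negbTE bR) ?andbF //.
by rewrite eqxx orbT.
Qed.

Let A2 y : y \in (R :\: U) :|: S ->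
  q y \in (R :\: U) :|: S /\ q y = glue U (p, q) y.
Proof.
have /forestP[q1 _] := qU; have /forestP[p1 _] := pU.
rewrite inE => /orP[yU|yS].
  by rewrite ffunE (forest_step dSU) //; case/setDP: yU => _ /negbTE ->.
have yR := SR yS; rewrite ffunE q1; last by rewrite inE (negbTE yR) andbF.
case: ifP => [yU|_]; last by rewrite inE yS orbT.
by rewrite (subsetP UR) in yR.
Qed.

Let glue_U x : x \in U -> fconnect (glue U (p, q)) x b.
Proof.
move=> xU; have xA : x \in U :|: [set b] by rewrite inE xU.
rewrite -(fconnect_eq_in _ A1 xA); have /forestP[_ /(_ x xU)[y]] := pU.
by rewrite inE => /eqP ->.
Qed.

Let glue_D x : x \in R :\: U -> ~~ fconnect (glue U (p, q)) x b /\
  exists2 y, y \in S & fconnect (glue U (p, q)) x y.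
Proof.
move=> xU; have xA : x \in (R :\: U) :|: S by rewrite inE xU.
split; last first.
  have /forestP[_ /(_ x xU)[y yS qy]] := qU.
  by exists y => //; rewrite -(fconnect_eq_in _ A2 xA).
rewrite -(fconnect_eq_in _ A2 xA); apply/negP => /iter_findex E.
have [_] := iter_eq_in (findex q x b) A2 xA; rewrite E !inE.
by rewrite (negbTE bS) (negbTE bR) andbF.
Qed.

Lemma glue_forest : glue U (p, q) \in forest (b |: S) R /\ hanging (glue U (p, q)) = U.
Proof.
split.
  apply/forestP; split=> x xR.
    rewrite ffunE /=; case: ifP => [xU|_]; first by rewrite (subsetP UR) in xR.
    by have /forestP[-> //] := qU; rewrite inE (negbTE xR) andbF.
  have [xU|xU] := boolP (x \in U).
    by exists b; [rewrite !inE eqxx | apply: glue_U].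
  have [|_ [y yS cy]] := @glue_D x; first by rewrite inE xU.
  by exists y => //; rewrite !inE yS orbT.
apply/setP => x; rewrite inE; have [xU|xU] := boolP (x \in U).
  by rewrite (subsetP UR) //= glue_U.
case: (boolP (x \in R)) => //= xR.
by have [|/negbTE ->] := @glue_D x; first by rewrite inE xU.
Qed.

(** No edge joins the two parts, so the children of a vertex all lie in its own part. *)
Lemma glue_weight : forest_weight (b |: S) R (glue U (p, q)) =
  (forest_weight [set b] U p * forest_weight S (R :\: U) q)%R.
Proof.
have E1 u : u \in U :|: [set b] ->
    preim_count R (glue U (p, q)) u = preim_count U p u.
  move=> uA; apply: eq_card => x; rewrite !inE ffunE /=.
  have [xU|xU] := boolP (x \in U); first by rewrite (subsetP UR).
  case: (boolP (x \in R)) => //= xR; apply/eqP => E.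
  have [|qA _] := @A2 x; first by rewrite !inE xU xR.
  move: qA; rewrite E !inE; move: uA; rewrite !inE => /orP[uU|/eqP ->].
    by rewrite uU /= => /SR; rewrite (subsetP UR).
  by rewrite (negbTE bS) (negbTE bR) andbF.
have E2 u : u \in (R :\: U) :|: S ->
    preim_count R (glue U (p, q)) u = preim_count (R :\: U) q u.
  move=> uA; apply: eq_card => x; rewrite !inE ffunE /=.
  have [xU|xU] := boolP (x \in U); last by [].
  rewrite (subsetP UR) //=; apply/eqP => E.
  have [|pA _] := @A1 x; first by rewrite !inE xU.
  move: pA uA; rewrite E !inE => /orP[uU|/eqP ->].
    by rewrite uU /= => /SR; rewrite (subsetP UR).
  by rewrite (negbTE bS) (negbTE bR) andbF.
rewrite /forest_weight big_setU1 //= big_set1 E1 ?inE ?eqxx ?orbT //.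
rewrite (eq_bigr (fun u => hs (preim_count (R :\: U) q u))) => [|u uS]; last first.
  by rewrite E2 // inE uS orbT.
rewrite [X in (_ * X)%R](bigID (fun u => u \in U)) /= mulrACA.
congr (_ * _ * (_ * _))%R.
  apply: eq_big => [u|u /andP[_ uU]]; last by rewrite E1 // inE uU.
  by have [uU|] := boolP (u \in U); rewrite ?andbF // (subsetP UR).
apply: eq_big => [u|u /andP[uR uU]]; first by rewrite inE andbC.
by rewrite E2 // !inE uU uR.
Qed.

Lemma restr_glue : restr U (glue U (p, q)) = p /\ restr (R :\: U) (glue U (p, q)) = q.
Proof.
have /forestP[q1 _] := qU; have /forestP[p1 _] := pU.
split; apply/ffunP => x; rewrite !ffunE; case: ifPn => // xN.
- by rewrite xN.
- by rewrite p1.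
- by case/setDP: xN => _ /negbTE ->.
by rewrite q1.
Qed.

End Glue.

Lemma restr_forest f : f \in forest (b |: S) R -> hanging f = U ->
  [/\ restr U f \in forest [set b] U, restr (R :\: U) f \in forest S (R :\: U)
    & glue U (restr U f, restr (R :\: U) f) = f].
Proof.
move=> ff fU; have /forestP[f1 f2] := ff.
have UE x : x \in R -> (x \in U) = fconnect f x b by rewrite -fU inE => ->.
have fb : f b = b by apply: f1.
have dbSR : [disjoint b |: S & R] by rewrite -setI_eq0 setIUl setU_eq0 !setI_eq0 disjoints1 bR.
have step x : x \in R -> f x \in R -> (f x \in U) = (x \in U).
  move=> xR fxR; rewrite !UE // [in RHS]fconnect_eqVf.
  by case: eqP xR bR => [->|//] ->.
have stepb x : x \in R -> f x = b -> x \in U.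
  by move=> xR fx; rewrite UE // -fx fconnect1.
split.
- apply/forestP; split=> x xU; first by rewrite ffunE (negbTE xU).
  exists b; first by rewrite inE.
  have xA : x \in U :|: [set b] by rewrite inE xU.
  rewrite (@fconnect_eq_in _ _ _ f _ _ _ xA) ?UE -?UE ?(subsetP UR) //.
  move=> y; rewrite inE => /orP[yU|]; last first.
    by rewrite inE => /eqP ->; rewrite ffunE (negbTE bU) !inE eqxx orbT fb.
  rewrite ffunE yU; split=> //; have yR := subsetP UR _ yU.
  have := forest_step dbSR ff yR; rewrite !inE; case: eqP => [|_]; rewrite ?orbT //.
  case/orP => [fyR|/=fyS]; first by rewrite step // yU.
  move: yU; rewrite UE // fconnect_eqVf; case: eqP yR bR => [-> ->//|_ _ _ /=].
  rewrite (fconnect_fixed _ (f1 _ (SR fyS))) => /eqP E.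
  by move: fyS bS; rewrite E => ->.
- apply/forestP; split=> x xU; first by rewrite ffunE (negbTE xU).
  have xA : x \in (R :\: U) :|: S by rewrite inE xU.
  have H y : y \in (R :\: U) :|: S ->
      restr (R :\: U) f y \in (R :\: U) :|: S /\ restr (R :\: U) f y = f y.
    rewrite ffunE inE; have [yU _|yU /= yS] := boolP (y \in R :\: U); last first.
      by rewrite inE yS orbT f1 // SR.
    split=> //; case/setDP: (yU) => yR yNU; have := forest_step dbSR ff yR.
    rewrite !inE; case/or3P => [fyR|/eqP fyb|->]; last by rewrite orbT.
      by rewrite step // yNU fyR.
    by rewrite stepb in yNU.
  case/setDP: (xU) => xR xNU; have [y] := f2 x xR.
  rewrite !inE => /orP[/eqP ->|yS] xy; first by rewrite UE // xy in xNU.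
  by exists y; rewrite // (fconnect_eq_in _ H).
apply/ffunP => x; rewrite !ffunE /= !inE; case: ifPn => xU; rewrite xU //=.
by case: ifPn => // xR; rewrite f1.
Qed.

(** [glue U] and the pair of restrictions are inverse bijections. *)
Lemma forest_sum_hanging :
  (\sum_(f in forest (b |: S) R | hanging f == U) forest_weight (b |: S) R f =
   forest_sum [set b] U * forest_sum S (R :\: U))%R.
Proof.
rewrite /forest_sum [RHS]big_distrl /=.
under [RHS]eq_bigr do rewrite big_distrr /=.
rewrite [RHS]pair_big /=.
rewrite (reindex_onto (glue U) (fun f => (restr U f, restr (R :\: U) f))) /=.
  apply: eq_big => [[p q]|[p q] /andP[/andP[fF /eqP fU] /eqP E]] /=.
    apply/andP/andP => [[/andP[fF /eqP fU] /eqP E]|[pU qU]].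
      by have [] := restr_forest fF fU; case: E => -> ->.
    have [gF gU] := glue_forest pU qU; have [-> ->] := restr_glue pU qU.
    by rewrite gF gU !eqxx.
  by case: E (restr_forest fF fU) => -> -> [pU qU _]; rewrite glue_weight.
by move=> f /andP[fF /eqP fU]; have [_ _] := restr_forest fF fU.
Qed.

End Fixed.

Lemma forest_sum_split : forest_sum (b |: S) R =
  (\sum_(U : {set T} | U \subset R) forest_sum [set b] U * forest_sum S (R :\: U))%R.
Proof.
rewrite {1}/forest_sum (partition_big hanging (fun U => U \subset R)) /=.
  by apply: eq_bigr => U UR; rewrite forest_sum_hanging.
by move=> f _; apply/subsetP => x; rewrite inE => /andP[].
Qed.

End Split.

End Weights.

End Forests.

Section Transport.
Variables (T T' : finType) (g : T' -> T).
Hypothesis gI : injective g.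
Variables (K : comNzRingType) (hs hm : nat -> K).
Implicit Types S R : {set T'}.

Definition push (p : {ffun T' -> T'}) : {ffun T -> T} :=
  [ffun x => if [pick y | g y == x] is Some y then g (p y) else x].

Definition pull (p : {ffun T -> T}) : {ffun T' -> T'} :=
  [ffun y => if [pick y' | g y' == p (g y)] is Some y' then y' else y].

Let pick_g y : [pick y' | g y' == g y] = Some y.
Proof.
by case: pickP => [y' /eqP/gI -> //|/(_ y)]; rewrite eqxx.
Qed.

Let push_g p y : push p (g y) = g (p y).
Proof. by rewrite ffunE pick_g. Qed.

Let push_out p x : x \notin codom g -> push p x = x.
Proof.
by rewrite ffunE; case: pickP => // y /eqP <-; rewrite codom_f.
Qed.

Let pushK p : pull (push p) = p.
Proof. by apply/ffunP => y; rewrite ffunE push_g pick_g. Qed.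

Let fconnect_push p x y : fconnect (push p) (g x) (g y) = fconnect p x y.
Proof.
have E n z : iter n (push p) (g z) = g (iter n p z).
  by elim: n => //= n ->; rewrite push_g.
apply/idP/idP => /iter_findex; last by move=> <-; rewrite -E fconnect_iter.
by rewrite E => /gI <-; apply: fconnect_iter.
Qed.

Let push_forest S R p :
  (push p \in forest (g @: S) (g @: R)) = (p \in forest S R).
Proof.
apply/forestP/forestP => -[p1 p2]; split=> x xR.
- by apply: gI; rewrite -push_g p1 // mem_imset.
- have [|z] := p2 (g x); first by rewrite mem_imset.
  by case/imsetP => y yS ->; rewrite fconnect_push; exists y.
- have [/codomP[y xE]|] := boolP (x \in codom g); last exact: push_out.
  by rewrite xE push_g p1 //; move: xR; rewrite xE mem_imset.
case/imsetP: xR => z zR ->; have [y yS yz] := p2 z zR.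
by exists (g y); rewrite ?mem_imset ?fconnect_push.
Qed.

Let pullK S R p : [disjoint S & R] -> p \in forest (g @: S) (g @: R) ->
  push (pull p) = p.
Proof.
move=> dSR pF; have /forestP[p1 p2] := pF.
have dg : [disjoint g @: S & g @: R].
  by rewrite -setI_eq0 -imsetI ?imset_eq0 ?setI_eq0 // => x y _ _; apply: gI.
apply/ffunP => x; have [/codomP[y ->]|xN] := boolP (x \in codom g); last first.
  rewrite push_out // p1 //; apply: contraNN xN => /imsetP[y _ ->].
  exact: codom_f.
rewrite push_g ffunE; case: pickP => [y' /eqP //|H].
have [yR|yR] := boolP (g y \in g @: R); last by rewrite p1.
have := forest_step dg pF yR; rewrite inE => /orP[] /imsetP[z _ E];
  by have := H z; rewrite E eqxx.
Qed.

(** Invariance under relabelling, by which a tree on any root and any vertex set can be moved to the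
    standard type [option 'I_v]. *)
Lemma forest_sum_imset S R : [disjoint S & R] ->
  forest_sum hs hm (g @: S) (g @: R) = forest_sum hs hm S R.
Proof.
move=> dSR; rewrite /forest_sum (reindex_onto push pull) /=; last first.
  by move=> p; apply: pullK.
apply: eq_big => [p|p _]; first by rewrite pushK eqxx andbT push_forest.
have E u : preim_count (g @: R) (push p) (g u) = preim_count R p u.
  rewrite /preim_count -(card_imset _ gI); apply: eq_card => x.
  apply/idP/imsetP => [|[y]].
    rewrite inE => /andP[/imsetP[y yR ->]]; rewrite push_g => /eqP/gI <-.
    by exists y; rewrite // inE yR eqxx.
  by rewrite !inE => /andP[yR /eqP <-] ->; rewrite mem_imset // yR push_g eqxx.
rewrite /forest_weight !big_imset /=; try by move=> x y _ _; apply: gI.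
by congr (_ * _)%R; apply: eq_bigr => u _; rewrite E.
Qed.

End Transport.

Section ForestSeries.
Variables (K : numFieldType) (hs hm : nat -> K).
Local Open Scope ring_scope.

Definition labelled_trees v : K :=
  forest_sum hs hm [set None : option 'I_v] (~: [set None]).

(** The exponential generating series in the number of vertices other than the root. *)
Definition tree_egf : fps K := Fps (fun v => labelled_trees v / v`!%:R).

Lemma forest_sum1 (T : finType) (b : T) (U : {set T}) : b \notin U ->
  forest_sum hs hm [set b] U = labelled_trees #|U|.
Proof.
move=> bU; pose g (i : option 'I_#|U|) := if i is Some i then enum_val i else b.
have gI : injective g.
  move=> [i|] [j|] //=; first by move/enum_val_inj ->.
    by move=> E; move: bU; rewrite -E enum_valP.
  by move=> E; move: bU; rewrite E enum_valP.
rewrite /labelled_trees -(forest_sum_imset gI hs hm); last first.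
  by rewrite disjoints1 !inE eqxx.
congr forest_sum; first by rewrite imset_set1.
apply/setP => x; apply/idP/imsetP => [xU|[[i|]]]; last by rewrite !inE eqxx.
  by exists (Some (enum_rank_in xU x)); rewrite ?inE //= enum_rankK_in.
by move=> _ ->; apply: enum_valP.
Qed.

Lemma sum_subsets (T : finType) (R : {set T}) (F : nat -> K) :
  \sum_(U : {set T} | U \subset R) F #|U| =
  \sum_(j < #|R|.+1) 'C(#|R|, j)%:R * F j.
Proof.
rewrite (partition_big (fun U : {set T} => inord #|U| : 'I_#|R|.+1) predT) //=.
apply: eq_bigr => j _; rewrite -cards_draws -[X in X%:R * _]sum1_card natr_sum mulr_suml.
apply: eq_big => [U|U /andP[UR /eqP <-]].
  rewrite inE; case: (boolP (U \subset R)) => //= UR.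
  by rewrite -val_eqE /= inordK // ltnS subset_leq_card.
by rewrite inordK ?mul1r // ltnS subset_leq_card.
Qed.

(* The exponential formula, by splitting off the vertices hanging from one root. *)
Lemma forest_sumE (T : finType) (S R : {set T}) : [disjoint S & R] ->
  forest_sum hs hm S R = #|R|`!%:R * (tree_egf ^+ #|S|) #|R|.
Proof.
elim: {S}#|S| {-2}S (erefl #|S|) R => [|k IH] S kE R dSR.
  have -> : S = set0 by apply/eqP; rewrite -cards_eq0 kE.
  rewrite forest_sum0 cards0 expr0 /= cards_eq0.
  by case: eqP => [->|]; rewrite ?cards0 ?mulr1 ?mulr0.
have /card_gt0P[b bS] : (0 < #|S|)%N by rewrite kE.
rewrite kE exprS; rewrite (cardsD1 b) bS add1n in kE; case: kE => kE.
have bN : b \notin S :\ b by rewrite !inE eqxx.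
have bR : b \notin R by rewrite (disjointFr dSR).
have dS : [disjoint S :\ b & R] by apply: disjointWl dSR; apply: subsetDl.
rewrite -(setD1K bS) (forest_sum_split hs hm bN bR dS).
rewrite (eq_bigr (fun U : {set T} => labelled_trees #|U| *
    (((#|R| - #|U|)`!)%N%:R * (tree_egf ^+ k) (#|R| - #|U|)%N))) => [|U UR]; last first.
  rewrite forest_sum1; last by apply: contraNN bR; apply: subsetP UR b.
  rewrite IH // ?kE ?cardsDS //.
  exact: disjointWr (subsetDl _ _) dS.
rewrite (sum_subsets R (fun j => labelled_trees j *
    (((#|R| - j)`!)%N%:R * (tree_egf ^+ k) (#|R| - j)%N))).
rewrite [X in _ * X](_ : _ = \sum_(j < #|R|.+1) tree_egf j * (tree_egf ^+ k) (#|R| - j)%N) //.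
rewrite mulr_sumr; apply: eq_bigr => j _ /=.
have /(congr1 (fun n => n%:R : K)) := @bin_fact #|R| j (ltn_ord j); rewrite !natrM => <-.
have : (j`!)%N%:R != 0 :> K by rewrite pnatr_eq0 -lt0n fact_gt0.
by move=> j0; field.
Qed.

End ForestSeries.

(** * The exponential formula for functions with a single cycle *)

Section Endofunctions.
Variable V : finType.
Variables (K : numFieldType) (hs hm : nat -> K).
Local Open Scope ring_scope.
Implicit Type f : {ffun V -> V}.

Definition endo_weight f : K :=
  \prod_(u in core f) hs (off_core f u) * \prod_(u in ~: core f) hm (off_core f u).

Definition cyclic_on k (s : k.+1.-tuple V) f :=
  fcycle f s && [forall x, fconnect f x (thead s)].

Lemma thead_mem k (s : k.+1.-tuple V) : thead s \in s.
Proof. by rewrite {2}[s]tuple_eta mem_head. Qed.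

Lemma cyclic_onP k (s : k.+1.-tuple V) f : uniq s -> cyclic_on s f ->
  [/\ thead s \in core f, core f = [set x in s] & traject f (thead s) k.+1 = s].
Proof.
case/tupleP: s => x0 s0; set s := [tuple of _] => us /andP[cs /forallP fs].
have tc : thead s \in core f by apply/coreP.
have E : orbit f (thead s) = s.
  rewrite (orbitE cs us (thead_mem s)) (_ : index _ _ = 0%N) ?rot0 //.
  by rewrite theadE /= eqxx.
split=> //; first by apply/setP => x; rewrite (core_fconnect _ tc) fconnect_orbit E inE.
have o : order f (thead s) = k.+1 by rewrite -size_orbit E size_tuple.
by move: E; rewrite /orbit o.
Qed.

(** Removing the cycle edges leaves a forest rooted at the cycle; [close], which restores them by
    [next s], is the inverse. *)
Lemma cyclic_on_sum k (s : k.+1.-tuple V) : uniq s ->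
  \sum_(f | cyclic_on s f) endo_weight f =
  forest_sum hs hm [set x in s] (~: [set x in s]).
Proof.
move=> us; set S := [set x in s].
have memS x : (x \in S) = (x \in s) by rewrite inE.
pose close (p : {ffun V -> V}) : {ffun V -> V} :=
  [ffun x => if x \in S then next s x else p x].
have close_core p : p \in forest S (~: S) -> cyclic_on s (close p).
  move=> /forestP[_ p2]; have cs : fcycle (close p) s.
    apply: cycle_from_next => // x xs; by rewrite /= ffunE memS xs.
  apply/andP; split=> //; apply/forallP => x.
  have loop y : y \in S -> fconnect (close p) y (thead s).
    by rewrite memS => ys; rewrite (fconnect_cycle cs ys) thead_mem.
  have [xS|xS] := boolP (x \in S); first exact: loop.
  have [|y yS /iter_findex yE] := p2 x; first by rewrite inE.
  have : iter (findex p x y) p x \in S by rewrite yE.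
  move: (findex p x y) {yE} => n; elim: n x {xS} => [|n IH] x; first exact: loop.
  rewrite iterSr => /IH H; have [xS|xS] := boolP (x \in S); first exact: loop.
  by apply: connect_trans (fconnect1 _ _) _; rewrite ffunE (negbTE xS).
have close_restr f : cyclic_on s f -> close (restr (~: S) f) = f.
  case/andP => cs _; apply/ffunP => x; rewrite !ffunE in_setC.
  by have [xS|xS] := boolP (x \in S); rewrite ?(nextE cs) -?memS.
rewrite /forest_sum (reindex_onto close (restr (~: S))) //=.
have restr_close (p : {ffun V -> V}) : (forall x, x \in S -> p x = x) -> restr (~: S) (close p) = p.
  move=> pS; apply/ffunP => x; rewrite !ffunE in_setC.
  case: (boolP (x \in S)) => xS /=; last by [].
  by rewrite pS.
apply: eq_big => [p|p /andP[cp /eqP pE]].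
  apply/andP/idP => [[cp /eqP pE]|pF].
    have [tc cE _] := cyclic_onP us cp; rewrite -/S in cE.
    apply/forestP; split=> x xS; first by rewrite -pE ffunE (negbTE xS).
    have /andP[_ /forallP/(_ x)/iter_findex] := cp; move: (findex _ _ _) => n.
    elim: n x {xS} => [|n IH] x; first by move=> /= ->; exists (thead s); rewrite ?memS ?thead_mem.
    rewrite iterSr => H; have [xS|xS] := boolP (x \in S); first by exists x.
    move: H; rewrite ffunE (negbTE xS) => /IH[y yS py]; exists y => //.
    exact: connect_trans (fconnect1 _ _) py.
  split; first exact: close_core.
  by apply/eqP/restr_close => x xS; have /forestP[-> //] := pF; rewrite inE xS.
have [tc cE _] := cyclic_onP us cp; rewrite -/S in cE.
rewrite /endo_weight cE; have E u : off_core (close p) u = preim_count (~: S) p u.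
  apply: eq_card => x; rewrite in_set in_set cE in_setC.
  by case: (boolP (x \in S)) => //= xS; rewrite ffunE (negbTE xS).
by congr (_ * _); apply: eq_bigr => u _; rewrite E.
Qed.

(** The factor [k.+1] counts the starting points on the cycle. The injective tuples number
    [#|V| ^_ k.+1], which times the [(#|V| - k.+1)!] of [forest_sumE] is [#|V|!]. *)
Lemma endo_sum k :
  k.+1%:R * \sum_(f : {ffun V -> V} | #|core f| == k.+1) endo_weight f =
  #|V|`!%:R * (if (k < #|V|)%N then (tree_egf hs hm ^+ k.+1) (#|V| - k.+1)%N else 0).
Proof.
transitivity (\sum_(s : k.+1.-tuple V | uniq s) \sum_(f | cyclic_on s f) endo_weight f).
  rewrite (exchange_big_dep (fun f => #|core f| == k.+1)) /=; last first.
    move=> s f us /(cyclic_onP us)[_ -> _].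
    by rewrite cardsE (card_uniqP us) size_tuple.
  rewrite mulr_sumr; apply: eq_bigr => f /eqP fk.
  rewrite sumr_const mulr_natl; congr (_ *+ _).
  transitivity #|core f|; first by rewrite fk.
  pose tr z : k.+1.-tuple V := Tuple (introT eqP (size_traject f z k.+1)).
  rewrite -(card_in_imset (f := tr)).
    apply: eq_card => s; apply/imsetP/andP => [[z zc ->]|[us cs]].
      have zo : traject f z k.+1 = orbit f z by rewrite /orbit order_core // fk.
      split; first by rewrite -[tval _]/(traject f z k.+1) zo orbit_uniq.
      rewrite /cyclic_on -[tval _]/(traject f z k.+1) zo; apply/andP; split.
        rewrite -fconnect_f; by move/coreP: zc; apply.
      by apply/forallP => x; move/coreP: zc; apply.
    have [tc cE tE] := cyclic_onP us cs.
    by exists (thead s) => //; apply/val_inj.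
  by move=> z z' _ _ /(congr1 val) /= [].
have E (s : k.+1.-tuple V) : uniq s -> #|[set x in s]| = k.+1.
  by move=> us; rewrite cardsE (card_uniqP us) size_tuple.
rewrite (eq_bigr (fun=> ((#|V| - k.+1)`!)%N%:R *
    (tree_egf hs hm ^+ k.+1) (#|V| - k.+1)%N)) => [|s us]; last first.
  rewrite cyclic_on_sum // forest_sumE -?setI_eq0 ?setICr // E //.
  by rewrite cardsCs setCK E.
rewrite sumr_const -[LHS]mulr_natl.
have -> : #|[pred s : k.+1.-tuple V | uniq s]| = (#|V| ^_ k.+1)%N.
  rewrite -card_uniq_tuples; apply: eq_card => s; rewrite !inE.
  by rewrite (introT allP) ?andbT // => x; rewrite inE.
case: ifPn => [kV|]; last first.
  by rewrite -leqNgt => Vk; rewrite ffact_small // mulr0n mul0r mulr0.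
by rewrite mulrA -natrM ffact_fact.
Qed.

End Endofunctions.

(** * Depth-first tours of labelled plane trees *)

Inductive ltree (V : Type) := LNode of V & seq (ltree V).
Arguments LNode {V}.

Section LabelledTrees.
Variable V : eqType.
Implicit Types (t u : ltree V) (ts us : seq (ltree V)) (x y q : V) (s : seq V).

Definition lab t := let: LNode x _ := t in x.
Definition subtrees t := let: LNode _ ts := t in ts.

Lemma ltree_ind' (Q : ltree V -> Prop) :
  (forall x ts, foldr (fun t => and (Q t)) True ts -> Q (LNode x ts)) ->
  forall t, Q t.
Proof.
move=> QN; fix IH 1 => -[x ts]; apply: QN.
by elim: ts => [|t ts IHts] //=; split.
Qed.

(** The depth-first walk round the tree, without its starting vertex: each subtree contributes the
    step to its root, its own tour and the step back. *)
Fixpoint tour t : seq V :=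
  let: LNode x ts := t in flatten [seq lab u :: rcons (tour u) x | u <- ts].

Definition forest_tour q ts : seq V :=
  flatten [seq lab u :: rcons (tour u) q | u <- ts].

Lemma tourE x ts : tour (LNode x ts) = forest_tour x ts.
Proof. by []. Qed.

Fixpoint edges t : seq (V * V) :=
  let: LNode x ts := t in flatten [seq (x, lab u) :: edges u | u <- ts].

Definition swap (e : V * V) := (e.2, e.1).

Lemma last_forest_tour q ts : last q (forest_tour q ts) = q.
Proof.
by elim: ts => //= t ts IH; rewrite last_cat /= last_rcons.
Qed.

Lemma last_tour t : last (lab t) (tour t) = lab t.
Proof. by case: t => x ts; apply: last_forest_tour. Qed.

Lemma count_steps_forest_tour (a : pred (V * V)) q ts :
  count a (pairmap pair q (forest_tour q ts)) =
    sumn [seq a (q, lab u) + a (lab u, q) +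
              count a (pairmap pair (lab u) (tour u)) | u <- ts].
Proof.
elim: ts => //= t ts IH.
rewrite pairmap_cat count_cat -cats1 pairmap_cat count_cat last_cat last_tour /=.
by rewrite IH addn0; lia.
Qed.

(** Each edge is crossed once downwards and once upwards. *)
Lemma count_steps_tour (a : pred (V * V)) t :
  count a (pairmap pair (lab t) (tour t)) =
    count a (edges t) + count (fun e => a (swap e)) (edges t).
Proof.
elim/ltree_ind': t => x ts IH; rewrite count_steps_forest_tour /=.
elim: ts IH => //= t ts IHts [IHt /IHts {}IHts].
rewrite IHts IHt !count_cat [swap (x, _)]/swap /=.
move: (count _ _) (count _ _) (count _ _) (count _ _) => n1 n2 n3 n4; lia.
Qed.

Variables (z : V) (p : V -> V).
Hypothesis pz : p z = z.
Hypothesis p_acyclic : forall y, y != z -> p (p y) != y.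

Definition down q y := (y != z) && (p y == q).

Fixpoint compat t :=
  let: LNode x ts := t in all (fun u => down x (lab u) && compat u) ts.

(* Reads [s] as the rest of a depth-first tour that stands at [q]: the entries of the
   result are the lists of subtrees still to be visited below [q], below its parent,
   and so on up to the root [z]. *)
Fixpoint unfold_walk s q : seq (seq (ltree V)) :=
  if s is y :: s' then
    let D := unfold_walk s' y in
    if down q y then (LNode y (head [::] D) :: head [::] (behead D)) :: behead (behead D)
    else [::] :: D
  else [:: [::]].

(** The inverse of [unfold_walk]: it writes out the rest of the tour from the unfinished lists of
    subtrees. *)
Fixpoint stack_tour (D : seq (seq (ltree V))) q : seq V :=
  match D with
  | [::] => [::]
  | [:: F] => forest_tour q F
  | F :: D' => forest_tour q F ++ p q :: stack_tour D' (p q)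
  end.

Lemma forest_tour_cat q t ts s : forest_tour q (t :: ts) ++ s =
  lab t :: rcons (tour t) q ++ (forest_tour q ts ++ s).
Proof. by rewrite /forest_tour /= -catA. Qed.

(** A tour determines its tree. The hypothesis [p_acyclic] ensures that the step back to a parent is
    not mistaken for a descent. *)
Lemma unfold_tour q ts s : all (fun u => down q (lab u) && compat u) ts ->
  unfold_walk (forest_tour q ts ++ s) q =
    (ts ++ head [::] (unfold_walk s q)) :: behead (unfold_walk s q).
Proof.
have unfoldN r y : exists F D, unfold_walk r y = F :: D.
  case: r => [|y' r] /=; first by exists [::], [::].
  by case: ifP => _; do 2!eexists.
pose Q t := compat t -> forall q r, down q (lab t) ->
  unfold_walk (lab t :: rcons (tour t) q ++ r) q =
  (t :: head [::] (unfold_walk r q)) :: behead (unfold_walk r q).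
suff QT t : Q t.
  elim: ts => [|t ts IH]; first by have [F [D]] := unfoldN s q; rewrite cat0s => ->.
  case/andP => /andP[dt ct] /IH {}IH.
  by rewrite forest_tour_cat QT // IH.
elim/ltree_ind': t => x vs IH; rewrite /Q => cvs {}q r dq; move: (dq).
rewrite /lab => {}dq; rewrite tourE.
have F us y r' : foldr (fun t => and (Q t)) True us ->
    all (fun u => down y (lab u) && compat u) us ->
    unfold_walk (forest_tour y us ++ r') y =
      (us ++ head [::] (unfold_walk r' y)) :: behead (unfold_walk r' y).
  elim: us => [_ _|u us IHus]; first by have [F [D]] := unfoldN r' y; rewrite cat0s => ->.
  case=> Qu /IHus {}IHus /andP[/andP[du cu] /IHus {}IHus].
  by rewrite forest_tour_cat Qu // IHus.
rewrite [LHS]/= dq -cats1 -catA cat1s F //.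
case/andP: dq => xz /eqP pq.
have -> : unfold_walk (q :: r) x = [::] :: unfold_walk r q.
  rewrite /= (_ : down x q = false) //.
  by rewrite /down -pq; apply/negbTE; rewrite negb_and p_acyclic ?orbT.
by rewrite /= cats0.
Qed.

Fixpoint valid q s : bool :=
  if s is y :: s' then (down q y || ((q != z) && (y == p q))) && valid y s'
  else q == z.

Fixpoint compat_stack (D : seq (seq (ltree V))) q : bool :=
  if D is F :: D' then
    all (fun u => down q (lab u) && compat u) F && compat_stack D' (p q)
  else true.

Lemma stack_tour_cat q F1 F2 D :
  stack_tour ((F1 ++ F2) :: D) q = forest_tour q F1 ++ stack_tour (F2 :: D) q.
Proof.
have E : forest_tour q (F1 ++ F2) = forest_tour q F1 ++ forest_tour q F2.
  by rewrite /forest_tour map_cat flatten_cat.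
by case: D => [|F3 D] /=; rewrite E // catA.
Qed.

(** The height of the stack exceeds the depth of the current vertex by one, so that at [z] a single
    list remains and the walk is the tour of one tree. *)
Lemma unfold_valid (depth : V -> nat) : depth z = 0 ->
  (forall y, y != z -> depth y = (depth (p y)).+1) ->
  forall s q, valid q s ->
  [/\ size (unfold_walk s q) = (depth q).+1, stack_tour (unfold_walk s q) q = s
    & compat_stack (unfold_walk s q) q].
Proof.
move=> d0 dS; elim=> [|y s IH] q /=; first by move=> /eqP ->; rewrite d0.
case: ifPn => [dq|dq] /=.
  move=> /IH[]; case/andP: (dq) => yz /eqP pq; rewrite (dS y yz) pq.
  case: (unfold_walk s y) => [|F1 [|F2 D]] // [sD] <-.
  rewrite /= pq => /and3P[c1 c2 c3]; split; rewrite /= ?dq ?c1 ?c2 ?c3 ?sD //.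
  rewrite -[LHS]/(stack_tour (([:: LNode y F1] ++ F2) :: D) q) stack_tour_cat.
  rewrite {1}/forest_tour /= cats0 -/(forest_tour y F1).
  by rewrite cat_rcons.
move=> /andP[/andP[qz /eqP yE] /IH[]]; rewrite (dS q qz) -yE.
case: (unfold_walk s y) => [|F1 D] // sD <- cD; split; rewrite /= -?yE //.
by congr _.+1.
Qed.

End LabelledTrees.

(** * Labelled trees from a shape and a labelling of its vertices *)

Section Build.
Variable V : eqType.
Implicit Types (X : ptree) (t : ltree V) (g h : seq nat -> V) (w : seq nat).

Fixpoint build X g : ltree V :=
  let: PNode ts := X in
  LNode (g [::])
    ((fix bf i ts := if ts is t :: ts' then
        build t (fun w => g (rcons w i)) :: bf i.+1 ts' else [::]) 0 ts).

(** The local fixpoint of [build], named so that induction can refer to it. *)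
Fixpoint build_forest i (ts : seq ptree) g : seq (ltree V) :=
  if ts is t :: ts' then
    build t (fun w => g (rcons w i)) :: build_forest i.+1 ts' g
  else [::].

Lemma buildE ts g : build (PNode ts) g = LNode (g [::]) (build_forest 0 ts g).
Proof.
rewrite /=; congr LNode; move: 0.
by elim: ts => //= t ts IH i; rewrite IH.
Qed.

Fixpoint vforest i (ts : seq ptree) : seq (seq nat) :=
  if ts is t :: ts' then [seq rcons w i | w <- vertices t] ++ vforest i.+1 ts'
  else [::].

Lemma verticesE ts : vertices (PNode ts) = [::] :: vforest 0 ts.
Proof.
rewrite /=; congr (_ :: _); move: 0.
by elim: ts => //= t ts IH i; rewrite IH.
Qed.

Lemma root_vertices X : vertices X = [::] :: behead (vertices X).
Proof. by case: X => ts; rewrite verticesE. Qed.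

Lemma vforest_neq i ts w : w \in vforest i ts -> w != [::].
Proof.
elim: ts i => //= t ts IH i; rewrite mem_cat => /orP[/mapP[u _ ->]|/IH //].
by case: u.
Qed.

Lemma nonroot_vertices X : [seq w <- vertices X | w != [::]] = behead (vertices X).
Proof.
case: X => ts; rewrite verticesE /=; apply/all_filterP/allP => w.
exact: vforest_neq.
Qed.

Lemma mem_vforest i ts w : w \in vforest i ts ->
  exists j u, [/\ i <= j, j < i + size ts, u \in vertices (nth (PNode [::]) ts (j - i)) & w = rcons u j].
Proof.
elim: ts i => //= t ts IH i; rewrite mem_cat => /orP[/mapP[u ut ->]|/IH].
  by exists i, u; rewrite subnn leqnn addnS ltnS leq_addr.
case=> j [u [ij js ut ->]]; exists j, u; split=> //; try lia.
by rewrite (_ : j - i = (j - i.+1).+1); last lia.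
Qed.

Lemma vforest_mem i ts j u : j < size ts ->
  u \in vertices (nth (PNode [::]) ts j) -> rcons u (i + j) \in vforest i ts.
Proof.
elim: ts i j => //= t ts IH i [|j] js ut; rewrite mem_cat.
  by rewrite addn0 (map_f (rcons^~ i)).
by rewrite -addSnnS IH ?orbT.
Qed.

Lemma behead_vertices X w : w \in vertices X -> behead w \in vertices X.
Proof.
elim/ptree_ind': X w => ts IH w; rewrite verticesE inE => /orP[/eqP ->|].
  by rewrite inE eqxx.
case/mem_vforest => j [[|x u] [_ js ut ->]]; first by rewrite inE eqxx.
rewrite subn0 add0n in ut js; rewrite inE /= -[j]add0n vforest_mem ?orbT //.
have {}IH : forall k, k < size ts -> forall w, w \in vertices (nth (PNode [::]) ts k) ->
    behead w \in vertices (nth (PNode [::]) ts k).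
  elim: {ut js} ts IH => //= t ts IHts [H /IHts {}IHts] [|k] ks; [exact: H | exact: IHts].
exact: IH _ js _ ut.
Qed.

Lemma edges_build X g :
  edges (build X g) = [seq (g (behead w), g w) | w <- behead (vertices X)].
Proof.
elim/ptree_ind': X g => ts IH g; rewrite buildE verticesE /=.
elim: ts 0 IH => //= t ts IHts i [IHt /IHts {}IHts].
rewrite IHts map_cat IHt root_vertices /=; congr (_ :: _ ++ _).
  by congr (_, _); case: t {IHt} => us; rewrite buildE.
rewrite -map_comp -nonroot_vertices; apply/eq_in_map => w.
by rewrite mem_filter; case: w.
Qed.

Lemma eq_build X g h : {in vertices X, g =1 h} -> build X g = build X h.
Proof.
elim/ptree_ind': X g h => ts IH g h; rewrite !buildE verticesE => E.
congr LNode; first by rewrite E // mem_head.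
have {}E : {in vforest 0 ts, g =1 h} by move=> w wt; rewrite E // inE wt orbT.
elim: ts 0 IH E => //= t ts IHts i [IHt Its] E; congr (_ :: _).
  by apply: IHt => w wt; apply: E; rewrite mem_cat (map_f (rcons^~ i)).
by apply: IHts => // w wt; apply: E; rewrite mem_cat wt orbT.
Qed.

Fixpoint tree_shape t : ptree := let: LNode _ ts := t in PNode (map tree_shape ts).

Lemma tree_shape_build X g : tree_shape (build X g) = X.
Proof.
elim/ptree_ind': X g => ts IH g; rewrite buildE /=; congr PNode.
by elim: ts 0 IH => //= t ts IHts i [-> /IHts ->].
Qed.

Variable z : V.

(** Paths are read from the root down, whereas vertices list the indices from the vertex up; hence
    the [rev] below. *)
Fixpoint label_at (path : seq nat) t : V :=
  if path is i :: path' then label_at path' (nth (LNode z [::]) (subtrees t) i)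
  else lab t.

Lemma nth_build_forest i ts g j : j < size ts ->
  nth (LNode z [::]) (build_forest i ts g) j =
    build (nth (PNode [::]) ts j) (fun w => g (rcons w (i + j))).
Proof.
elim: ts i j => //= t ts IH i [|j] js; first by rewrite addn0.
by rewrite /= IH // addSnnS.
Qed.

Lemma label_at_build X g w : w \in vertices X -> label_at (rev w) (build X g) = g w.
Proof.
elim/ptree_ind': X g w => ts IH g w; rewrite verticesE inE => /orP[/eqP ->|].
  by rewrite buildE.
case/mem_vforest => j [u [_ js ut ->]].
rewrite subn0 add0n in ut js; rewrite rev_rcons buildE /= nth_build_forest //.
rewrite add0n; have {}IH : forall k, k < size ts -> forall g w,
   w \in vertices (nth (PNode [::]) ts k) ->
   label_at (rev w) (build (nth (PNode [::]) ts k) g) = g w.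
  elim: {ut js} ts IH => //= t ts IHts [H /IHts {}IHts] [|k] ks; [exact: H | exact: IHts].
exact: IH.
Qed.

Lemma build_label_at t : build (tree_shape t) (fun w => label_at (rev w) t) = t.
Proof.
elim/ltree_ind': t => x ts IH; rewrite [tree_shape _]/= buildE /=; congr LNode.
have H i g : (forall j w, j < size ts -> g (rcons w (i + j)) =
    label_at (rev w) (nth (LNode z [::]) ts j)) -> build_forest i (map tree_shape ts) g = ts.
  elim: ts i IH => //= t ts IHts i [IHt /IHts {}IHts] E; congr (_ :: _).
    by rewrite -[RHS]IHt; apply: eq_build => w _; rewrite -{1}[i]addn0 E.
  by apply: IHts => j w js; rewrite addSnnS E.
by apply: H => j w _; rewrite rev_rcons.
Qed.

Lemma compat_edges p t : compat z p t = all (fun e => down z p e.1 e.2) (edges t).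
Proof.
elim/ltree_ind': t => x ts IH /=.
by elim: ts IH => //= t ts IHts [-> /IHts ->]; rewrite all_cat andbA.
Qed.

Lemma size_children X :
  size (children X) = count (fun w => behead w == [::]) (behead (vertices X)).
Proof.
case: X => ts; rewrite verticesE /=; move: 0.
elim: ts => //= t ts IH i; rewrite count_cat -IH root_vertices /= count_map.
rewrite -nonroot_vertices (_ : count _ _ = 0) // -(count_pred0 [seq w <- vertices t | w != [::]]).
by apply: eq_in_count => w; rewrite mem_filter; case: w => // x [|y w].
Qed.

End Build.

Lemma card_nonroot X (a : pred (seq nat)) :
  #|[pred u : nonroot X | a (val u)]| = count a (behead (vertices X)).
Proof.
rewrite -nonroot_vertices -size_filter cardE -(size_map val); apply: perm_size.
apply: uniq_perm; first by rewrite map_inj_uniq ?enum_uniq //; apply: val_inj.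
  by rewrite !filter_uniq ?vertices_uniq.
move=> w; rewrite mem_filter; apply/mapP/andP => [[u]|[aw wX]].
  by rewrite mem_enum inE => au ->; rewrite au (valP u).
by exists (SeqSub wX); rewrite ?mem_enum ?inE.
Qed.

(** * Labelled plane trees with a given parent map on labels *)

Section LabelCount.
Variables (m v : nat) (p : {ffun option 'I_v -> option 'I_v}).
Hypothesis m0 : 0 < m.
Hypothesis pF : p \in forest [set None] (~: [set None]).
Implicit Types (X : ptree) (x y : option 'I_v).

Let pN : p None = None.
Proof. by have /forestP[-> //] := pF; rewrite !inE eqxx. Qed.

Lemma tree_core : core p = [set None].
Proof.
have Nc : None \in core p.
  apply/coreP => x; have [->|xN] := eqVneq x None; first exact: connect0.
  by have /forestP[_ /(_ x)[|y]] := pF; rewrite !inE // => /eqP ->.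
apply/setP => x; rewrite (core_fconnect _ Nc) inE.
by rewrite (fconnect_fixed _ pN) eq_sym.
Qed.

Let Nc : None \in core p.
Proof. by rewrite tree_core set11. Qed.

Let p_acyclic y : y != None -> p (p y) != y.
Proof. by move=> yN; rewrite eq_sym (off_core_neq Nc) // tree_core inE. Qed.

(** Each label and its parent label are joined by [m] crossings each way. The fixed point [None] of
    [p] is not meant as a loop, hence the zeros. *)
Let c := edge_mx p 0 0 m.

Let cE x y : c x y = m * ((y == p x) && (x != None)) + m * ((x == p y) && (y != None)).
Proof.
rewrite /c /edge_mx tree_core !inE.
by case: (y == p x); case: (x == None); case: (x == p y); case: (y == None); rewrite /=; lia.
Qed.

(** [p] records for each label the common label of the parents of its block. Once it is fixed, the
    step counts of the tour are fixed too. *)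
Definition compatible X (f : {ffun nonroot X -> 'I_v}) :=
  [forall u, label f (behead (val u)) == p (Some (f u))] &&
  [forall l, #|f @^-1: [set l]| == m].

Lemma label_root X (f : {ffun nonroot X -> 'I_v}) : label f [::] = None.
Proof. by rewrite /label insubF // mem_filter. Qed.

Lemma label_val X (f : {ffun nonroot X -> 'I_v}) u : label f (val u) = Some (f u).
Proof. by rewrite /label valK. Qed.

Section Walk.
Variables (X : ptree) (f : {ffun nonroot X -> 'I_v}).
Hypothesis fc : compatible f.

Let t := build X (label f).

Let lab_t : lab t = None.
Proof. by rewrite /t; case: X f => ts g; rewrite buildE /= label_root. Qed.

Let parentE u : label f (behead (val u)) = p (Some (f u)).
Proof. by case/andP: fc => /forallP/(_ u)/eqP. Qed.

Let labelE w : w \in behead (vertices X) ->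
  exists l, label f w = Some l /\ label f (behead w) = p (Some l).
Proof.
rewrite -nonroot_vertices => wX; exists (f (SeqSub wX)).
by rewrite -parentE -label_val.
Qed.

Lemma count_edges x y :
  count_mem (x, y) (edges t) = m * ((x == p y) && (y != None)).
Proof.
rewrite edges_build count_map.
have [yN|yN] := eqVneq y None.
  rewrite yN andbF muln0 -(count_pred0 (behead (vertices X))).
  apply: eq_in_count => w /labelE[l [wl _]].
  by rewrite /= xpair_eqE wl andbF.
have [l yl] : exists l, y = Some l by case: y yN => // l _; exists l.
rewrite andbT {y yN}yl; have [->|xp] := eqVneq x (p (Some l)).
  rewrite muln1; case/andP: fc => _ /forallP/(_ l)/eqP <-.
  rewrite -card_nonroot; apply: eq_card => u.
  rewrite !inE /= xpair_eqE parentE label_val (inj_eq Some_inj) andbC.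
  by case: (f u =P l) => [->|]; rewrite ?eqxx.
rewrite muln0 -(count_pred0 (behead (vertices X))).
apply: eq_in_count => w /labelE[k [wk wp]].
rewrite /= xpair_eqE wk wp; apply/negbTE/andP => -[/eqP E /eqP[kl]].
by rewrite -E kl eqxx in xp.
Qed.

Lemma count_walk x y : count_mem (x, y) (steps None (tour t)) = c x y.
Proof.
rewrite /steps -lab_t count_steps_tour cE addnC -!count_edges; congr (_ + _).
by apply: eq_count => -[a b] /=; rewrite !xpair_eqE andbC.
Qed.

Lemma compat_walk : compat None p t.
Proof.
rewrite compat_edges edges_build; apply/allP => _ /mapP[w /labelE[l [wl pl]] ->].
by rewrite /down /= wl pl eqxx.
Qed.

Lemma size_walk : size (tour t) = 2 * size (behead (vertices X)).
Proof.
have := count_steps_tour predT t; rewrite !count_predT size_pairmap => ->.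
by rewrite edges_build size_map mul2n addnn.
Qed.

Lemma size_children_compat : size (children X) = m * off_core p None.
Proof.
rewrite size_children -card_nonroot /off_core mulnC -sum_nat_const.
rewrite -sum1_card (partition_big (fun u => Some (f u)) (fun y => (y != None) && (p y == None))).
  rewrite /=; apply: eq_big => [y|y]; first by rewrite inE tree_core inE.
  case: y => // l /andP[_ /eqP pl]; case/andP: fc => _ /forallP/(_ l)/eqP <-.
  rewrite sum1dep_card; apply: eq_card => u; rewrite !inE (inj_eq Some_inj).
  rewrite andbC; case: eqP => //= fu; have := parentE u; rewrite fu pl.
  have [->|bN] := eqVneq (behead (val u)) [::]; first by [].
  have bX : behead (val u) \in [seq w <- vertices X | w != [::]].
    rewrite mem_filter bN; apply: behead_vertices.
    by have := valP u; rewrite mem_filter => /andP[].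
  by rewrite -[behead _]/(val (SeqSub bX)) label_val.
move=> u /eqP bu; rewrite /= -parentE.
have -> : behead (val u) = [::] by [].
by rewrite label_root.
Qed.

End Walk.

Lemma tour_inj X (f : {ffun nonroot X -> 'I_v}) Y (g : {ffun nonroot Y -> 'I_v}) :
    compatible f -> compatible g ->
    tour (build X (label f)) = tour (build Y (label g)) ->
  build X (label f) = build Y (label g).
Proof.
move=> /compat_walk cf /compat_walk cg.
have : lab (build X (label f)) = None by case: X f {cf} => ts f; rewrite buildE /= label_root.
have : lab (build Y (label g)) = None by case: Y g {cg} => ts g; rewrite buildE /= label_root.
case: (build X _) cf => x ts cf; case: (build Y _) cg => y us cg /= yN xN.
rewrite xN yN /= in cf cg * => E.
have := unfold_tour p_acyclic [::] cf; have := unfold_tour p_acyclic [::] cg.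
by rewrite !cats0 /forest_tour E => -> /= -[->].
Qed.

Lemma label_inj X (f g : {ffun nonroot X -> 'I_v}) :
  build X (label f) = build X (label g) -> f = g.
Proof.
move=> E; apply/ffunP => u; apply: Some_inj; rewrite -!label_val.
have uX : val u \in vertices X by have := valP u; rewrite mem_filter => /andP[].
by rewrite -(label_at_build None (label f) uX) E label_at_build.
Qed.

(** The step counts allow only steps along [p] and back, so that [s] unfolds to a tree; as each
    label is entered [m] times from its parent label, the blocks have order [m]. *)
Lemma walk_surj n (s : n.-tuple (option 'I_v)) : n = 2 * (m * v) ->
  s \in walks n c None ->
  exists X (f : {ffun nonroot X -> 'I_v}),
    [/\ compatible f, size (vertices X) = (m * v).+1 & val s = tour (build X (label f))].
Proof.
move=> nE sw; have /walksP sc := sw.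
have cb u : outdeg c u = indeg c u by rewrite indeg_edge_mx.
have lastN : last None s = None.
  have := walks_balanced sw None; rewrite cb eqxx => /addnI/eqP.
  by rewrite eqb1 => /eqP.
have sv : valid None p None s.
  have H x y : (x, y) \in steps None s -> down None p x y || (x != None) && (y == p x).
    rewrite -has_pred1 has_count sc cE /down (eq_sym (p y)).
    by case: (y == p x); case: (x == p y); case: (x == None); case: (y == None);
      rewrite /= ?muln0 ?muln1 ?addn0.
  suff valid_steps s' q : (forall x y, (x, y) \in steps q s' ->
      down None p x y || (x != None) && (y == p x)) -> last q s' = None ->
      valid None p q s' by exact: valid_steps H lastN.
  elim: s' q => [|y s' IH] q /= {}H lx; first exact/eqP.
  rewrite H ?inE ?eqxx //=; apply: IH => // a b ab.
  by apply: H; rewrite inE ab orbT.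
pose depth y := findex p y None.
have dS y : y != None -> depth y = (depth (p y)).+1.
  move=> yN; apply: fconnect_findex; last by rewrite eq_sym.
  by move/coreP: Nc.
have [] := unfold_valid (depth := depth) (findex0 p None) dS sv.
rewrite /depth findex0; case: (unfold_walk _ _ s None) => [|F [|? ?]] // _ /= sE.
rewrite andbT => Fc; pose t := LNode None F.
have ct : compat None p t by [].
have st : tour t = s by [].
pose g w := label_at None (rev w) t.
have tE : build (tree_shape t) g = t by apply: build_label_at.
pose X := tree_shape t.
have eE : edges t = [seq (g (behead w), g w) | w <- behead (vertices X)].
  by rewrite -edges_build tE.
have cX : size (behead (vertices X)) = m * v.
  have := count_steps_tour predT t; rewrite !count_predT size_pairmap st size_tuple.
  by rewrite eE size_map; lia.
have gd w : w \in behead (vertices X) -> g w != None /\ p (g w) = g (behead w).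
  move=> wX; have := ct; rewrite compat_edges => /allP/(_ (g (behead w), g w)).
  by rewrite eE (map_f (fun w => (g (behead w), g w))) // /down /= => /(_ isT)/andP[-> /eqP].
have [f fE] : exists f : {ffun nonroot X -> 'I_v}, forall u, Some (f u) = g (val u).
  have /fin_all_exists[f fE] : forall u : nonroot X, exists l, Some l = g (val u).
    move=> u; have [] := gd (val u); first by rewrite -nonroot_vertices; apply: (valP u).
    by case: (g _) => // l _ _; exists l.
  by exists (finfun f) => u; rewrite ffunE.
have lE w : w \in vertices X -> label f w = g w.
  rewrite root_vertices inE => /orP[/eqP ->|]; first by rewrite label_root.
  by rewrite -nonroot_vertices => wX; rewrite -(fE (SeqSub wX)) -label_val.
exists X, f; have bE : build X (label f) = t by rewrite -[RHS]tE; apply: eq_build => w /lE.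
split; last by rewrite bE st.
  apply/andP; split.
    apply/forallP => u; have uX : val u \in behead (vertices X).
      by rewrite -nonroot_vertices; apply: (valP u).
    have [_ pg] := gd _ uX; rewrite lE ?fE ?pg //; apply: behead_vertices.
    exact: mem_behead uX.
  apply/forallP => l; apply/eqP.
  have Ecount x y : count_mem (x, y) (edges t) + count_mem (y, x) (edges t) = c x y.
    rewrite -sc /steps -st -[None]/(lab t) count_steps_tour; congr (_ + _).
    by apply: eq_count => -[a b] /=; rewrite !xpair_eqE andbC.
  transitivity (count_mem (p (Some l), Some l) (edges t)).
    rewrite eE count_map.
    transitivity (count (fun w => g w == Some l) (behead (vertices X))).
      rewrite -card_nonroot; apply: eq_card => u; rewrite !inE -fE.
      by rewrite (inj_eq Some_inj).
    apply: eq_in_count => w /gd[_ pg]; rewrite /= xpair_eqE -pg andbC.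
    by case: eqP => // ->; rewrite eqxx.
  have := Ecount (p (Some l)) (Some l); rewrite cE.
  rewrite (_ : count_mem (Some l, _) _ = 0).
    have -> : (Some l == p (p (Some l))) = false.
      by rewrite eq_sym; apply/negbTE/p_acyclic.
    by rewrite eqxx /= muln0 muln1 addn0.
  apply/eqP; rewrite -leqn0 leqNgt -has_count has_pred1; apply/negP.
  move: ct; rewrite compat_edges => /allP H /H; rewrite /down /= => /andP[_].
  by rewrite (negbTE (p_acyclic _)).
by rewrite root_vertices /= cX.
Qed.

(** Tours are a bijection from the compatibly labelled trees to these walks, and the number of
    children of the root depends on [p] alone. *)
Lemma sum_compatible (F : nat -> nat) :
  \sum_(X : plane_tree (m * v).+1)
     #|[set f : {ffun nonroot X -> 'I_v} | compatible f]| * F (size (children X)) =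
  #|walks (2 * (m * v)) c None| * F (m * off_core p None).
Proof.
rewrite -[#|walks _ _ _|]sum1_card big_distrl /=.
transitivity (\sum_(X : plane_tree (m * v).+1)
   \sum_(f : {ffun nonroot X -> 'I_v} | compatible f)
   \sum_(s in walks (2 * (m * v)) c None)
      (val s == tour (build X (label f))) * F (m * off_core p None)).
  apply: eq_bigr => X _; rewrite -sum1_card big_distrl /=.
  apply: eq_big => [f|f fc]; first by rewrite inE.
  rewrite inE in fc; rewrite mul1n (size_children_compat fc).
  have ts : size (tour (build X (label f))) == 2 * (m * v).
    rewrite (size_walk f); case: (X : plane_tree _) => Y /= /eqP.
    by rewrite root_vertices /= => -[->].
  rewrite (bigD1 (Tuple ts)) /=; last by apply/walksP => x y; rewrite count_walk.
  rewrite eqxx mul1n big1 ?addn0 // => s /andP[_ sN].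
  by case: eqP => // E; case/eqP: sN; apply: val_inj.
transitivity (\sum_(s in walks (2 * (m * v)) c None) \sum_(X : plane_tree (m * v).+1)
   \sum_(f : {ffun nonroot X -> 'I_v} | compatible f)
      (val s == tour (build X (label f))) * F (m * off_core p None)).
  rewrite [RHS]exchange_big /=; apply: eq_bigr => X _; by rewrite exchange_big.
apply: eq_bigr => s sw.
have [X [f [fc sX sE]]] := walk_surj (erefl _) sw.
have sX' : size (vertices X) == (m * v).+1 by apply/eqP.
pose X' : plane_tree (m * v).+1 := PlaneTree sX'.
rewrite (bigD1 X') //= (bigD1 f) //= sE eqxx.
rewrite big1 => [|g /andP[gc gf]]; last first.
  case: eqP => // E; case/eqP: gf; apply: label_inj.
  by rewrite (tour_inj gc fc (esym E)).
rewrite big1 ?addn0 // => Y YX; apply: big1 => g gc.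
case: eqP => // E; case/eqP: YX; apply: val_inj.
by rewrite /= -(tree_shape_build X (label f)) (tour_inj fc gc E) tree_shape_build.
Qed.

End LabelCount.

Lemma card_compositions d s : #|compositions d s.+1| = 'C(d + s, s).
Proof.
rewrite addnC -card_ord_partitions.
rewrite -(card_imset _ (can_inj (@tuple_of_finfunK 'I_d.+1 s.+1))).
apply: eq_card => t; rewrite inE; apply/imsetP/idP => [[f]|ts].
  rewrite inE => /eqP fd ->; rewrite big_tuple -[X in _ == X]fd.
  by apply/eqP/eq_bigr => i _; rewrite tnth_map tnth_ord_tuple.
exists (finfun_of_tuple t); last by rewrite finfun_of_tupleK.
rewrite inE; apply/eqP; rewrite -[RHS](eqP ts) big_tuple.
by apply: eq_bigr => i _; rewrite ffunE.
Qed.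

(** * Labelings up to permutation and their parent maps *)

Section Labelings.
Variables (m v : nat).
Hypothesis m0 : 0 < m.
Variable X : plane_tree (m * v).+1.
Implicit Types (f g : {ffun nonroot X -> 'I_v}) (p : {ffun option 'I_v -> option 'I_v}).

Lemma card_nonrootT : #|{: nonroot X}| = m * v.
Proof.
transitivity (size (behead (vertices X))).
  by rewrite -count_predT -card_nonroot; apply: eq_card.
by rewrite size_behead; case: (X) => Y /= /eqP ->.
Qed.

Lemma sum_fibers f : \sum_l #|f @^-1: [set l]| = m * v.
Proof.
apply: etrans card_nonrootT; rewrite -sum1_card [RHS](partition_big f predT) //=.
by apply: eq_bigr => l _; rewrite sum1dep_card; apply: eq_card => u; rewrite !inE.
Qed.

(** The [m * v] vertices other than the root are shared out among [v] labels, of which none takes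
    more than [m]. *)
Lemma admissible_fiber f l : admissible m f -> #|f @^-1: [set l]| = m.
Proof.
case/and3P => /forallP f1 _ _.
have le k : #|f @^-1: [set k]| <= m by case/orP: (f1 k) => /eqP ->; rewrite ?cards0.
have : \sum_k (m - #|f @^-1: [set k]|) = 0.
  by rewrite sumnB // sum_fibers sum_nat_const card_ord mulnC subnn.
move/eqP; rewrite sum_nat_eq0 => /forallP/(_ l)/=; rewrite subn_eq0 => lm.
by apply/eqP; rewrite eqn_leq le.
Qed.

Lemma admissible_surj f l : admissible m f -> exists u, f u = l.
Proof.
move=> /(admissible_fiber l) fl; have /card_gt0P[u] : 0 < #|f @^-1: [set l]| by rewrite fl.
by rewrite !inE => /eqP <-; exists u.
Qed.

(** A vertex lies as deep in the tree as its label does under [p], which is why equal labels force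
    equal levels. *)
Lemma size_depth p f w : p None = None ->
    (forall x, fconnect p x None) ->
    (forall u, label f (behead (val u)) = p (Some (f u))) ->
  w \in vertices X -> size w = findex p (label f w) None.
Proof.
move=> pN pc H; elim: {w}(size w) {-2}w (erefl (size w)) => [|n IH] w sw wX.
  by move/size0nil: sw => ->; rewrite label_root findex0.
have wN : w \in [seq w <- vertices X | w != [::]].
  by rewrite mem_filter wX andbT; case: w sw {wX}.
have := H (SeqSub wN); have := label_val f (SeqSub wN); rewrite /= => lw pw.
rewrite fconnect_findex // ?lw // -pw -IH ?size_behead ?sw //.
exact: behead_vertices.
Qed.

Lemma compatible_admissible p f :
  p \in forest [set None] (~: [set None]) -> compatible m p f -> admissible m f.
Proof.
move=> pF /andP[/forallP H1 /forallP H2].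
have /forestP[p1 p2] := pF; have pN : p None = None by rewrite p1 // !inE eqxx.
have pc x : fconnect p x None.
  have [->|xN] := eqVneq x None; first exact: connect0.
  by have [|y] := p2 x; rewrite !inE // => /eqP ->.
apply/and3P; split.
- by apply/forallP => l; rewrite H2 orbT.
- apply/forallP => u; apply/forallP => w; apply/implyP => /eqP fE.
  have vX (u' : nonroot X) : val u' \in vertices X by have := valP u'; rewrite mem_filter => /andP[].
  rewrite !(@size_depth p f) // ?label_val ?fE // => u'; exact/eqP.
apply/forallP => u; apply/forallP => w; apply/implyP => /eqP fE.
by rewrite (eqP (H1 u)) (eqP (H1 w)) fE.
Qed.

Lemma admissible_compatible f : admissible m f ->
  exists2 p, p \in forest [set None] (~: [set None]) & compatible m p f.
Proof.
move=> fa; have /and3P[_ /forallP f2 /forallP f3] := fa.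
have [p0 p0E] : exists p0 : 'I_v -> option 'I_v,
    forall u, label f (behead (val u)) = p0 (f u).
  have /fin_all_exists[p0 p0E] : forall l : 'I_v, exists y,
      forall u, f u = l -> label f (behead (val u)) = y.
    move=> l; have [u0 u0l] := admissible_surj l fa.
    exists (label f (behead (val u0))) => u ul.
    by apply/eqP; apply: (implyP (forallP (f3 u) u0)); rewrite u0l ul.
  by exists p0 => u; apply: p0E.
pose p : {ffun option 'I_v -> option 'I_v} := [ffun y => if y is Some l then p0 l else None].
have pE u : label f (behead (val u)) = p (Some (f u)) by rewrite ffunE p0E.
exists p; last first.
  by apply/andP; split; apply/forallP => u; [rewrite pE | rewrite admissible_fiber].
apply/forestP; split=> [x|[l|]]; last by rewrite !inE eqxx.
  by rewrite !inE negbK => /eqP ->; rewrite ffunE.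
move=> _; exists None; first by rewrite inE.
have [u <-] := admissible_surj l fa.
have uX : val u \in vertices X by have := valP u; rewrite mem_filter => /andP[].
rewrite -(label_val f); move: uX; move: {u}(val u) => w.
elim: {w}(size w) {-2}w (erefl (size w)) => [|n IH] w sw wX.
  by move/size0nil: sw => ->; rewrite label_root connect0.
have wN : w \in [seq w <- vertices X | w != [::]].
  by rewrite mem_filter wX andbT; case: w sw {wX}.
have := pE (SeqSub wN); rewrite -label_val /= => pw.
apply: connect_trans (fconnect1 _ _) _; rewrite -pw.
by apply: IH; rewrite ?size_behead ?sw ?behead_vertices.
Qed.

Lemma compatible_unique p q f : admissible m f ->
    p \in forest [set None] (~: [set None]) ->
    q \in forest [set None] (~: [set None]) ->
  compatible m p f -> compatible m q f -> p = q.
Proof.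
move=> fa /forestP[p1 _] /forestP[q1 _] /andP[/forallP Hp _] /andP[/forallP Hq _].
apply/ffunP => -[l|]; last by rewrite p1 ?q1 // !inE eqxx.
have [u <-] := admissible_surj l fa.
by rewrite -(eqP (Hp u)) (eqP (Hq u)).
Qed.

Lemma card_admissible : #|[set f : {ffun nonroot X -> 'I_v} | admissible m f]| =
  \sum_(p in forest [set None] (~: [set None]))
     #|[set f : {ffun nonroot X -> 'I_v} | compatible m p f]|.
Proof.
under eq_bigr do rewrite -sum1_card.
rewrite -sum1_card (exchange_big_dep (fun f => f \in [set f | admissible m f])) /=.
  apply: eq_bigr => f; rewrite inE => fa.
  have [p pF pf] := admissible_compatible fa.
  rewrite (bigD1 p) /=; last by rewrite pF inE.
  rewrite big_pred0 ?addn0 // => q; apply/negbTE/negP => /andP[/andP[qF qf] /eqP[]].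
  by rewrite inE in qf; apply: compatible_unique fa qF pF qf pf.
by move=> p f pF; rewrite !inE; apply: compatible_admissible.
Qed.

Definition relabel f (s : {perm 'I_v}) : {ffun nonroot X -> 'I_v} := [ffun w => s (f w)].

Lemma same_labelingP f g : reflect (exists s, g = relabel f s) (same_labeling f g).
Proof. by apply: (iffP existsP) => -[s /eqP]; exists s. Qed.

Lemma label_relabel f s w : label (relabel f s) w = omap s (label f w).
Proof. by rewrite /label; case: insub => //= u; rewrite ffunE. Qed.

Lemma admissible_relabel f s : admissible m f -> admissible m (relabel f s).
Proof.
case/and3P => /forallP f1 /forallP f2 /forallP f3; apply/and3P; split.
- apply/forallP => l; have -> : relabel f s @^-1: [set l] = f @^-1: [set s^-1%g l].
    by apply/setP => u; rewrite !inE ffunE -[in RHS](inj_eq (@perm_inj _ s)) permKV.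
  exact: f1.
- apply/forallP => u; apply/forallP => w; rewrite !ffunE (inj_eq perm_inj).
  exact: (forallP (f2 u)).
apply/forallP => u; apply/forallP => w; rewrite !ffunE (inj_eq perm_inj).
rewrite !label_relabel; apply/implyP => fE.
by rewrite (eqP (implyP (forallP (f3 u) w) fE)).
Qed.

(** Every label is in use, so the permutations of labels act freely and each class has [v!]
    elements. *)
Lemma card_labelings :
  #|labelings m v X| * v`! = #|[set f : {ffun nonroot X -> 'I_v} | admissible m f]|.
Proof.
have eqR : {in [set f | admissible m f] & &, equivalence_rel (@same_labeling v X)}.
  move=> f g h _ _ _; split.
    by apply/same_labelingP; exists 1%g; apply/ffunP => u; rewrite ffunE perm1.
  case/same_labelingP => s ->; apply/same_labelingP/same_labelingP => -[t ->].
    exists (s^-1 * t)%g; apply/ffunP => u; by rewrite !ffunE permM permK.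
  by exists (s * t)%g; apply/ffunP => u; rewrite !ffunE permM.
rewrite (@card_uniform_partition _ v`! (labelings m v X)) //.
  move=> A /imsetP[f fa ->]; rewrite inE in fa.
  have rI : injective (relabel f).
    move=> s t E; apply/permP => l; have [u <-] := admissible_surj l fa.
    by move/ffunP: E => /(_ u); rewrite !ffunE.
  rewrite -(card_Sn v) -(card_imset _ rI); apply: eq_card => g; rewrite inE.
  apply/andP/imsetP => [[_ /same_labelingP[s ->]]|[s _ ->]]; first by exists s.
  by split; [rewrite inE admissible_relabel | apply/same_labelingP; exists s].
exact: equivalence_partitionP.
Qed.

End Labelings.

(** * Counting walks along the edges of a function *)

Section FactProd.
Variable V : finType.
Implicit Types (f : {ffun V -> V}) (a b m : nat).

Lemma sum_off_core f : \sum_u off_core f u = #|V| - #|core f|.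
Proof.
rewrite -cardsT -cardsDS ?subsetT // setTD -sum1_card.
rewrite [RHS](partition_big f predT) //=; apply: eq_bigr => u _.
rewrite sum1dep_card; apply: eq_card => x.
by rewrite [LHS]in_set [RHS]in_set in_setC.
Qed.

Lemma prod_core_split f (A B : nat) :
  \prod_u (if u \in core f then A else B) = A ^ #|core f| * B ^ (#|V| - #|core f|).
Proof.
rewrite (bigID (fun u => u \in core f)) /=; congr (_ * _).
  rewrite -prod_nat_const; apply: eq_bigr => u -> //.
rewrite -cardsT -cardsDS ?subsetT // setTD -prod_nat_const.
apply: eq_big => [u|u /negbTE -> //]; by rewrite in_setC.
Qed.

(** On a short cycle an entry is [a + b], and [(a + b)!] is not [a! * b!] in general; taking [b = 0]
    avoids this. *)
Lemma entry_fact_edge f a b m : core f != set0 -> (b == 0) || (2 < #|core f|) ->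
  entry_fact (edge_mx f a b m) =
    (a`! * b`!) ^ #|core f| * (m`! * m`!) ^ (#|V| - #|core f|).
Proof.
move=> /set0Pn[z zc] hb.
pose A u := if u \in core f then a`! else m`!.
pose B u := if u \in core f then b`! else m`!.
have E u v : (edge_mx f a b m u v)`! =
    (if v == f u then A u else 1) * (if u == f v then B v else 1).
  rewrite /edge_mx /A /B; case: (v =P f u) => [vE|_]; case: (u =P f v) => [uE|_].
  - have uc : u \in core f by apply: (@periodic_core _ f z u 1) => //=; rewrite -vE.
    have vc : v \in core f by rewrite vE f_core.
    have /eqP-> : b == 0.
      case/orP: hb => // k3; have := @core_iter_neq _ f u 0 2 uc isT k3.
      by rewrite /= -vE -uE eqxx.
    by rewrite uc vc !mul1n addn0 muln1.
  - by rewrite mul1n mul0n addn0 muln1; case: ifP.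
  - by rewrite mul1n mul0n add0n mul1n; case: ifP.
  by rewrite !mul0n.
rewrite /entry_fact; under eq_bigr do under eq_bigr do rewrite E.
under eq_bigr do rewrite big_split /= -big_mkcond /= big_pred1_eq.
rewrite big_split /= exchange_big /=.
under [X in _ * X]eq_bigr do rewrite -big_mkcond /= big_pred1_eq.
by rewrite !prod_core_split !expnMn mulnACA.
Qed.

End FactProd.

(** * The BEST theorem as a product of weights over vertices *)

Section Weights.
Variable K : numFieldType.
Local Open Scope ring_scope.

(* Up to the normalization, this is the factor (outdegree - 1)! of the BEST theorem
   at a vertex with [d] preimages off the cycle, where [s] steps leave the vertex along
   the edges that are not among the [d]. *)
Definition block_weight (m s d : nat) : K :=
  (s.-1 + m * d)`!%:R / (s.-1`!%:R * m`!%:R ^+ d).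

Let factN0 n : (n`!)%N%:R != 0 :> K.
Proof. by rewrite pnatr_eq0 -lt0n fact_gt0. Qed.

Lemma block_weightE m s d :
  ((s.-1 + m * d)`!)%N%:R = block_weight m s d * (s.-1`!)%N%:R * (m`!)%N%:R ^+ d.
Proof. by rewrite /block_weight; field; rewrite !expf_neq0 ?factN0. Qed.

Section Closed.
Variables (V : finType) (f : {ffun V -> V}) (a b m k kappa : nat).
Hypotheses (m0 : (0 < m)%N) (ab : (a + b = 2 * m)%N) (f0 : core f != set0).
Hypothesis hb : (b == 0%N) || (2 < #|core f|)%N.
Hypothesis arbE : forall z, z \in core f ->
  arb_sum z (edge_mx f a b m) = (m ^ (#|V| - #|core f|) * kappa)%N.

(** In [closed_best], each vertex off the cycle brings the factor [m] from the arborescences,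
    [(m - 1)!] from its own degree and [m!] from that of its image; they cancel its [m! * m!] in
    [entry_fact]. Each cycle vertex keeps [(2 * m - 1)!/(a! * b!)]. *)
Lemma card_closed_edge :
  #|closed_walks (2 * m * #|V|) (edge_mx f a b m)|%:R / (2 * m * #|V|)%:R =
  endo_weight (block_weight m (2 * m)) (block_weight m m) f *
    (((2 * m).-1)`!%:R / (a`!%:R * b`!%:R)) ^+ #|core f| * kappa%:R.
Proof.
have /set0Pn[z zc] := f0; set c := edge_mx f a b m.
have d0 u : (0 < outdeg c u)%N by rewrite outdeg_edge_mx; case: ifP => _; lia.
have kV : (#|core f| <= #|V|)%N by apply: max_card.
have V0 : (0 < #|V|)%N by apply/card_gt0P; exists z.
have sd : (\sum_u outdeg c u = 2 * m * #|V|)%N.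
  transitivity (\sum_u (m + m * off_core f u) + \sum_(u in core f) m)%N.
    rewrite [X in (_ + X)%N]big_mkcond -big_split /=; apply: eq_bigr => u _.
    by rewrite outdeg_edge_mx; case: ifP => _; lia.
  rewrite big_split /= -big_distrr /= sum_off_core !sum_nat_const.
  rewrite -addnA (mulnC m) -mulnDl subnK // (_ : #|xpredT| = #|V|); last exact: eq_card.
  by lia.
have cb u : outdeg c u = indeg c u by rewrite indeg_edge_mx.
have /(congr1 (fun n => n%:R : K)) := closed_best sd cb (d0 z).
have -> : arb_sum z (exit_weight c z) = (m ^ (#|V| - #|core f|) * kappa)%N.
  rewrite -(arbE zc); apply: eq_arb_sum => u v _.
  by rewrite /exit_weight gtn_eqF.
rewrite entry_fact_edge // !(natrM, natrX, natr_prod).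
have -> : \prod_u ((outdeg c u).-1`!)%N%:R =
    endo_weight (block_weight m (2 * m)) (block_weight m m) f *
    (((2 * m).-1)`!%:R ^+ #|core f| *
     (((m.-1)`!)%N%:R * m`!%:R) ^+ (#|V| - #|core f|)) :> K.
  rewrite exprMn -[in m`!%:R ^+ _](sum_off_core f) -prodrXr.
  rewrite (bigID (fun u => u \in core f)) /=.
  rewrite (eq_bigr (fun u => block_weight m (2 * m) (off_core f u) *
     ((2 * m).-1`!)%N%:R * m`!%:R ^+ off_core f u)) => [|u uc]; last first.
    by rewrite -block_weightE outdeg_edge_mx uc ab; congr (_`!%:R); lia.
  rewrite [X in _ * X = _](eq_bigr (fun u => block_weight m m (off_core f u) *
     (m.-1`!)%N%:R * m`!%:R ^+ off_core f u)) => [|u /negbTE uc]; last first.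
    by rewrite -block_weightE outdeg_edge_mx uc; congr (_`!%:R); lia.
  rewrite /endo_weight; move: (block_weight m (2 * m)) (block_weight m m) => h1 h2.
  rewrite !big_split /= !prodr_const [\prod_(u : V) _](bigID (fun u => u \in core f)) /=.
  have N (F : V -> K) : \prod_(u in ~: core f) F u = \prod_(u | u \notin core f) F u.
    by apply: eq_bigl => u; rewrite in_setC.
  have -> : #|[pred u | u \notin core f]| = (#|V| - #|core f|)%N.
    rewrite -cardsT -cardsDS ?subsetT // setTD.
    by apply: eq_card => u; rewrite in_setC.
  by rewrite N; ring.
move: (endo_weight _ _ _) => E.
have -> : (m`!)%N%:R = m%:R * (m.-1`!)%N%:R :> K.
  by rewrite -natrM; case: m m0 => // m' _; rewrite factS.
rewrite -[m%:R * _ * _]mulrA exprMn.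
have mN : m%:R != 0 :> K by rewrite pnatr_eq0 -lt0n.
have VN : #|V|%:R != 0 :> K by rewrite pnatr_eq0 -lt0n.
rewrite expr_div_n !exprMn.
set j := (#|V| - #|core f|)%N; set i := #|core f|.
have := expf_neq0 j mN; have := expf_neq0 j (factN0 m.-1).
have := expf_neq0 i (factN0 a); have := expf_neq0 i (factN0 b).
move: (m%:R ^+ j) (m.-1`!%:R ^+ j) (a`!%:R ^+ i) (b`!%:R ^+ i) (((2 * m).-1)`!%:R ^+ i).
move: #|closed_walks _ _|%:R => T y1 y2 y3 y4 y5 n4 n3 n2 n1 H.
have {H} -> : T = 2 * m%:R * #|V|%:R * kappa%:R * E * y5 / (y3 * y4).
  apply: (canRL (mulfK _)); first by rewrite mulf_neq0.
  apply: (mulIf (x := y1 * (y2 * (y1 * y2)))); first by rewrite !mulf_neq0.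
  transitivity (T * (y3 * y4 * (y1 * (y2 * (y1 * y2))))); first by ring.
  by rewrite H; ring.
by field; rewrite n3 n4 mN VN.
Qed.

End Closed.

Section Trees.
Variables (m v s : nat).
Hypothesis m0 : (0 < m)%N.

(** BEST gives the root, with [d] children under [p], the factor [(m * d)!]; times the binomial it
    is [(m * d + s)!/s!], the numerator of the root weight for [s.+1] parts. *)
Lemma tree_walks (p : {ffun option 'I_v -> option 'I_v}) :
    p \in forest [set None] (~: [set None]) ->
  #|walks (2 * (m * v)) (edge_mx p 0 0 m) None|%:R *
    'C(m * off_core p None + s, s)%:R =
  forest_weight (block_weight m s.+1) (block_weight m m) [set None] (~: [set None]) p.
Proof.
move=> pF; have cE := tree_core pF; set c := edge_mx p 0 0 m.
have Nc : None \in core p by rewrite cE set11.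
have cardV : #|{: option 'I_v}| = v.+1 by rewrite card_option card_ord.
have k1 : #|core p| = 1%N by rewrite cE cards1.
have cardO : (#|{: option 'I_v}| - #|core p| = v)%N by rewrite k1 cardV subn1.
have dE u : outdeg c u = if u == None then (m * off_core p None)%N
    else (m + m * off_core p u)%N.
  by rewrite outdeg_edge_mx cE inE; case: eqP => // ->.
have sd : (\sum_u outdeg c u = 2 * (m * v))%N.
  transitivity (\sum_u m * off_core p u + \sum_(u | u \notin core p) m)%N.
    rewrite [X in (_ + X)%N]big_mkcond -big_split /=; apply: eq_bigr => u _.
    by rewrite dE cE inE; case: eqP => [->|_] /=; lia.
  rewrite -big_distrr /= sum_off_core cardO sum_nat_const.
  rewrite (_ : #|_| = v); first by lia.
  by rewrite -[RHS]cardO -cardsT -cardsDS ?subsetT // setTD; apply: eq_card => u; rewrite in_setC.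
have cb : balanced c None None by move=> u; rewrite indeg_edge_mx.
have /(congr1 (fun n => n%:R : K)) := best sd cb.
have -> : arb_sum None (exit_weight c None) = (m ^ v)%N.
  have := @arb_sum_edge_small _ p None 0 0 m Nc; rewrite cardO k1 muln1 => <- //.
  apply: eq_arb_sum => u w uN; rewrite /exit_weight gtn_eqF // dE (negbTE uN); lia.
rewrite entry_fact_edge //; last by apply/set0Pn; exists None.
rewrite cardO k1 /degree_fact dE eqxx !(natrM, natrX, natr_prod).
have offE u : preim_count (~: [set None]) p u = off_core p u.
  by apply: eq_card => x; rewrite [LHS]in_set [RHS]in_set cE in_setC.
rewrite /forest_weight big_set1 offE.
rewrite [X in _ = _ * X](eq_bigr (fun u => block_weight m m (off_core p u))) => [|u _];
  last by rewrite offE.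
rewrite [X in _ = _ * X](eq_bigl (fun u => u != None)) => [|u]; last by rewrite !inE.
rewrite (eq_bigr (fun u => block_weight m m (off_core p u) * (m.-1`!)%N%:R *
    m`!%:R ^+ off_core p u)) => [|u uN]; last first.
  by rewrite -block_weightE dE (negbTE uN); congr (_`!%:R); lia.
have offv : (off_core p None + \sum_(u | u != None) off_core p u = v)%N.
  by have := sum_off_core p; rewrite cardO (bigD1 None).
have c1 : #|[pred u : option 'I_v | u != None]| = v.
  by rewrite -[RHS]cardO k1 -cardsT -(cards1 (None : option 'I_v)) -cardsDS ?subsetT // setTD;
     apply: eq_card => u; rewrite in_setC in_set1.
set P := (X in _ = _ * X); set d := off_core p None.
have -> : \prod_(u | u != None) (block_weight m m (off_core p u) * (m.-1`!)%N%:R *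
    m`!%:R ^+ off_core p u) = P * (m.-1`!)%N%:R ^+ v * m`!%:R ^+ (v - d) :> K.
  rewrite (_ : (v - d)%N = \sum_(u | u != None) off_core p u)%N; last by move: offv; rewrite -/d; lia.
  have <- : \prod_(u : option 'I_v | u != None) (m.-1`!)%N%:R = (m.-1`!)%N%:R ^+ v :> K.
    by rewrite prodr_const c1.
  rewrite -prodrXr /P.
  move: (block_weight m m) => h.
  by rewrite !big_split.
have dv : (d <= v)%N by rewrite -offv leq_addr.
move: P => P; have := block_weightE m s.+1 d; rewrite /= addnC => hsE.
have /(congr1 (fun n => n%:R : K)) := @bin_fact (m * d + s) s (leq_addl _ _).
rewrite addnK !natrM hsE => {hsE}.
have mE : (m`!)%N%:R = m%:R * (m.-1`!)%N%:R :> K.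
  by rewrite -natrM; case: m m0 => // m' _; rewrite factS.
have ml : (m`!%:R ^+ v = m`!%:R ^+ d * m`!%:R ^+ (v - d) :> K) by rewrite -exprD subnKC.
have mE' : (m`!%:R * m`!%:R) ^+ v = m%:R ^+ v * (m.-1`!)%N%:R ^+ v * m`!%:R ^+ v :> K.
  by rewrite !exprMn {1}mE exprMn.
rewrite {}mE' ml fact0 !mulr1 expr1n mul1r.
have mN : m%:R != 0 :> K by rewrite pnatr_eq0 -lt0n.
have := expf_neq0 v mN; have := expf_neq0 v (factN0 m.-1).
have := expf_neq0 d (factN0 m); have := expf_neq0 (v - d)%N (factN0 m).
have := factN0 s; have := factN0 (m * d).
move: (m`!%:R ^+ d) (m`!%:R ^+ (v - d)) (m.-1`!%:R ^+ v) (m%:R ^+ v) => x1 x2 x3 x4.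
move: (block_weight _ _ _) (_`!%:R) (_`!%:R) => h y1 y2.
move: (#|walks _ _ _|%:R) ('C(_, _)%:R) => W B.
move=> n1 n2 n3 n4 n5 n6 E1 E2.
apply: (mulIf (x := x4 * x3 * (x1 * x2) * (y1 * y2))); first by rewrite !mulf_neq0.
transitivity (W * (x4 * x3 * (x1 * x2)) * (B * (y1 * y2))); first by ring.
by rewrite E1 E2; ring.
Qed.

(** The factor [v!] passes from classes of labelings to labelings, which are then sorted by their
    parent map [p]. *)
Lemma labelled_trees_count :
  labelled_trees (block_weight m s.+1) (block_weight m m) v =
    v`!%:R * (tree_count m v s.+1)%:R.
Proof.
rewrite -natrM /tree_count big_distrr /=.
have -> : (\sum_(X : plane_tree (m * v).+1)
    v`! * (#|labelings m v X| * #|compositions (size (children X)) s.+1|) =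
  \sum_(p in forest [set (None : option 'I_v)] (~: [set None]))
     #|walks (2 * (m * v)) (edge_mx p 0 0 m) None| * 'C(m * off_core p None + s, s))%N.
  under [RHS]eq_bigr => p pF do rewrite -(sum_compatible m0 pF (fun d => 'C(d + s, s))).
  rewrite exchange_big /=; apply: eq_bigr => X _.
  rewrite card_compositions mulnA [(v`! * _)%N]mulnC.
  by rewrite card_labelings // card_admissible // big_distrl.
rewrite natr_sum; apply: eq_bigr => p pF.
by rewrite natrM tree_walks.
Qed.

Lemma tree_egfE :
  tree_egf (block_weight m s.+1) (block_weight m m) v = (tree_count m v s.+1)%:R.
Proof. by rewrite /= labelled_trees_count mulrAC divff ?mul1r. Qed.

End Trees.
End Weights.

Local Open Scope ring_scope.

(** * Moments of walks *)

Section ProductFunctional.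
Variables (K : fieldType) (n : nat) (mu : 'I_n -> nat -> K).
Implicit Types (p q : {mpoly K[n]}) (A B : {set 'I_n}).

Local Notation E := (product_functional mu).

Let phi (e : 'X_{1..n}) : K := \prod_(t < n) mu t (e t).

Lemma product_functional_seq p (s : seq 'X_{1..n}) : uniq s ->
  {subset msupp p <= s} -> E p = \sum_(e <- s) p@_e * phi e.
Proof.
move=> us ps; rewrite /product_functional [RHS](bigID (fun e => e \in msupp p)) /=.
rewrite [X in _ + X]big1 ?addr0 => [|e /memN_msupp_eq0 ->]; last by rewrite mul0r.
rewrite -[RHS]big_filter; apply: perm_big; apply: uniq_perm.
- exact: msupp_uniq.
- exact: filter_uniq.
by move=> e; rewrite mem_filter; case: (boolP (e \in msupp p)) => // /ps ->.
Qed.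

Lemma product_functionalZD (c : K) p q : E (c *: p + q) = c * E p + E q.
Proof.
pose s := undup (msupp p ++ msupp q ++ msupp (c *: p + q)).
have us : uniq s by apply: undup_uniq.
rewrite !(@product_functional_seq _ s us); try by
  move=> e he; rewrite mem_undup !mem_cat he ?orbT.
rewrite mulr_sumr -big_split /=; apply: eq_bigr => e _.
by rewrite mcoeffD mcoeffZ mulrDl mulrA.
Qed.

Lemma product_functional0 : E 0 = 0.
Proof. by rewrite /product_functional msupp0 big_nil. Qed.

Lemma product_functionalD p q : E (p + q) = E p + E q.
Proof. by rewrite -[p]scale1r product_functionalZD mul1r scale1r. Qed.

Lemma product_functionalZ c p : E (c *: p) = c * E p.
Proof. by rewrite -[c *: p]addr0 product_functionalZD product_functional0 addr0. Qed.

Lemma product_functional_sum (I : Type) (r : seq I) (P : pred I) (F : I -> {mpoly K[n]}) :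
  E (\sum_(i <- r | P i) F i) = \sum_(i <- r | P i) E (F i).
Proof. exact: (big_morph _ product_functionalD product_functional0). Qed.

Lemma product_functionalX e : E 'X_[e] = phi e.
Proof. by rewrite /product_functional msuppX big_seq1 mcoeffX eqxx mul1r. Qed.

Definition supported A p :=
  all (fun e : 'X_{1..n} => [forall t, (t \notin A) ==> (e t == 0%N)]) (msupp p).

Lemma supportedP A p :
  reflect (forall e t, e \in msupp p -> t \notin A -> e t = 0%N) (supported A p).
Proof.
apply: (iffP allP) => [H e t /H/forallP/(_ t)/implyP/[apply]/eqP //|H e ep].
by apply/forallP => t; apply/implyP => tA; rewrite (H e t).
Qed.

Lemma supportedM A p q : supported A p -> supported A q -> supported A (p * q).
Proof.
move=> /supportedP Hp /supportedP Hq; apply/supportedP => e t /msuppM_le.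
by case/allpairsP => -[e1 e2] /= [ep eq ->] tA; rewrite mnmDE (Hp e1) ?(Hq e2).
Qed.

Lemma supportedD A p q : supported A p -> supported A q -> supported A (p + q).
Proof.
move=> /supportedP Hp /supportedP Hq; apply/supportedP => e t /msuppD_le.
by rewrite mem_cat => /orP[/Hp|/Hq]; apply.
Qed.

Lemma supportedZ A c p : supported A p -> supported A (c *: p).
Proof. by move=> /supportedP Hp; apply/supportedP => e t /msuppZ_le; apply: Hp. Qed.

Lemma supportedX A i : i \in A -> supported A 'X_i.
Proof.
move=> iA; apply/supportedP => e t; rewrite msuppX inE => /eqP -> tA.
by rewrite mnm1E; case: eqP tA => // <-; rewrite iA.
Qed.

Lemma supported1 A : supported A 1.
Proof.
by apply/supportedP => e t; rewrite -mpolyX0 msuppX inE => /eqP -> _; rewrite mnm0E.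
Qed.

Lemma supported_exp A p k : supported A p -> supported A (p ^+ k).
Proof.
move=> Hp; elim: k => [|k IH]; first by rewrite expr0 supported1.
by rewrite exprS supportedM.
Qed.

Lemma supported_sub A B p : A \subset B -> supported A p -> supported B p.
Proof.
move=> AB /supportedP H; apply/supportedP => e t ep tB; apply: H ep _.
by apply: contraNN tB; apply: subsetP.
Qed.

Hypothesis mu0 : forall t, mu t 0%N = 1.

Lemma product_functional1 : E 1 = 1.
Proof.
by rewrite -mpolyX0 product_functionalX /phi big1 // => t _; rewrite mnm0E.
Qed.

(** Each variable has exponent 0, of moment 1, in the monomials of [p] or in those of [q]. *)
Lemma product_functionalM A B p q : supported A p -> supported B q ->
  [disjoint A & B] -> E (p * q) = E p * E q.
Proof.
move=> /supportedP Hp /supportedP Hq AB; rewrite mpolyME product_functional_sum.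
rewrite big_allpairs_dep /= [E p]/product_functional mulr_suml.
rewrite big_seq [RHS]big_seq; apply: eq_bigr => e ep.
rewrite mulr_sumr big_seq [RHS]big_seq; apply: eq_bigr => e' eq.
rewrite product_functionalZ product_functionalX mulrACA; congr (_ * _).
rewrite -big_split /=; apply: eq_bigr => t _; rewrite mnmDE.
have [tA|tA] := boolP (t \in A).
  have -> : e' t = 0%N by apply: Hq => //; rewrite (disjointFr AB).
  by rewrite addn0 mu0 mulr1.
have -> : e t = 0%N by apply: Hp.
by rewrite add0n mu0 mul1r.
Qed.

Lemma product_functional_prod (I : eqType) (r : seq I) (A : I -> {set 'I_n})
    (Q : I -> {mpoly K[n]}) : uniq r ->
    (forall i, supported (A i) (Q i)) ->
    (forall i j, i \in r -> j \in r -> i != j -> [disjoint A i & A j]) ->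
  E (\prod_(i <- r) Q i) = \prod_(i <- r) E (Q i).
Proof.
move=> + HQ; elim: r => [|i r IH] /=; first by rewrite !big_nil product_functional1.
case/andP => ir ur HA; rewrite !big_cons.
have S : supported (\bigcup_(j <- r) A j) (\prod_(j <- r) Q j).
  elim: (r) => [|j s IHs]; first by rewrite !big_nil supported1.
  rewrite !big_cons supportedM //; first by apply: supported_sub (HQ j); apply: subsetUl.
  by apply: supported_sub IHs; apply: subsetUr.
rewrite (product_functionalM (HQ i) S); last first.
  have : forall j, j \in r -> [disjoint A i & A j].
    move=> j jr; apply: HA; rewrite ?inE ?eqxx ?jr ?orbT //.
    by apply: contraNneq ir => ->.
  elim: (r) => [|j s IHs] H; first by rewrite big_nil -setI_eq0 setI0.
  rewrite big_cons -setI_eq0 setIUr setU_eq0 !setI_eq0 H ?mem_head //=.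
  by apply: IHs => k ks; apply: H; rewrite inE ks orbT.
rewrite IH // => j k jr kr; apply: HA; by rewrite inE ?jr ?kr orbT.
Qed.

Lemma product_functional_monom2 i j a b : i != j ->
  E ('X_i ^+ a * 'X_j ^+ b) = mu i a * mu j b.
Proof.
move=> ij; rewrite !mpolyXn -mpolyXD product_functionalX /phi.
rewrite (bigD1 i) //= (bigD1 j) 1?eq_sym //= big1 ?mulr1.
  by rewrite !mnmDE !mulmnE !mnm1E !eqxx (negbTE ij) eq_sym (negbTE ij) !mul1n mul0n addn0 mul0n.
by move=> t /andP[ti tj]; rewrite mnmDE !mulmnE !mnm1E eq_sym (negbTE ti) eq_sym (negbTE tj) mu0.
Qed.

End ProductFunctional.

(** * Moments of powers of z and its conjugate *)

Section Moments.
Variables (C : numClosedFieldType) (m : nat).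
Hypothesis m0 : (0 < m)%N.

Local Notation nl := (nonloop_moment C m).

(* The moment <z^a zbar^b>_m, by the binomial theorem. *)
Definition pair_moment (a b : nat) : C :=
  \sum_(p < a.+1) \sum_(q < b.+1)
    ('C(a, p) * 'C(b, q))%:R * ('i ^+ p * (- 'i) ^+ q) *
    (nl (a - p + (b - q)) * nl (p + q)).

Lemma pair_momentE n (mu : 'I_n -> nat -> C) i j a b :
    (forall t, mu t 0%N = 1) -> i != j -> mu i = nl -> mu j = nl ->
  product_functional mu (('X_i + 'i *: 'X_j) ^+ a * ('X_i - 'i *: 'X_j) ^+ b) =
    pair_moment a b.
Proof.
move=> mu0 ij mui muj; rewrite -scaleNr !exprDn mulr_suml product_functional_sum.
apply: eq_bigr => p _; rewrite mulr_sumr product_functional_sum.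
apply: eq_bigr => q _; rewrite !exprZn.
rewrite (_ : _ * _ = (('C(a, p) * 'C(b, q))%:R * ('i ^+ p * (- 'i) ^+ q)) *:
    ('X_i ^+ (a - p + (b - q)) * 'X_j ^+ (p + q))); last first.
  rewrite !exprD -!scaler_nat -!scalerAr -!scalerAl !scalerA natrM.
  congr (_ *: _); last by rewrite mulrACA.
  by ring.
by rewrite product_functionalZ product_functional_monom2 // mui muj.
Qed.

Lemma nonloop0 : nl 0%N = 1.
Proof.
by rewrite /nonloop_moment dvdn0 /wick div0n fact0 !expr0 mulr1 !divr1.
Qed.

Lemma loop0 : loop_moment C m 0%N = 1.
Proof. by rewrite /loop_moment dvdn0 /wick div0n fact0 expr0 mulr1 divr1. Qed.

Let m20 : (0 < 2 * m)%N. Proof. by rewrite muln_gt0. Qed.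

Lemma wick1 : wick C (2 * m) (2 * m) = 1.
Proof.
rewrite /wick divnn m20 expr1 mulr1 divff // pnatr_eq0 -lt0n; exact: fact_gt0.
Qed.

Lemma nonloop1 : nl (2 * m) = 2^-1.
Proof. by rewrite /nonloop_moment dvdnn wick1 divnn m20 expr1 mul1r. Qed.

Lemma loop1 : loop_moment C m (2 * m) = 1.
Proof. by rewrite /loop_moment dvdnn wick1. Qed.

Lemma nonloop_neq0 k : nl k != 0 -> (2 * m %| k)%N.
Proof. by rewrite /nonloop_moment; case: ifP => //; rewrite eqxx. Qed.

Lemma loop_neq0 k : loop_moment C m k != 0 -> (2 * m %| k)%N.
Proof. by rewrite /loop_moment; case: ifP => //; rewrite eqxx. Qed.

Lemma pair_moment_neq0 a b : pair_moment a b != 0 -> (2 * m %| a + b)%N.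
Proof.
apply: contraR => H; apply/eqP; apply: big1 => p _; apply: big1 => q _.
have [->|/nonloop_neq0 d2] := eqVneq (nl (p + q)) 0; first by rewrite !mulr0.
have [->|/nonloop_neq0 d1] := eqVneq (nl (a - p + (b - q))) 0; first by rewrite mul0r mulr0.
case/negP: H.
have -> : (a + b = a - p + (b - q) + (p + q))%N.
  by have := ltn_ord p; have := ltn_ord q; lia.
exact: dvdn_add.
Qed.

(** [falling_expansion] asks for rational coefficients; rationality of the moments excludes the
    default value of [alpha]. *)
Definition rational (x : C) := exists q : rat, x = ratr q.

Lemma rational_nat k : rational k%:R.
Proof. by exists k%:R; rewrite ratr_nat. Qed.

Lemma rationalM x y : rational x -> rational y -> rational (x * y).
Proof. by move=> [a ->] [b ->]; exists (a * b); rewrite rmorphM. Qed.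

Lemma rationalV x : rational x -> rational x^-1.
Proof. by move=> [a ->]; exists a^-1; rewrite fmorphV. Qed.

Lemma rational_exp x k : rational x -> rational (x ^+ k).
Proof. by move=> [a ->]; exists (a ^+ k); rewrite rmorphXn. Qed.

Lemma rational_sum (I : Type) (r : seq I) (P : pred I) (F : I -> C) :
  (forall i, P i -> rational (F i)) -> rational (\sum_(i <- r | P i) F i).
Proof.
move=> H; elim/big_ind: _ => //; first by exists 0; rewrite rmorph0.
by move=> x y [a ->] [b ->]; exists (a + b); rewrite rmorphD.
Qed.

Lemma rational_prod (I : Type) (r : seq I) (P : pred I) (F : I -> C) :
  (forall i, P i -> rational (F i)) -> rational (\prod_(i <- r | P i) F i).
Proof.
move=> H; elim/big_ind: _ => //; first by exists 1; rewrite rmorph1.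
exact: rationalM.
Qed.

Lemma rational_wick j k : rational (wick C j k).
Proof.
apply: rationalM; first exact: rational_nat.
apply/rationalV/rationalM; last exact: rational_nat.
exact/rational_exp/rational_nat.
Qed.

Lemma rational_loop k : rational (loop_moment C m k).
Proof.
rewrite /loop_moment; case: ifP => _; first exact: rational_wick.
exact: (rational_nat 0).
Qed.

Lemma rational_nonloop k : rational (nl k).
Proof.
rewrite /nonloop_moment; case: ifP => _; last exact: (rational_nat 0).
apply: rationalM; first exact: rational_wick.
exact/rationalV/rational_exp/(rational_nat 2).
Qed.

Lemma i_powers p q : 'i ^+ p * (- 'i) ^+ q = (-1) ^+ q * 'i ^+ (p + q) :> C.
Proof. by rewrite [X in _ * X = _]exprNn mulrCA exprD. Qed.

Lemma i_even_power k : ~~ odd k -> 'i ^+ k = (-1) ^+ k./2 :> C.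
Proof.
by move=> ek; rewrite -{1}[k]odd_double_half (negbTE ek) add0n -mul2n exprM sqrCi.
Qed.

Lemma rational_pair_moment a b : rational (pair_moment a b).
Proof.
apply: rational_sum => p _; apply: rational_sum => q _.
have [->|/nonloop_neq0 d2] := eqVneq (nl (p + q)) 0.
  by rewrite !mulr0; apply: (rational_nat 0).
apply: rationalM; last by apply: rationalM; apply: rational_nonloop.
apply: rationalM; first exact: rational_nat.
have e2 : ~~ odd (p + q) by rewrite -dvdn2; apply: dvdn_trans d2; apply: dvdn_mulr.
have r1 : rational (-1) by exists (-1); rewrite rmorphN rmorph1.
by rewrite i_powers i_even_power //; apply: rationalM; apply: rational_exp.
Qed.

Lemma pair_moment00 : pair_moment 0 0 = 1.
Proof. by rewrite /pair_moment !big_ord1 /= !nonloop0 !bin0 !mulr1. Qed.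

(** Only the pure powers of [x] and of [y] survive in the expansion. They contribute 1/2 and
    [(-1)^(m + b)/2], the sign being that of ['i^a * (-'i)^b]. *)
Lemma pair_moment_simple a b : (a + b = 2 * m)%N ->
  pair_moment a b = (~~ odd (m + b))%:R.
Proof.
move=> ab; have big (p : 'I_a.+1) (q : 'I_b.+1) : (p + q)%N != 0%N ->
    (p + q)%N != (2 * m)%N -> nl (p + q) = 0.
  move=> n0 n2; rewrite /nonloop_moment; case: ifP => // /dvdnP[[|[|k]] kE].
  - by rewrite kE in n0.
  - by rewrite kE mul1n eqxx in n2.
  by have := ltn_ord p; have := ltn_ord q; rewrite !ltnS; nia.
rewrite /pair_moment pair_bigA /=.
have ne : ((ord0, ord0) : 'I_a.+1 * 'I_b.+1) != (ord_max, ord_max).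
  by rewrite xpair_eqE -!val_eqE /=; lia.
rewrite (bigD1 (ord0, ord0)) //= (bigD1 (ord_max, ord_max)) 1?eq_sym //= big1 ?addr0.
  rewrite !bin0 !binn !subnn !subn0 !addn0 ab nonloop0 nonloop1 !expr0 !mul1r mulr1.
  rewrite i_powers ab mul2n i_even_power ?odd_double // doubleK -exprD addnC -signr_odd.
  case: (odd _); first by rewrite expr1 mulN1r subrr.
  by rewrite expr0 mul1r /=; field.
move=> [p q] /andP[] /=; rewrite !xpair_eqE -!val_eqE /= => N1 N2.
by rewrite big ?mulr0 //; have := ltn_ord p; have := ltn_ord q; rewrite !ltnS; lia.
Qed.

Lemma pair_moment_simpleC a b : (a + b = 2 * m)%N -> pair_moment a b = pair_moment b a.
Proof.
move=> ab; rewrite !pair_moment_simple // ?[(b + a)%N]addnC //.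
suff -> : odd (m + b) = odd (m + a) by [].
by have := congr1 odd ab; rewrite oddM /= !oddD; case: (odd a); case: (odd b).
Qed.

Lemma zzbar_pair_moment k : zzbar_moment C m k = pair_moment k k.
Proof.
rewrite /zzbar_moment exprMn; apply: pair_momentE => // t; exact: nonloop0.
Qed.

End Moments.

Lemma big_tupleS (R : Type) (idx : R) (op : Monoid.com_law idx) (T : finType) n
    (P : pred (n.+1.-tuple T)) (F : n.+1.-tuple T -> R) :
  \big[op/idx]_(s | P s) F s =
  \big[op/idx]_j \big[op/idx]_(s : n.-tuple T | P [tuple of j :: s]) F [tuple of j :: s].
Proof.
rewrite pair_big_dep /= (reindex (fun js : T * n.-tuple T => [tuple of js.1 :: js.2])) //=.
exists (fun s : n.+1.-tuple T => (thead s, [tuple of behead s])) => [[j s] _|s _] /=.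
  by congr (_, _); apply: val_inj.
by rewrite -tuple_eta.
Qed.

Lemma prod_count (R : comNzRingType) (T : finType) (F : T -> R) (r : seq T) :
  \prod_(i <- r) F i = \prod_i F i ^+ count_mem i r.
Proof.
elim: r => [|x r IH]; first by rewrite big_nil big1.
rewrite big_cons IH [RHS](bigD1 x) //= eqxx exprS -mulrA; congr (_ * _).
rewrite [LHS](bigD1 x) //=; congr (_ * _); apply: eq_bigr => i ix.
by rewrite eq_sym (negbTE ix).
Qed.

Lemma prod_pairs (R : comNzRingType) N (G : 'I_N -> 'I_N -> R) :
  \prod_u \prod_v G u v = \prod_u G u u * \prod_(u < N) \prod_(v < N | (u < v)%N) (G u v * G v u).
Proof.
transitivity (\prod_(u < N) (G u u * \prod_(v < N | (u < v)%N) G u v * \prod_(v < N | (v < u)%N) G u v)).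
  apply: eq_bigr => u _; rewrite (bigD1 u) //= -mulrA; congr (_ * _).
  rewrite (bigID (fun v : 'I_N => (u < v)%N)) /=; congr (_ * _); apply: eq_bigl => v.
    by rewrite -val_eqE /=; case: ltngtP.
  by rewrite -val_eqE /=; case: ltngtP.
rewrite !big_split /= -mulrA; congr (_ * _).
under [in RHS]eq_bigr do rewrite big_split /=.
rewrite big_split /=; congr (_ * _).
rewrite (exchange_big_dep xpredT) //=.
Qed.

Lemma expmxE (R : comNzRingType) N (A : 'M[R]_N) n u w :
  (A ^+ n) u w = \sum_(s : n.-tuple 'I_N | last u s == w)
    \prod_(e <- steps u s) A e.1 e.2.
Proof.
elim: n u => [|n IH] u.
  rewrite expr0 [LHS]mxE; have [->|uw] := eqVneq u w.
    rewrite (big_pred1 [tuple]) => [|s]; first by rewrite big_nil.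
    by rewrite tuple0 /= !eqxx.
  by rewrite big_pred0 => // s; rewrite tuple0 /= (negbTE uw).
rewrite exprS [LHS]mxE big_tupleS; apply: eq_bigr => j _.
rewrite IH mulr_sumr; apply: eq_bigr => s _.
by rewrite /= big_cons.
Qed.

Lemma trace_expmxE (R : comNzRingType) N (A : 'M[R]_N) n :
  \tr (A ^+ n.+1) = \sum_(s : n.+1.-tuple 'I_N) \prod_u \prod_v A u v ^+ cyc_count s u v.
Proof.
rewrite /mxtrace; under eq_bigr do rewrite expmxE.
rewrite (exchange_big_dep xpredT) //=; apply: eq_bigr => s _.
case/tupleP: s => x s; rewrite pair_bigA (big_pred1 (last x s)) => [|u]; last by rewrite /= eq_sym.
transitivity (\prod_(e <- cyc_steps (x :: s)) A e.1 e.2); first by rewrite cyc_steps_cons.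
by rewrite prod_count; apply: eq_bigr => -[u v] _.
Qed.

Section Trace.
Variables (C : numClosedFieldType) (m : nat).
Hypothesis m0 : (0 < m)%N.

Definition walk_moment N (c : 'I_N -> 'I_N -> nat) : C :=
  \prod_u loop_moment C m (c u u) *
  \prod_(u < N) \prod_(v < N | (u < v)%N) pair_moment C m (c u v) (c v u).

Section Fixed.
Variable N : nat.
Local Notation mu := (@coord_moment C m N).
Local Notation idx := (@mxvec_index N N).

Let muE i j : mu (idx i j) = if i == j then loop_moment C m else nonloop_moment C m.
Proof. by rewrite /coord_moment mxvecE mxE. Qed.

Let mu0 t : mu t 0%N = 1.
Proof.
case/mxvec_indexP: t => i j; rewrite muE.
by case: ifP => _; [apply: loop0 | apply: nonloop0].
Qed.

Let idx_inj i j i' j' : idx i j = idx i' j' -> i = i' /\ j = j'.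
Proof.
have [g gK _] := curry_mxvec_bij N N.
by move=> E; have := congr1 g E; rewrite !(gK (_, _)) // => -[-> ->].
Qed.

(** The entries are grouped by unordered pairs, which use disjoint sets of coordinates. *)
Lemma product_functional_walk (c : 'I_N -> 'I_N -> nat) :
  product_functional mu (\prod_u \prod_v hermitian_mx C N u v ^+ c u v) = walk_moment c.
Proof.
pose Q (e : 'I_N * 'I_N) : {mpoly C[N * N]} :=
  if e.1 == e.2 then Defs.coord C e.1 e.1 ^+ c e.1 e.1
  else (Defs.coord C e.1 e.2 + 'i *: Defs.coord C e.2 e.1) ^+ c e.1 e.2 *
       (Defs.coord C e.1 e.2 - 'i *: Defs.coord C e.2 e.1) ^+ c e.2 e.1.
pose A (e : 'I_N * 'I_N) := [set idx e.1 e.2; idx e.2 e.1].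
have QA e : supported (A e) (Q e).
  have A1 : supported (A e) (Defs.coord C e.1 e.2) by apply: supportedX; rewrite !inE eqxx.
  have A2 : supported (A e) (Defs.coord C e.2 e.1) by apply: supportedX; rewrite !inE eqxx orbT.
  rewrite /Q; case: eqP => [E|_]; first by apply: supported_exp; move: A1; rewrite -E.
  rewrite -scaleNr.
  by apply: supportedM; apply: supported_exp; apply: supportedD => //; apply: supportedZ.
pose r := enum [pred e : 'I_N * 'I_N | (e.1 <= e.2)%N].
transitivity (product_functional mu (\prod_(e <- r) Q e)).
  congr product_functional; rewrite prod_pairs /r big_enum /=.
  rewrite (bigID (fun e : 'I_N * 'I_N => e.1 == e.2)) /=; congr (_ * _).
    rewrite (reindex (fun u : 'I_N => (u, u))) /=; last first.
      by exists fst => [u _ //|[u v]]; rewrite inE /= => /andP[_ /eqP ->].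
    apply: eq_big => [u|u _] /=; first by rewrite inE /= leqnn eqxx.
    by rewrite /Q /hermitian_mx /= !mxE !eqxx.
  rewrite pair_big_dep /=; apply: eq_big => [[u v]|[u v] uv] /=.
    by rewrite inE /= -val_eqE /= ltn_neqAle andbC.
  have ne : (u == v) = false by apply/negbTE; rewrite -val_eqE neq_ltn; move: uv => /= ->.
  by rewrite /Q /hermitian_mx /= ne !mxE ne uv eq_sym ne ltnNge (ltnW uv).
rewrite (@product_functional_prod _ _ mu mu0 _ r A Q) ?enum_uniq //; last first.
  move=> [u v] [u' v']; rewrite !mem_enum !inE /= => uv uv' ne.
  rewrite -setI_eq0; apply/eqP/setP => t; rewrite !inE; apply/negP.
  case/andP => /orP[]/eqP -> /orP[]/eqP/idx_inj /= [E1 E2]; case/negP: ne;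
    rewrite xpair_eqE -!val_eqE /= -?E1 -?E2 ?eqxx //; move: uv uv'; rewrite -E1 -E2 => le ge.
  - by rewrite [X in X && _]eqn_leq [X in _ && X]eqn_leq le ge.
  by rewrite [X in X && _]eqn_leq [X in _ && X]eqn_leq le ge.
rewrite /r big_enum /= (bigID (fun e : 'I_N * 'I_N => e.1 == e.2)) /=; congr (_ * _).
  rewrite (reindex (fun u : 'I_N => (u, u))) /=; last first.
    by exists fst => [u _ //|[u v]]; rewrite inE /= => /andP[_ /eqP ->].
  apply: eq_big => [u|u _] /=; first by rewrite inE /= leqnn eqxx.
  rewrite /Q /= eqxx.
  rewrite /Defs.coord mpolyXn product_functionalX (bigD1 (idx u u)) //= big1 ?mulr1.
    by rewrite mulmnE mnm1E eqxx mul1n muE eqxx.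
  by move=> t tu; rewrite mulmnE mnm1E eq_sym (negbTE tu) mul0n mu0.
rewrite [RHS]pair_big_dep /=; apply: eq_big => [[u v]|[u v] /andP[_ ne]] /=.
  by rewrite inE /= -val_eqE /= ltn_neqAle andbC.
rewrite /Q /= in ne *; rewrite (negbTE ne).
apply: pair_momentE => //; rewrite ?muE ?(negbTE ne) //.
  by apply: contraNneq ne => /idx_inj[-> _].
by rewrite eq_sym (negbTE ne).
Qed.

End Fixed.

Lemma trace_momentE n N :
  trace_moment C m n.+1 N = \sum_(s : n.+1.-tuple 'I_N) walk_moment (cyc_count s).
Proof.
rewrite /trace_moment trace_expmxE product_functional_sum.
by apply: eq_bigr => s _; apply: product_functional_walk.
Qed.

End Trace.

(** * The coefficient of the falling factorial *)

Lemma cyc_count_map (T T' : finType) (g : T -> T') (s : seq T) u v : injective g ->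
  cyc_count (map g s) (g u) (g v) = cyc_count s u v.
Proof.
move=> gI; rewrite /cyc_count /cyc_steps -map_rotr.
have -> : zip (map g (rotr 1 s)) (map g s) =
    map (fun e => (g e.1, g e.2)) (zip (rotr 1 s) s).
  by move: (rotr 1 s) => p; elim: p s => [|x p IH] [|y q] //=; rewrite IH.
by rewrite count_map; apply: eq_count => -[a b] /=; rewrite !xpair_eqE !(inj_eq gI).
Qed.

Lemma cyc_count_notin (T : finType) (s : seq T) u v :
  (u \notin s) || (v \notin s) -> cyc_count s u v = 0%N.
Proof.
move=> H; have := leq_outdeg (cyc_count s) u v; have := leq_indeg (cyc_count s) u v.
rewrite indeg_cyc_count outdeg_cyc_count.
by case/orP: H => /count_memPn ->; lia.
Qed.

Section Grouping.
Variables (C : numClosedFieldType) (m : nat).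
Hypothesis m0 : (0 < m)%N.

Local Notation W := (walk_moment C m).

Definition surjective_walk n k (s : n.-tuple 'I_k) := [forall u, u \in s].

Definition surjective_sum n k : C :=
  \sum_(s : n.-tuple 'I_k | surjective_walk s) W (cyc_count s).

Lemma prod_codom (k N : nat) (g : 'I_k -> 'I_N) (F : 'I_N -> C) : injective g ->
  (forall x, x \notin codom g -> F x = 1) -> \prod_x F x = \prod_u F (g u).
Proof.
move=> gI F1; rewrite (bigID (fun x => x \in codom g)) /= [X in _ * X]big1 ?mulr1 //.
rewrite -(big_imset F (in2W gI)) /=; apply: eq_bigl => x.
by apply/idP/imsetP => [/codomP[u ->]|[u _ ->]]; [exists u | apply: codom_f].
Qed.

(** [g] must preserve the order, since [walk_moment] reads each pair from its smaller index. *)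
Lemma walk_moment_map n k N (g : 'I_k -> 'I_N) (s : n.-tuple 'I_k) :
  (forall u v, (g u < g v)%N = (u < v)%N) ->
  W (cyc_count (map g s)) = W (cyc_count s).
Proof.
move=> gm; have gI : injective g.
  move=> u v E; apply: val_inj; have := gm u v; have := gm v u; rewrite E ltnn.
  by case: (ltngtP u v).
have out x y : (x \notin codom g) || (y \notin codom g) -> cyc_count (map g s) x y = 0%N.
  move=> H; apply: cyc_count_notin; case/orP: H => H; apply/orP; [left|right];
    by apply: contraNN H => /mapP[u _ ->]; apply: codom_f.
rewrite /walk_moment; congr (_ * _).
  rewrite (prod_codom gI) => [|x xg]; last by rewrite out ?xg // loop0.
  by apply: eq_bigr => u _; rewrite cyc_count_map.
rewrite (prod_codom gI) => [|x xg]; last first.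
  by apply: big1 => y _; rewrite !out ?xg ?orbT // pair_moment00.
apply: eq_bigr => u _; rewrite big_mkcond (prod_codom gI) => [|y yg]; last first.
  by rewrite !out ?yg ?orbT // pair_moment00 if_same.
by rewrite [RHS]big_mkcond; apply: eq_bigr => v _; rewrite gm !cyc_count_map.
Qed.

Lemma enum_val_mono N (A : {set 'I_N}) (i j : 'I_#|A|) :
  (enum_val i < enum_val j)%N = (i < j)%N.
Proof.
have sA : sorted ltn (map val (enum A)).
  rewrite sorted_map /enum_mem; apply: sorted_filter; first by move=> x y z; apply: ltn_trans.
  by rewrite -sorted_map -enumT val_enum_ord iota_ltn_sorted.
have szi (k : 'I_#|A|) : nat_of_ord k \in [pred l : nat | (l < size (map val (enum A)))%N].
  by rewrite inE size_map -cardE.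
have E (k : 'I_#|A|) : nat_of_ord (enum_val k) = nth 0%N (map val (enum A)) k.
  have kA : (k < size (enum A))%N by rewrite -cardE.
  by rewrite (nth_map (enum_val k)) // -enum_val_nth.
rewrite !E.
have H := sorted_ltn_nth ltn_trans 0%N sA.
have [ij|ij|ij] := ltngtP i j.
- by apply: H.
- by have := H j i (szi j) (szi i) ij; rewrite ltnNge => /negbTE; case: ltngtP.
by rewrite ij ltnn.
Qed.

Lemma sum_image n N (A : {set 'I_N}) :
  \sum_(s : n.+1.-tuple 'I_N | [set x in s] == A) W (cyc_count s) =
  surjective_sum n.+1 #|A|.
Proof.
pose g (s : n.+1.-tuple 'I_#|A|) := [tuple of map enum_val s] : n.+1.-tuple 'I_N.
have gI : injective g.
  by move=> s t /(congr1 val) /= /(inj_map enum_val_inj) /val_inj.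
rewrite /surjective_sum.
under [RHS]eq_bigr => s _ do rewrite -(walk_moment_map s (@enum_val_mono N A)).
rewrite -[RHS](big_imset (fun s : n.+1.-tuple 'I_N => W (cyc_count s))) /=; last first.
  by move=> s t _ _; apply: gI.
apply: eq_bigl => s; apply/eqP/imsetP => [sA|[t ts ->]]; last first.
  apply/setP => x; rewrite inE; apply/mapP/idP => [[i _ ->]|xA]; first exact: enum_valP.
  exists (enum_rank_in xA x); last by rewrite enum_rankK_in.
  by move/forallP: ts; apply.
have sE x : (x \in s) = (x \in A) by rewrite -sA inE.
have xA : tnth s ord0 \in A by rewrite -sE mem_tnth.
exists [tuple of map (enum_rank_in xA) s].
  apply/forallP => i; apply/mapP; exists (enum_val i); first by rewrite sE enum_valP.
  by rewrite enum_valK_in.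
apply: val_inj; rewrite /= -map_comp -[LHS]map_id; apply/eq_in_map => x.
by rewrite sE /= => ?; rewrite enum_rankK_in.
Qed.

Lemma trace_moment_binomial n N : trace_moment C m n.+1 N =
  \sum_(k < N.+1) 'C(N, k)%:R * surjective_sum n.+1 k.
Proof.
rewrite trace_momentE // (partition_big (fun s : n.+1.-tuple 'I_N => [set x in s]) predT) //=.
under eq_bigr do rewrite sum_image.
have := sum_subsets [set: 'I_N] (fun k => surjective_sum n.+1 k).
rewrite cardsT card_ord => <-; apply: eq_bigl => A; by rewrite subsetT.
Qed.

Section Good.
Variables (n k : nat) (s : n.-tuple 'I_k).
Hypotheses (ss : surjective_walk s) (Ws : W (cyc_count s) != 0).

Lemma walk_dvd_pair u v : u != v -> (2 * m %| cyc_count s u v + cyc_count s v u)%N.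
Proof.
move: Ws; rewrite /walk_moment mulf_eq0 negb_or => /andP[_ /prodf_neq0 H] uv.
have H' (x y : 'I_k) : (x < y)%N -> (2 * m %| cyc_count s x y + cyc_count s y x)%N.
  move=> xy; apply: (@pair_moment_neq0 C); move/prodf_neq0: (H x isT); exact.
by case: (ltngtP u v) uv => [||/val_inj ->]; rewrite ?eqxx // => ? _; [|rewrite addnC]; apply: H'.
Qed.

Lemma walk_dvd_loop u : (2 * m %| cyc_count s u u)%N.
Proof.
move: Ws; rewrite /walk_moment mulf_eq0 negb_or => /andP[/prodf_neq0 H _].
exact/(@loop_neq0 C)/H.
Qed.

Lemma walk_outdeg u : (0 < outdeg (cyc_count s) u)%N.
Proof. by rewrite outdeg_cyc_count -has_count has_pred1; move/forallP: ss. Qed.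

Lemma walk_circ u : outdeg (cyc_count s) u = indeg (cyc_count s) u.
Proof. by rewrite outdeg_cyc_count indeg_cyc_count. Qed.

Lemma walk_size : (\sum_u outdeg (cyc_count s) u = n)%N.
Proof.
by under eq_bigr do rewrite outdeg_cyc_count; rewrite sum_count_mem size_tuple.
Qed.

(** The walk [s] itself makes the left side of [closed_best] positive. *)
Lemma walk_arb z : arb_sum z (exit_weight (cyc_count s) z) != 0%N.
Proof.
have := closed_best walk_size walk_circ (walk_outdeg z).
have sc : s \in closed_walks n (cyc_count s) by apply/closed_walksP.
have c0 : (0 < #|closed_walks n (cyc_count s)|)%N by apply/card_gt0P; exists s.
have e0 : (0 < entry_fact (cyc_count s))%N.
  by apply: prodn_gt0 => u; apply: prodn_gt0 => v; apply: fact_gt0.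
by apply: contra_eqN => /eqP ->; rewrite mul0n muln0 -lt0n muln_gt0 c0.
Qed.

End Good.

Lemma surjective_sum_big r k : (r.+1 < k)%N -> surjective_sum (2 * m * r) k = 0.
Proof.
move=> rk; apply: big1 => s ss; apply/eqP; apply: contraLR rk => Ws.
have [k0|k0] := posnP k; first by rewrite k0.
have := card_vertices_le m0 (walk_dvd_pair Ws) (walk_dvd_loop Ws) (z := Ordinal k0)
  (walk_size s) (walk_outdeg ss) (walk_arb ss _).
by rewrite card_ord -leqNgt.
Qed.

Lemma rational_surjective_sum n k : rational (surjective_sum n k).
Proof.
apply: rational_sum => s _; apply: rationalM.
  by apply: rational_prod => u _; apply: rational_loop.
by apply: rational_prod => u _; apply: rational_prod => v _; apply: rational_pair_moment.
Qed.

Lemma sum_widen (K L : nat) (g : nat -> C) : (K <= L)%N ->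
  (forall k, (K <= k)%N -> g k = 0) -> \sum_(k < L) g k = \sum_(k < K) g k.
Proof.
move=> KL g0; rewrite (big_ord_widen L g KL) [RHS]big_mkcond; apply: eq_bigr => k _.
by case: ltnP => // /g0.
Qed.

(** Binomials become falling factorials through [k!]. The ranges of the two sums agree because the
    terms with [k > N] or [k > r + 1] vanish. *)
Lemma expansion_value r N : (0 < r)%N ->
  (2 * m * r)%:R^-1 * trace_moment C m (2 * m * r) N =
  \sum_(l < r.+2) (surjective_sum (2 * m * r) (r.+1 - l) /
    ((2 * m * r)%:R * ((r.+1 - l)`!)%N%:R)) * (N ^_ (r.+1 - l))%:R.
Proof.
move=> r0; have n0 : (0 < 2 * m * r)%N by rewrite !muln_gt0 m0.
rewrite [RHS](reindex_inj rev_ord_inj) /=.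
under [RHS]eq_bigr => l _.
  have -> : (r.+1 - (r.+2 - l.+1) = l)%N by have := ltn_ord l; lia.
  over.
have vanish := @surjective_sum_big r; move: (2 * m * r)%N n0 vanish => n n0 vanish.
case: n n0 vanish => // n _ vanish; rewrite trace_moment_binomial.
have E k : surjective_sum n.+1 k / (n.+1%:R * (k`!)%N%:R) * (N ^_ k)%:R =
    n.+1%:R^-1 * ('C(N, k)%:R * surjective_sum n.+1 k).
  rewrite -bin_ffact natrM; have k0 : (k`!)%N%:R != 0 :> C.
    by rewrite pnatr_eq0 -lt0n fact_gt0.
  have nN : n.+1%:R != 0 :> C by rewrite pnatr_eq0.
  by move: (n.+1%:R : C) nN => y yN; field; rewrite k0 yN.
under [RHS]eq_bigr do rewrite E.
rewrite -mulr_sumr; congr (_ * _).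
pose g k := 'C(N, k)%:R * surjective_sum n.+1 k : C.
transitivity (\sum_(k < N.+1 + r.+2) g k).
  by apply/esym/sum_widen; rewrite ?leq_addr // => k Nk; rewrite /g bin_small // mul0r.
by apply/sum_widen; rewrite ?leq_addl // => k rk; rewrite /g vanish ?mulr0.
Qed.

(** The forward difference in [N] turns [N ^_ k.+1] into [k.+1 * N ^_ k] and removes [b 0], which is
    then found at [N = 1]. *)
Lemma falling_independent K (b : nat -> C) :
  (forall N, (0 < N)%N -> \sum_(k < K) b k * (N ^_ k)%:R = 0) ->
  forall k, (k < K)%N -> b k = 0.
Proof.
elim: K b => // K IH b H k.
have bS j : (j < K)%N -> b j.+1 = 0.
  move=> jK; suff E : b j.+1 * j.+1%:R = 0.
    by apply/eqP; move/eqP: E; rewrite mulf_eq0 pnatr_eq0 orbF.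
  apply: (IH (fun j => b j.+1 * j.+1%:R)) jK => N N0.
  pose S x := \sum_(i < K) b i.+1 * (x ^_ i.+1)%:R.
  have SE x : (0 < x)%N -> S x = - b 0%N.
    by move=> /H; rewrite big_ord_recl ffactn0 mulr1 addrC => /eqP; rewrite addr_eq0 => /eqP.
  transitivity (S N.+1 - S N); last by rewrite !SE // subrr.
  rewrite /S -sumrB.
  apply: eq_bigr => i _; rewrite -mulrBr -mulrA; congr (_ * _).
  rewrite ffactSS ffactnSr !natrM.
  have [iN|iN] := leqP i N; first by rewrite natrB // -(natr1 i) -(natr1 N); ring.
  by rewrite ffact_small // mulr0 mul0r mulr0 subrr.
case: k => [_|k]; last by rewrite ltnS => /bS.
have := H 1%N isT; rewrite big_ord_recl ffactn0 mulr1 big1 ?addr0 // => i _.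
by rewrite bS ?mul0r.
Qed.

(** An expansion exists, so the default value is excluded; the one that [alpha] chooses is unknown,
    but [falling_independent] makes it unique. *)
Lemma alphaE r : (0 < r)%N ->
  ratr (alpha C m 1 r) = surjective_sum (2 * m * r) r / ((2 * m * r)%:R * (r`!)%N%:R).
Proof.
move=> r0; pose x l := surjective_sum (2 * m * r) (r.+1 - l) /
    ((2 * m * r)%:R * ((r.+1 - l)`!)%N%:R).
have xR l : exists q : rat, ratr q == x l.
  have [q ->] : rational (x l); last by exists q.
  apply: rationalM; first exact: rational_surjective_sum.
  by apply/rationalV/rationalM; apply: rational_nat.
pose a l := xchoose (xR l); have aE l : ratr (a l) = x l by apply/eqP; apply: (xchooseP (xR l)).
have fa : falling_expansion C m r a.
  move=> N _; rewrite expansion_value //; apply: eq_bigr => l _.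
  by rewrite aE.
rewrite /alpha; case: pselect => [aP|[]]; last by exists a.
case: (cid aP) => /= a' fa'.
suff : ratr (a' 1%N) = x 1%N by rewrite /x subn1.
have H N : (0 < N)%N ->
    \sum_(k < r.+2) (ratr (a' (r.+1 - k)%N) - x (r.+1 - k)%N) * (N ^_ k)%:R = 0.
  move=> N0; rewrite (reindex_inj rev_ord_inj) /=.
  under eq_bigr => l _.
    have -> : (r.+2 - l.+1 = r.+1 - l)%N by rewrite subSS.
    have -> : (r.+1 - (r.+1 - l) = l)%N by have := ltn_ord l; lia.
    rewrite mulrBl; over.
  by rewrite sumrB -fa' // expansion_value // subrr.
have := falling_independent (b := fun k => ratr (a' (r.+1 - k)%N) - x (r.+1 - k)%N) H (k := r).
by rewrite subSn // subnn => /(_ (ltnW (ltnSn _)))/eqP; rewrite subr_eq0 => /eqP.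
Qed.

End Grouping.

(** As [a - b = 2 * (m - b)], divisibility by 4 is the parity condition under which
    [pair_moment_simple] gives 1. *)
Lemma index_pair_odd m a b : (a + b = 2 * m)%N -> index_pair m a b = ~~ odd (m + b).
Proof.
move=> ab; rewrite /index_pair ab eqxx /=; apply/idP/idP => [/dvdzP[q qE]|mb].
  by lia.
have [h hE] : exists h, (m + b = 2 * h)%N.
  by exists (m + b)./2; rewrite mul2n even_halfK.
by apply/dvdzP; exists (h%:Z - b%:Z); lia.
Qed.

(** * Moments of the walks along a function *)

Section EdgeMoment.
Variables (C : numClosedFieldType) (m r : nat).
Hypothesis m0 : (0 < m)%N.
Variable f : {ffun 'I_r -> 'I_r}.
Hypothesis f0 : core f != set0.
Implicit Types (u v : 'I_r) (a b : nat).

Local Notation W := (walk_moment C m).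
Local Notation pm := (pair_moment C m).

Lemma eq_walk_moment N (c c' : 'I_N -> 'I_N -> nat) :
  (forall u v : 'I_N, c u v = c' u v) -> W c = W c'.
Proof.
move=> E; rewrite /walk_moment; congr (_ * _); first by apply: eq_bigr => u _; rewrite E.
by apply: eq_bigr => u _; apply: eq_bigr => v _; rewrite !E.
Qed.

Let z_core : exists z, z \in core f. Proof. exact/set0Pn. Qed.

Lemma loop_edge a b u : (a + b = 2 * m)%N -> loop_moment C m (edge_mx f a b m u u) = 1.
Proof.
move=> ab; rewrite /edge_mx; case: eqP => [uf|_]; last by rewrite loop0.
have [z zc] := z_core.
have uc : u \in core f by apply: (@periodic_core _ f z u 0) => //=.
by rewrite uc !mul1n ab loop1.
Qed.

Lemma pm_mm : pm m m = 1.
Proof. by rewrite pair_moment_simple ?addnn ?odd_double // mul2n. Qed.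

Lemma pm_edge a b u v : (a + b = 2 * m)%N -> u != v ->
  pm (edge_mx f a b m u v) (edge_mx f a b m v u) =
    if (v == f u) && (u == f v) then pm (2 * m) (2 * m)
    else if (v == f u) && (u \in core f) || (u == f v) && (v \in core f) then pm a b
    else 1.
Proof.
move=> ab uv; have [z zc] := z_core; rewrite /edge_mx.
have [vf|vf] := eqVneq v (f u); have [uf|uf] := eqVneq u (f v);
  rewrite /= ?mul1n ?mul0n ?addn0 ?add0n.
- have uc : u \in core f by apply: (@periodic_core _ f z u 1) => //=; rewrite -vf.
  have vc : v \in core f by rewrite vf f_core.
  by rewrite uc vc ab.
- by rewrite orbF; case: ifP => _ //; rewrite pm_mm.
- by case: ifP => _; [rewrite pair_moment_simpleC // addnC | rewrite pm_mm].
by rewrite pair_moment00.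
Qed.

Lemma walk_moment_edge a b : (a + b = 2 * m)%N ->
  W (edge_mx f a b m) = \prod_(u < r) \prod_(v < r | (u < v)%N)
    if (v == f u) && (u == f v) then pm (2 * m) (2 * m)
    else if (v == f u) && (u \in core f) || (u == f v) && (v \in core f) then pm a b
    else 1.
Proof.
move=> ab; rewrite /walk_moment big1 ?mul1r => [|u _]; last exact: loop_edge.
apply: eq_bigr => u _; apply: eq_bigr => v uv; apply: pm_edge => //.
by rewrite -val_eqE neq_ltn uv.
Qed.

Lemma walk_moment_loop : #|core f| = 1%N -> W (edge_mx f (2 * m) 0 m) = 1.
Proof.
move=> k1; rewrite walk_moment_edge ?addn0 //; apply: big1 => u _; apply: big1 => v uv.
have uNv : u != v by rewrite -val_eqE neq_ltn uv.
have fix1 x : x \in core f -> f x = x.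
  by move=> xc; have := iter_card_core xc; rewrite k1.
have [z zc] := z_core.
have H x y : x != y -> (y == f x) && (x \in core f) = false.
  by move=> xy; case: (boolP (x \in core f)) => [/fix1 ->|]; rewrite ?andbF // eq_sym (negbTE xy).
case: ifP => [/andP[/eqP vf /eqP uf]|_]; last by rewrite !H // eq_sym.
have uc : u \in core f by apply: (@periodic_core _ f z u 1) => //=; rewrite -vf.
by move: uNv; rewrite vf fix1 // eqxx.
Qed.

(** The cycle is one pair, crossed [2 * m] times each way; all other factors are 1. *)
Lemma walk_moment_double : #|core f| = 2%N ->
  W (edge_mx f (2 * m) 0 m) = pm (2 * m) (2 * m).
Proof.
move=> k2; have [z zc] := z_core.
have ff x : x \in core f -> f (f x) = x.
  by move=> xc; have := iter_card_core xc; rewrite k2.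
have zN : z != f z by apply: (@core_iter_neq _ f z 0 1) => //; rewrite k2.
have coreE x : (x \in core f) = (x == z) || (x == f z).
  by rewrite (core_fconnect x zc) fconnect_orbit /orbit (order_core zc) k2 /= !inE.
have [p [q [pq pE]]] : exists p q : 'I_r, (p < q)%N /\
    forall u v, (u < v)%N -> (v == f u) && (u == f v) = (u == p) && (v == q).
  have H u v : (v == f u) && (u == f v) = ((u == z) && (v == f z)) || ((u == f z) && (v == z)).
    apply/idP/idP => [/andP[/eqP vf /eqP uf]|]; last first.
      by case/orP => /andP[/eqP -> /eqP ->]; rewrite ?ff ?eqxx.
    have : u \in core f by apply: (@periodic_core _ f z u 1) => //=; rewrite -vf.
    by rewrite coreE => /orP[]/eqP uE; rewrite vf uE ?ff // !eqxx ?orbT.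
  case: (ltngtP z (f z)) => zf.
  - exists z, (f z); split=> // u v uv; rewrite H.
    case: (u =P f z) => [uE|_] /=; last by rewrite orbF.
    by case: (v =P z) => [vE|_]; rewrite ?orbF //; move: uv; rewrite uE vE; lia.
  - exists (f z), z; split=> // u v uv; rewrite H.
    case: (u =P z) => [uE|_] //=.
    by case: (v =P f z) => [vE|_] //; move: uv; rewrite uE vE; lia.
  by move: zN; rewrite -(val_inj zf) eqxx.
rewrite walk_moment_edge ?addn0 // (bigD1 p) //= (bigD1 q) //= pE // !eqxx /=.
have one u v : (u < v)%N -> ~~ ((u == p) && (v == q)) ->
    (if (v == f u) && (u == f v) then pm (2 * m) (2 * m)
    else if (v == f u) && (u \in core f) || (u == f v) && (v \in core f) then pm (2 * m) 0
    else 1) = 1.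
  move=> uv N; rewrite pE // (negbTE N).
  have H0 : (v == f u) && (u == f v) = false by rewrite pE // (negbTE N).
  have -> : (v == f u) && (u \in core f) = false.
    apply/negP => /andP[/eqP E uc]; have uE : u = f v by rewrite E ff.
    by move: H0; rewrite -E -uE !eqxx.
  have -> // : (u == f v) && (v \in core f) = false.
  apply/negP => /andP[/eqP E vc]; have vE : v = f u by rewrite E ff.
  by move: H0; rewrite -E -vE !eqxx.
rewrite big1 ?mulr1 => [|v /andP[pv vq]]; last by apply: one; rewrite ?(negbTE vq) ?andbF.
rewrite big1 ?mulr1 // => u up; apply: big1 => v uv; apply: one => //.
by rewrite (negbTE up).
Qed.

(** Every cycle edge contributes the same [pair_moment a b], which is 0 or 1, so its power does not
    depend on the length of the cycle. *)
Lemma walk_moment_cycle a b : (2 < #|core f|)%N -> (a + b = 2 * m)%N ->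
  W (edge_mx f a b m) = (index_pair m a b)%:R.
Proof.
move=> k3 ab; have [z zc] := z_core; rewrite walk_moment_edge //.
have nb u v : (v == f u) && (u == f v) = false.
  apply/negP => /andP[/eqP vf /eqP uf].
  have uc : u \in core f by apply: (@periodic_core _ f z u 1) => //=; rewrite -vf.
  by have := @core_iter_neq _ f u 0 2 uc isT k3; rewrite /= -vf -uf eqxx.
rewrite index_pair_odd //; case: (boolP (odd _)) => ob /=; last first.
  apply: big1 => u _; apply: big1 => v _; rewrite nb pair_moment_simple // ob.
  by rewrite if_same.
have pm0 : pm a b = 0 by rewrite pair_moment_simple // ob.
have zN : z != f z by apply: (@core_iter_neq _ f z 0 1) => //; lia.
apply/eqP; case: (ltngtP z (f z)) => zf; last by move: zN; rewrite -(val_inj zf) eqxx.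
  apply/prodf_eq0; exists z => //; apply/prodf_eq0; exists (f z) => //.
  by rewrite nb eqxx zc pm0.
apply/prodf_eq0; exists (f z) => //; apply/prodf_eq0; exists z => //.
by rewrite nb eqxx zc orbT pm0.
Qed.

End EdgeMoment.

(** * Summation over the functions with a single cycle *)

Section CoreSum.
Variables (C : numClosedFieldType) (m r : nat).
Hypotheses (m0 : (0 < m)%N) (r0 : (0 < r)%N).

Local Notation W := (walk_moment C m).
Local Notation n := (2 * m * r)%N.
Local Notation weight := (endo_weight (block_weight C m (2 * m)) (block_weight C m m)).
Implicit Types (f : {ffun 'I_r -> 'I_r}) (s : n.-tuple 'I_r).

Definition orientation_number (k : nat) : C := if (k <= 2)%N then 1 else 2.

Let oriented f s := surjective_walk s && orients m (cyc_count s) f.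

(** A walk of nonzero moment has [orientation_number] orientations, all with the same cycle length,
    so that dividing by this number counts it once. *)
Lemma surjective_sum_orientations : surjective_sum C m n r =
  \sum_(f | core f != set0) (orientation_number #|core f|)^-1 *
    \sum_(s | oriented f s) W (cyc_count s).
Proof.
rewrite /surjective_sum.
under [RHS]eq_bigr do rewrite mulr_sumr.
rewrite (exchange_big_dep (fun s => surjective_walk s)) /=; last by move=> f s _ /andP[].
apply: eq_bigr => s ss; have [->|Ws] := eqVneq (W (cyc_count s)) 0.
  by rewrite big1 // => f _; rewrite mulr0.
have V0 : 'I_r by exact: Ordinal r0.
have sz : (\sum_u outdeg (cyc_count s) u = 2 * m * #|'I_r|)%N.
  by rewrite walk_size card_ord.
have [f f0 fs] := orientation_exists m0 (walk_dvd_pair m0 Ws) (walk_dvd_loop Ws) sz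
  (walk_outdeg ss) (walk_arb ss V0).
rewrite (eq_bigr (fun=> (orientation_number #|core f|)^-1 * W (cyc_count s))); last first.
  move=> g /andP[g0 /andP[_ gs]]; congr (_^-1 * _).
  have : g \in [set g : {ffun 'I_r -> 'I_r} | (core g != set0) && orients m (cyc_count s) g].
    by rewrite inE g0.
  by rewrite (orientationsE m0 f0 fs) !inE => /orP[]/eqP -> //; rewrite core_rev.
rewrite sumr_const -[RHS]mulr_natl mulrA.
rewrite [X in X%:R](_ : _ = if (#|core f| <= 2)%N then 1%N else 2); last first.
  rewrite -(card_orientations m0 f0 fs); apply: eq_card => g.
  by rewrite inE /oriented ss.
by rewrite /orientation_number; case: ifP => _; rewrite divff ?mul1r ?oner_eq0 ?pnatr_eq0.
Qed.

Lemma oriented_closed f a b s : core f != set0 -> (a + b = 2 * m)%N ->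
  s \in closed_walks n (edge_mx f a b m) -> oriented f s.
Proof.
move=> f0 ab /closed_walksP sc; apply/andP; split.
  apply/forallP => u; rewrite -has_pred1 has_count -outdeg_cyc_count.
  rewrite [outdeg _ _](_ : _ = outdeg (edge_mx f a b m) u); last first.
    by apply: eq_bigr => v _; rewrite sc.
  by rewrite outdeg_edge_mx; case: ifP => _; lia.
apply/orientsP => u v; rewrite !sc.
by have /orientsP -> := orients_edge_mx f ab.
Qed.

(** On a short cycle all values of [a] give the same step counts; [b = 0] is the choice that
    [entry_fact_edge] admits. *)
Lemma sum_oriented_small f : core f != set0 -> (#|core f| <= 2)%N ->
  \sum_(s | oriented f s) W (cyc_count s) =
  #|closed_walks n (edge_mx f (2 * m) 0 m)|%:R * W (edge_mx f (2 * m) 0 m).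
Proof.
move=> f0 k2; rewrite mulr_natl -sumr_const.
apply: eq_big => [s|s]; last first.
  move=> so; apply: eq_walk_moment; apply/closed_walksP; move: so; case/andP => ss so.
  have [a am E] := circulationE f0 so (walk_circ s).
  apply/closed_walksP => u v; rewrite E; apply: edge_mx_small => //; lia.
apply/idP/idP => [/andP[ss so]|]; last by apply: oriented_closed; rewrite ?addn0.
have [a am E] := circulationE f0 so (walk_circ s).
apply/closed_walksP => u v; rewrite E; apply: edge_mx_small => //; lia.
Qed.

(** The value of [a] is read off from the steps from [z] to [f z], an entry into which [b] does not
    enter when the cycle is longer than 2. *)
Lemma sum_oriented_cycle f : core f != set0 -> (2 < #|core f|)%N ->
  \sum_(s | oriented f s) W (cyc_count s) =
  \sum_(a < (2 * m).+1) #|closed_walks n (edge_mx f a (2 * m - a) m)|%:R *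
     (index_pair m a (2 * m - a))%:R.
Proof.
move=> f0 k3; have /set0Pn[z zc] := f0.
have entry a b : edge_mx f a b m z (f z) = a.
  rewrite /edge_mx eqxx zc f_core //; have := @core_iter_neq _ f z 0 2 zc isT k3.
  by rewrite /= => /negbTE ->; rewrite mul1n addn0.
rewrite (partition_big (fun s => inord (cyc_count s z (f z)) : 'I_(2 * m).+1) predT) //=.
apply: eq_bigr => a _; have am : (a <= 2 * m)%N by rewrite -ltnS.
rewrite mulr_natl -sumr_const.
have E s : oriented f s && (inord (cyc_count s z (f z)) == a) =
    (s \in closed_walks n (edge_mx f a (2 * m - a) m)).
  apply/andP/idP => [[/andP[ss so] /eqP sa]|sc]; last first.
    split; first by apply: oriented_closed sc => //; rewrite subnKC.
    by move/closed_walksP: sc => ->; rewrite entry inord_val.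
  have [a' am' E] := circulationE f0 so (walk_circ s).
  have aE : a' = a by rewrite -sa E entry inordK.
  by apply/closed_walksP => u v; rewrite E aE.
apply: eq_big => [s|s]; first exact: E.
rewrite E => /closed_walksP sc; rewrite (eq_walk_moment C m sc).
by apply: walk_moment_cycle => //; rewrite subnKC.
Qed.

(* The factor that a cycle of length [k] contributes. *)
Definition core_coef (k : nat) : C :=
  if k == 1%N then (2 * m)%:R^-1
  else if k == 2 then pair_moment C m (2 * m) (2 * m) / (2 * m)%:R
  else 2^-1 * \sum_(a < (2 * m).+1 | index_pair m a (2 * m - a))
     ((2 * m).-1`!%:R / (a`!%:R * (2 * m - a)`!%:R)) ^+ k *
     (\sum_(j < k) (2 * m - a) ^ j * a ^ (k.-1 - j))%N%:R.

Let card_closed f a b kappa := @card_closed_edge C 'I_r f a b m kappa m0.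

(** For short cycles of length [k], [((2 * m - 1)!/(2 * m)!)^k] is [(2 * m)^(-k)], and the tree
    factor [(2 * m)^(k - 1)] leaves [1/(2 * m)]. *)
Lemma core_sum f : core f != set0 ->
  (orientation_number #|core f|)^-1 * (\sum_(s | oriented f s) W (cyc_count s)) / n%:R =
  core_coef #|core f| * weight f.
Proof.
move=> f0; have /set0Pn[z zc] := f0; have k0 := card_core_gt0 zc.
have f20 : ((2 * m).-1`!)%N%:R / ((2 * m)`!)%N%:R = (2 * m)%:R^-1 :> C.
  have -> : ((2 * m)`! = 2 * m * (2 * m).-1`!)%N.
    by rewrite -{1}(@prednK (2 * m)%N) ?factS ?prednK // muln_gt0.
  have : ((2 * m).-1`!)%N%:R != 0 :> C by rewrite pnatr_eq0 -lt0n fact_gt0.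
  have : (2 * m)%:R != 0 :> C by rewrite pnatr_eq0; lia.
  by rewrite [in X in _ / X]natrM; move: ((2 * m)%:R : C) (_%:R : C) => x y x0 y0; field; rewrite x0.
have [k2|k3] := leqP #|core f| 2.
  rewrite sum_oriented_small // /orientation_number k2 invr1 mul1r mulrAC.
  have := @card_closed f (2 * m)%N 0%N ((2 * m) ^ #|core f|.-1)%N (addn0 _) f0 isT.
  rewrite card_ord => -> => [|x xc]; last first.
    by rewrite arb_sum_edge_small // addn0 card_ord.
  rewrite fact0 mulr1 f20 /core_coef.
  case: #|core f| k0 k2 (@walk_moment_loop C m r m0 f f0) (@walk_moment_double C m r m0 f f0) =>
    [|[|[|k]]] //= _ _ H1 H2.
    by rewrite H1 // expr1 expn0 !mulr1 mulrC.
  have mN : (2 * m)%:R != 0 :> C by rewrite pnatr_eq0; lia.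
  by rewrite H2 // expn1; move: ((2 * m)%:R : C) mN => x xN; field.
rewrite sum_oriented_cycle // /orientation_number leqNgt k3 /= /core_coef.
rewrite [_ == 1%N]gtn_eqF 1?ltnW // [_ == 2]gtn_eqF // -!mulrA; congr (_ * _).
rewrite mulr_suml mulr_suml [RHS]big_mkcond; apply: eq_bigr => a _ /=.
have am : (a <= 2 * m)%N by rewrite -ltnS.
have := @card_closed f a (2 * m - a)%N
   (\sum_(j < #|core f|) (2 * m - a) ^ j * a ^ (#|core f|.-1 - j))%N (subnKC am) f0.
rewrite k3 orbT card_ord => H; rewrite [LHS]mulrAC {}H //; last first.
  by move=> x xc; rewrite arb_sum_edge // card_ord.
by case: ifP => _; rewrite ?mulr0 // mulr1 [RHS]mulrC mulrA.
Qed.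

Lemma surjective_sumE :
  surjective_sum C m n r / (n%:R * (r`!)%N%:R) =
  \sum_(k < r) core_coef k.+1 / k.+1%:R *
    (tree_egf (block_weight C m (2 * m)) (block_weight C m m) ^+ k.+1) (r - k.+1)%N.
Proof.
rewrite surjective_sum_orientations invfM mulrA mulr_suml.
rewrite (eq_bigr (fun f => core_coef #|core f| * weight f)) => [|f f0]; last exact: core_sum.
(* The default of [insubd] is never taken, since a nonempty cycle has at most [r] vertices. *)
rewrite (partition_big (fun f => insubd (Ordinal r0) #|core f|.-1) predT) //= mulr_suml.
apply: eq_bigr => k _.
have kE f : (core f != set0) && (insubd (Ordinal r0) #|core f|.-1 == k) = (#|core f| == k.+1).
  rewrite -card_gt0; have : (#|core f| <= r)%N by rewrite -[X in (_ <= X)%N]card_ord max_card.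
  by case: #|core f| => //= c cr; rewrite -val_eqE val_insubd cr eqSS.
rewrite (eq_bigl _ _ kE) (eq_bigr (fun f => core_coef k.+1 * weight f)) => [|f /eqP -> //].
have := endo_sum 'I_r (block_weight C m (2 * m)) (block_weight C m m) k.
rewrite card_ord ltn_ord -mulr_sumr; move: (\sum_(f | _) _) => S SE.
have rN : (r`!)%N%:R != 0 :> C by rewrite pnatr_eq0 -lt0n fact_gt0.
have kN : k.+1%:R != 0 :> C by rewrite pnatr_eq0.
rewrite -!mulrA; congr (_ * _); apply: (mulfI kN); rewrite mulrA SE.
by rewrite mulVKf // mulrAC divff ?mul1r.
Qed.

End CoreSum.

(** * Summation over the cycle length *)

Section Series.
Variable K : fieldType.
Implicit Types (f g u : fps K) (c : K).

Lemma fps_addE f g n : (f + g) n = f n + g n. Proof. by []. Qed.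

Lemma fps_subE f g n : (f - g) n = f n - g n. Proof. by []. Qed.

Lemma fps_scaleE c f n : (c *: f) n = c * f n. Proof. by []. Qed.

Lemma fps_sum_condE (I : Type) (s : seq I) (P : pred I) (F : I -> fps K) n :
  (\sum_(i <- s | P i) F i) n = \sum_(i <- s | P i) F i n.
Proof. by rewrite -big_filter fps_sumE big_filter. Qed.

Lemma fps_mulZZ a b f g : (a *: f) * (b *: g) = (a * b) *: (f * g).
Proof.
apply: fpsP => n /=; rewrite mulr_sumr; apply: eq_bigr => j _.
by rewrite mulrACA.
Qed.

Lemma fps_exprZ c f k : (c *: f) ^+ k = c ^+ k *: f ^+ k.
Proof.
elim: k => [|k IH]; first by rewrite !expr0 scale1r.
by rewrite !exprS IH fps_mulZZ.
Qed.

Definition fps_X : fps K := Fps (fun n => (n == 1%N)%:R).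

Lemma fps_mulXE g n : (fps_X * g) n = if n is n'.+1 then g n' else 0.
Proof.
rewrite /=; case: n => [|n]; first by rewrite big_ord1 /= mul0r.
rewrite big_ord_recl /= mul0r add0r big_ord_recl /= mul1r subSS subn0.
by rewrite big1 ?addr0 // => i _; rewrite mul0r.
Qed.

Lemma fps_mulXnE g k n : (fps_X ^+ k * g) n = if (k <= n)%N then g (n - k)%N else 0.
Proof.
elim: k n => [|k IH] n; first by rewrite expr0 mul1r subn0.
by rewrite exprS -mulrA fps_mulXE; case: n => [|n] //; rewrite IH subSS.
Qed.

Lemma fps_shift_exp f g k n : (forall n, f n.+1 = g n) -> f 0%N = 0 ->
  (f ^+ k) n = if (k <= n)%N then (g ^+ k) (n - k)%N else 0.
Proof.
move=> fS f0; have -> : f = fps_X * g.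
  by apply: fpsP => -[|l]; rewrite fps_mulXE.
by rewrite exprMn fps_mulXnE.
Qed.

(** It writes a single power in the form of a substitution, so that all terms of the final formula
    become one sum over [k]. *)
Lemma fps_exp_pick u n j : u 0%N = 0 ->
  \sum_(k < n.+1) (val k == j)%:R * (u ^+ k) n = (u ^+ j) n.
Proof.
move=> u0; have [jn|nj] := leqP j n; last first.
  rewrite fps_exp_small // big1 // => k _; case: eqP => [kj|_]; last by rewrite mul0r.
  by have := ltn_ord k; rewrite ltnS leqNgt -[nat_of_ord k]/(val k) kj nj.
rewrite (bigD1 (Ordinal (jn : (j < n.+1)%N))) //= eqxx mul1r big1 ?addr0 // => k kj.
by rewrite (negbTE (_ : val k != j)) ?mul0r // -[j]/(val (Ordinal (jn : (j < n.+1)%N))) val_eqE.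
Qed.

Lemma fps_geom_tail u n : u 0%N = 0 ->
  (u ^+ 3 / (1 - u)) n = \sum_(k < n.+1) (2 < k)%N%:R * (u ^+ k) n.
Proof.
move=> u0; have G := fps_geom u0; set h := fps_comp _ u in G.
have -> : u ^+ 3 / (1 - u) = h - (u ^+ 0 + u ^+ 1 + u ^+ 2).
  have -> : (1 - u)^-1 = h by apply: mulr1_eq.
  (* The factor [(1 - u) * h] is 1, and [1 - (1 - u) * (1 + u + u ^+ 2)] is [u ^+ 3]. *)
  have -> : h - (u ^+ 0 + u ^+ 1 + u ^+ 2) = h - ((1 - u) * h) * (1 + u + u ^+ 2).
    by rewrite G mul1r expr0 expr1.
  by ring.
transitivity (h n - ((u ^+ 0) n + (u ^+ 1) n + (u ^+ 2) n)); first by [].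
rewrite -(fps_exp_pick n 0 u0) -(fps_exp_pick n 1 u0) -(fps_exp_pick n 2 u0).
rewrite -!big_split -sumrB; apply: eq_bigr => k _ /=.
rewrite -!mulrDl -mulrBl; congr (_ * _).
by case: (val k) => [|[|[|l]]] /=; rewrite ?addr0 ?add0r ?subrr ?subr0.
Qed.

End Series.

(** * The contribution of a cycle in terms of beta *)

Section Coefficients.
Variables (C : numClosedFieldType) (m : nat).
Hypothesis m0 : (0 < m)%N.
Local Notation beta := (beta C m).

Let mN : m%:R != 0 :> C. Proof. by rewrite pnatr_eq0 -lt0n. Qed.
Let m2N : (2 * m)%:R != 0 :> C. Proof. by rewrite pnatr_eq0 muln_eq0 -lt0n. Qed.

Definition cycle_term k a : C :=
  ((2 * m).-1`!%:R / (a`!%:R * (2 * m - a)`!%:R)) ^+ k *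
  (\sum_(j < k) (2 * m - a) ^ j * a ^ (k.-1 - j))%N%:R.

Let ratio a : C := 'C(2 * m, a)%:R / (2 * m)%:R.

Let ratioE a : (a <= 2 * m)%N ->
  ((2 * m).-1`!)%N%:R / ((a`!)%N%:R * ((2 * m - a)`!)%N%:R) = ratio a.
Proof.
move=> am; have := bin_fact am.
have -> : ((2 * m)`! = 2 * m * (2 * m).-1`!)%N.
  by rewrite -{1}(@prednK (2 * m)%N) ?factS ?prednK // muln_gt0.
move=> /(congr1 (fun n => n%:R : C)); rewrite [LHS]natrM [in LHS]natrM [RHS]natrM.
have : (a`!)%N%:R != 0 :> C by rewrite pnatr_eq0 -lt0n fact_gt0.
have : ((2 * m - a)`!)%N%:R != 0 :> C by rewrite pnatr_eq0 -lt0n fact_gt0.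
rewrite /ratio; move: ((2 * m)%:R : C) m2N ('C(_, _)%:R : C).
move: (a`!%:R : C) ((2 * m - a)`!%:R : C) ((2 * m).-1`!%:R : C) => x y w z zN b yN xN E.
apply: (mulfI zN); rewrite mulrA -E; field; by rewrite xN yN zN.
Qed.

Let betaE a : beta a = a%:R * ratio a.
Proof. by rewrite /Defs.beta /ratio mulrAC mulrA. Qed.

Let ratioC a : (a <= 2 * m)%N -> ratio (2 * m - a) = ratio a.
Proof. by move=> am; rewrite /ratio bin_sub. Qed.

(** By the symmetry of the binomials, [beta a] and [beta (2 * m - a)] are [a] and [2 * m - a] times
    the same ratio. *)
Lemma cycle_term_diff k a : (a <= 2 * m)%N ->
  (a%:R - (2 * m - a)%:R) * cycle_term k a = beta a ^+ k - beta (2 * m - a)%N ^+ k.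
Proof.
move=> am; rewrite /cycle_term ratioE // !betaE ratioC // !exprMn -mulrBl subrXX.
rewrite natr_sum mulrCA mulrC; congr (_ * _ * _); apply: eq_bigr => j _.
by rewrite [LHS]natrM mulrC; congr (_ * _); exact: natrX.
Qed.

Lemma cycle_term_mid k : cycle_term k m = k%:R * beta m ^+ k / m%:R.
Proof.
have mm : (2 * m - m = m)%N by lia.
rewrite /cycle_term ratioE ?mm; last by lia.
have -> : (\sum_(j < k) m ^ j * m ^ (k.-1 - j) = k * m ^ k.-1)%N.
  rewrite (eq_bigr (fun=> (m ^ k.-1)%N)) => [|j _]; first by rewrite sum_nat_const card_ord.
  by rewrite -expnD subnKC //; have := ltn_ord j; lia.
case: k => [|k]; first by rewrite mul0n !mul0r mulr0.
rewrite betaE [(k.+1 * _)%:R]natrM natrX /=; move: (ratio m) => r.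
by move: (m%:R : C) mN => x xN; rewrite exprMn [x ^+ k.+1]exprS; field.
Qed.

(** [b] is forced to be [2 * m - a]. The term [a = m], where [k] equal summands cancel the division
    by [k], is the geometric part; the others are the logarithmic part. *)
Lemma core_coef_cycle k : (2 < k)%N -> core_coef C m k / k%:R =
  (2 * m)%:R^-1 * beta m ^+ k +
  \sum_(a < (2 * m).+1) \sum_(b < (2 * m).+1 | index_pair m a b && (a != b))
     (2%:R * (a%:R - b%:R))^-1 * (k%:R^-1 * (beta a ^+ k - beta b ^+ k)).
Proof.
move=> k3; have kN : k%:R != 0 :> C by rewrite pnatr_eq0; lia.
rewrite /core_coef [k == 1%N]gtn_eqF 1?ltnW // [k == 2]gtn_eqF //.
have mlt : (m < (2 * m).+1)%N by lia.
pose mid : 'I_(2 * m).+1 := Ordinal mlt.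
have subE (a : 'I_(2 * m).+1) : (2 * m - a)%N = rev_ord a by rewrite /= subSS.
rewrite (bigD1 mid) /=; last by rewrite index_pair_odd; lia.
rewrite mulrDr mulrDl; congr (_ + _).
  rewrite -[_ * _%:R]/(cycle_term k m) cycle_term_mid natrM.
  move: (m%:R : C) (k%:R : C) mN kN => x y xN yN; field; by rewrite xN yN.
rewrite mulr_sumr mulr_suml [LHS]big_mkcond; apply: eq_bigr => a _.
have am : (a <= 2 * m)%N by rewrite -ltnS.
rewrite -[_ * _%:R]/(cycle_term k a).
have revE : (a != rev_ord a) = (a != mid) by rewrite -!val_eqE /=; lia.
case: ifP => [/andP[ip aN]|ipN].
  rewrite (big_pred1 (rev_ord a)) => [|b]; last first.
    apply/andP/eqP => [[/andP[/eqP ab _] _]|->]; first by apply: val_inj => /=; lia.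
    by rewrite revE -subE ip aN.
  rewrite -subE -cycle_term_diff //.
  have dN : a%:R - (2 * m - a)%:R != 0 :> C.
    rewrite subr_eq0 eqr_nat; apply: contraNneq aN => E; apply/eqP/val_inj => /=; lia.
  move: (cycle_term k a) (a%:R - _) dN (k%:R : C) kN => x y yN w wN.
  by field; rewrite yN wN.
rewrite big_pred0 // => b; apply/negbTE; apply: contraFN ipN.
case/andP => ip ab; have bE : b = rev_ord a.
  by move: ip => /andP[/eqP ab' _]; apply: val_inj => /=; lia.
by rewrite bE -subE in ip; rewrite ip -revE -bE.
Qed.

End Coefficients.

Theorem theorem5p2 (C : numClosedFieldType) (m : nat) (hm : (0 < m)%N) :
  let F : fps C := tree_series C m (2 * m) in
  fps_map ratr (genus_series C m 1) =
    (2 * m)%:R^-1 *: F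
    + (zzbar_moment C m (2 * m) / (4 * m)%:R) *: F ^+ 2
    + (2 * m)%:R^-1 *: ((beta C m m *: F) ^+ 3 / (1 - beta C m m *: F))
    + \sum_(a < (2 * m).+1) \sum_(b < (2 * m).+1 | index_pair m a b && (a != b))
        (2%:R * (a%:R - b%:R))^-1 *:
          (fps_log_ge 3 (beta C m a *: F) - fps_log_ge 3 (beta C m b *: F)).
Proof.
move=> F; apply: fpsP => n.
have F0 : F 0%N = 0 by [].
have bF0 c : (c *: F) 0%N = 0 by rewrite /= mulr0.
pose A := tree_egf (block_weight C m (2 * m)) (block_weight C m m).
(* The weight of a cycle vertex, with [2 * m] steps leaving it along the cycle, is that of a tree
   root with compositions into [2 * m] parts. *)
have FS v : F v.+1 = A v.
  have m2 : (2 * m = (2 * m).-1.+1)%N by rewrite prednK // muln_gt0.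
  by rewrite /A m2 tree_egfE // -m2.
(* The right side as a power series in [F]: [D k] is the coefficient of [F ^+ k], to be matched with
   the contribution of cycles of length [k]. *)
pose D k : C := (2 * m)%:R^-1 * (k == 1%N)%:R
  + zzbar_moment C m (2 * m) / (4 * m)%:R * (k == 2)%:R
  + (2 * m)%:R^-1 * ((2 < k)%N%:R * beta C m m ^+ k)
  + \sum_(a < (2 * m).+1) \sum_(b < (2 * m).+1 | index_pair m a b && (a != b))
     (2%:R * (a%:R - b%:R))^-1 *
       ((if (2 < k)%N then k%:R^-1 else 0) * (beta C m a ^+ k - beta C m b ^+ k)).
transitivity (\sum_(k < n.+1) D k * (F ^+ k) n); last first.
  rewrite !fps_addE !fps_scaleE /D; under eq_bigr do rewrite !mulrDl.
  rewrite !big_split -[X in _ * X + _ + _ + _]expr1.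
  congr (_ + _ + _ + _).
  - rewrite -(fps_exp_pick n 1 F0) mulr_sumr.
    by apply: eq_bigr => k _; rewrite mulrA.
  - rewrite -(fps_exp_pick n 2 F0) mulr_sumr.
    by apply: eq_bigr => k _; rewrite mulrA.
  - rewrite fps_geom_tail // mulr_sumr; apply: eq_bigr => k _.
    by rewrite fps_exprZ fps_scaleE !mulrA.
  under eq_bigr do rewrite mulr_suml.
  rewrite fps_sum_condE [LHS]exchange_big; apply: eq_bigr => a _.
  under eq_bigr do rewrite mulr_suml.
  rewrite fps_sum_condE [LHS]exchange_big; apply: eq_bigr => b _.
  symmetry; rewrite fps_scaleE fps_subE /= -sumrB mulr_sumr; apply: eq_bigr => k _.
  rewrite !fps_exprZ !fps_scaleE -!mulrA; congr (_ * _).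
  by rewrite mulrBl mulrBr.
have D0 : D 0%N = 0.
  rewrite /D /= !mulr0 mul0r mulr0 !add0r big1 // => a _; rewrite big1 // => b _.
  by rewrite mul0r mulr0.
have DE k : D k.+1 = core_coef C m k.+1 / k.+1%:R.
  case: k => [|[|k]]; last 1 first.
  - by rewrite core_coef_cycle // /D !mulr0 !add0r mul1r.
  - rewrite /D /core_coef /= !mulr0 !mulr1 mul0r mulr0 !addr0 divr1 big1 ?addr0 // => a _.
    by rewrite big1 // => b _; rewrite mul0r mulr0.
  rewrite /D /core_coef /= !mulr0 mulr1 mul0r mulr0 add0r addr0.
  rewrite zzbar_pair_moment // big1 ?addr0 => [|a _]; last first.
    by rewrite big1 // => b _; rewrite mul0r mulr0.
  by rewrite -mulrA -invfM -natrM mulnAC.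
case: n => [|r]; first by rewrite big_ord1 D0 mul0r /= raddf0.
rewrite big_ord_recl D0 mul0r add0r [LHS]/= add0n.
have n0 : (0 < 2 * m * r.+1)%N by rewrite !muln_gt0 hm.
rewrite alphaE // surjective_sumE //; apply: eq_bigr => k _.
by rewrite DE (fps_shift_exp _ _ FS F0) /= ltn_ord subSS.
Qed.
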